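(* Let $q\ge0$, $x,y\ge0$ be real with $\max\{1,q\}\,xy<1$, and for integers $M,N\ge1$ let $L=MN$, $X=(x,\dots,x)$ ($M$ entries), $Y=(y,\dots,y)$ ($N$ entries), $a=qxy$, $b=xy$. Let $(\mu,\lambda)$ be a random pair of strict partitions with law $$\mathbb P_q^{X,Y}(\mu,\lambda)=\frac{Q_\mu(qX)Q_{\lambda/\mu}(X)P_\lambda(Y)}{\mathsf H(qX;Y)\mathsf H(X;Y)}\quad\text{if }\mu\subseteq\lambda$$ and $0$ otherwise, and set $B=|\mu|$, $R=|\lambda|-|\mu|$. Assume $0<a,b<1$ are fixed and $L\to\infty$. Then $$\frac{B-\dfrac{2La}{1-a^2}}{\sqrt{\dfrac{2La(1+a^2)}{(1-a^2)^2}}}\Longrightarrow N(0,1),\qquad \frac{R-\dfrac{2Lb}{1-b^2}}{\sqrt{\dfrac{2Lb(1+b^2)}{(1-b^2)^2}}}\Longrightarrow N(0,1),$$ and the two limiting normal random variables are independent (i.e. the pair converges jointly in distribution to a pair of independent standard normals).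
   Context: $\Longrightarrow$ denotes convergence in distribution. $|\lambda|$ is the sum of the parts of $\lambda$; $\mu\subseteq\lambda$ means $\mu_i\le\lambda_i$ for all $i$ after appending zeros. For an alphabet $A$, $p_n(A)$ is the $n$-th power sum. $A+B$ denotes the union of alphabets, so $p_n(A+B)=p_n(A)+p_n(B)$; $qX$ is the alphabet with entries multiplied by $q$. Schur $Q$- and $P$-functions are the standard ones (Macdonald, Ch. III.8): with $\sum_{r\ge0}q_r(A)z^r=\prod_{a\in A}\frac{1+az}{1-az}$, one has $Q_{(r)}=q_r$, $Q_{(r,s)}=q_rq_s+2\sum_{i\ge1}(-1)^iq_{r+i}q_{s-i}$ for $r>s\ge0$, and $Q_\lambda$ is the Pfaffian of the skew-symmetric matrix with upper entries $Q_{(\lambda_i,\lambda_j)}$, $i<j$ (a zero part is appended to $\lambda$ if its length is odd); $P_\lambda=2^{-\ell(\lambda)}Q_\lambda$. Skew $Q$-functions are determined by $Q_\lambda(A+B)=\sum_{\mu\subseteq\lambda}Q_{\lambda/\mu}(A)Q_\mu(B)$. $\mathsf H(A;B)=\exp\Big(2\sum_{n\ge1,\ n\text{ odd}}\frac{p_n(A)p_n(B)}{n}\Big)$, which for finite alphabets equals $\prod_{a\in A,b\in B}\frac{1+ab}{1-ab}$. *)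

(* Defs.v *)
From mathcomp Require Import all_boot all_order perm all_algebra.
From mathcomp Require Import all_classical all_reals all_analysis.

Set Implicit Arguments.
Unset Strict Implicit.
Unset Printing Implicit Defensive.

Import Order.TTheory GRing.Theory Num.Theory.
Import numFieldNormedType.Exports.

Local Open Scope classical_set_scope.
Local Open Scope ring_scope.

(* A strict partition is the decreasing list of its nonzero parts, so that
   l(lam) = size lam, |lam| = sumn lam and lam_i = nth 0 lam i. *)
Definition is_strict_part (s : seq nat) : bool := sorted gtn s && (0%N \notin s).

Definition strict_part : Type := {s : seq nat | is_strict_part s}.

Definition parts (lam : strict_part) : seq nat := sval lam.
Coercion parts : strict_part >-> seq.

(* The inequality holds trivially for i >= size mu. *)
Definition part_sub (mu lam : seq nat) : bool :=
  all (fun i => nth 0%N mu i <= nth 0%N lam i)%N (iota 0 (size mu)).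

(* Pf A = (2^m m!)^-1 sum_s sgn(s) prod_(i < m) A_(s(2i), s(2i+1)). *)
Section Pfaffian.
Variables (R : fieldType) (m : nat).

Definition pf_even (i : 'I_m) : 'I_m.*2 :=
  Ordinal (etrans (ltn_double i m) (ltn_ord i)).
Definition pf_odd (i : 'I_m) : 'I_m.*2 :=
  Ordinal (etrans (ltn_Sdouble i m) (ltn_ord i)).

Definition pfaffian (A : 'M[R]_(m.*2)) : R :=
  ((2 ^ m * m`!)%:R)^-1 *
  \sum_(s : 'S_(m.*2))
     (-1) ^+ s * \prod_(i < m) A (s (pf_even i)) (s (pf_odd i)).

End Pfaffian.

(* Finite alphabets are lists of scalars; the union is concatenation. *)
Section SchurQ.
Variable R : realType.
Implicit Types (A B : seq R) (lam mu : strict_part).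

Definition scale_alphabet (q : R) A : seq R := [seq q * a | a <- A].

Definition power_sum (n : nat) A : R := \sum_(a <- A) a ^+ n.

(* Coefficient of z^r in prod_a (1 + a z) / (1 - a z); each factor equals
   1 + 2 sum_(i >= 1) a^i z^i and may be truncated at degree r. *)
Definition schur_q (r : nat) A : R :=
  (\prod_(a <- A) \poly_(i < r.+1) (if i == 0%N then 1 else 2 * a ^+ i))`_r.

(* The terms with i > s vanish, since q_n = 0 for n < 0. *)
Definition schur_Q2 (r s : nat) A : R :=
  schur_q r A * schur_q s A +
  2 * \sum_(1 <= i < s.+1) (-1) ^+ i * schur_q (r + i) A * schur_q (s - i) A.

(* The matrix has size l(lam) or l(lam) + 1, whichever is even; in the second
   case nth returns the zero part appended to lam. *)
Definition schur_Q lam A : R :=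
  pfaffian (\matrix_(i < (uphalf (size lam)).*2, j < (uphalf (size lam)).*2)
    if (i < j)%N then schur_Q2 (nth 0%N lam i) (nth 0%N lam j) A
    else if (j < i)%N then - schur_Q2 (nth 0%N lam j) (nth 0%N lam i) A
    else 0).

Definition schur_P lam A : R := 2 ^- size lam * schur_Q lam A.

(* S lam mu A = Q_{lam/mu}(A).  As B varies the Q_mu(B) are linearly
   independent, so the values S lam mu A with mu included in lam, the only ones
   constrained and the only ones used below, are determined uniquely. *)
Definition is_skew_schur_Q (S : strict_part -> strict_part -> seq R -> R) : Prop :=
  forall lam A B,
    schur_Q lam (A ++ B) =
    \sum_(mu \in [set mu : strict_part | part_sub mu lam])
       S lam mu A * schur_Q mu B.

Definition HH A B : R :=
  expR (2 * limn (fun k =>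
    \sum_(1 <= n < k | odd n) power_sum n A * power_sum n B / n%:R)).

Definition PqXY (S : strict_part -> strict_part -> seq R -> R)
    (q : R) (X Y : seq R) (p : strict_part * strict_part) : R :=
  let: (mu, lam) := p in
  if part_sub mu lam then
    schur_Q mu (scale_alphabet q X) * S lam mu X * schur_P lam Y /
    (HH (scale_alphabet q X) Y * HH X Y)
  else 0.

End SchurQ.

Section Probability.
Variable R : realType.

(* For countable T: Z is a random element of the discrete space T with
   probability mass function w. *)
Definition has_law (d : measure_display) (Omega : measurableType d)
    (P : probability Omega R) (T : Type) (Z : Omega -> T) (w : T -> R) : Prop :=
  forall t : T, measurable (Z @^-1` [set t]) /\ P (Z @^-1` [set t]) = (w t)%:E.

Definition lower_quadrant (z : R * R) : set (R * R) :=
  [set u | u.1 <= z.1 /\ u.2 <= z.2].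

(* Convergence in distribution of random vectors in R^2, each on its own
   probability space: the joint distribution functions converge to that of nu
   at each continuity point of the latter. *)
Definition cvg_in_distribution2 (d : nat -> measure_display)
    (Omega : forall k, measurableType (d k))
    (P : forall k, probability (Omega k) R)
    (Z : forall k, Omega k -> R * R) (nu : set (R * R) -> \bar R) : Prop :=
  let F := fun z => nu (lower_quadrant z) in
  forall z, {for z, continuous F} ->
    (fun k => P k (Z k @^-1` lower_quadrant z)) @ \oo --> F z.

End Probability.

(* Main.v *)
From HB Require Import structures.
Require Import Defs.
From mathcomp Require Import all_boot all_order perm all_algebra.
From mathcomp Require Import all_classical all_reals all_analysis.
From mathcomp Require Import ring lra zify.

Set Implicit Arguments.
Unset Strict Implicit.
Unset Printing Implicit Defensive.

(** The sizes of the random pair are independent, and each is a sum of L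
    independent variables of one simple law; this is seen by summing the law
    over all pairs of given sizes.  The computation rests on the graded Cauchy
    identity (schur_Cauchy)
      sum_(|lam| = n) Q_lam(A) P_lam(B) = [w^n] prod_(a, b) (1 + abw) / (1 - abw).
    With the alphabet X + z q X in place of A and Y in place of B, the defining
    property of the skew functions and the homogeneity of Q_mu expand the left
    side in powers of z; comparing coefficients gives (skew_pair_sum)
      sum_(|mu| = i, |lam| = n) Q_mu(qX) Q_(lam/mu)(X) P_lam(Y) = c_i d_(n - i),
    where c_i and d_j are the coefficients of ((1 + aw) / (1 - aw))^L and of
    ((1 + bw) / (1 - bw))^L.  So |mu| and |lam| - |mu| are independent sums of L
    variables with generating function proportional to (1 + aw) / (1 - aw),
    resp. (1 + bw) / (1 - bw) (size_law, pair_prob).  The value of the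
    normalising constant comes from the total probability being one.

    Cauchy identity.  As Q_lam is given by a Pfaffian, the identity is proved by
    adding one variable a to A at a time.  The infinite antisymmetric matrix
    M_A(r, s) = Q_(r, s)(A) obeys M_(a + A) = T M_A T^t + (T e_0 /\ e_0), T being
    the Toeplitz matrix of (1 + aw) / (1 - aw) (schur_M_branch).  The sum over
    strict partitions is a sum over even subsets S of {0, ..., n} of products of
    two sub-Pfaffians, one of M_A and one of a rescaled M_B; 0 serves as padding
    part.  In this sum the rank-two perturbation contributes linearly
    (iter_pair_op_rank2), because inserting the same two labels twice kills an
    alternating function.  On the side of B the two resulting terms are
    recombined by a Pieri rule (pieri_schur), an instance of an identity for
    bordered Pfaffians (pieri_rank2): together they multiply the sum by
    prod_(b in B) (1 + abw) / (1 - abw).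

    Central limit theorem.  With Phi the normal distribution function, the
    functions x |-> Phi (x / sqrt s) solve the heat equation in (s, x).  Lindeberg
    replacement with these test functions (step_bound, lindeberg) bounds
    E Phi ((z - W) / eps) - Phi (z / sqrt (1 + eps^2)) for the standardized sum W,
    and a sandwich between shifted copies of Phi passes to the indicator of
    W <= z (normal_approx, central_limit). *)

Import Order.TTheory GRing.Theory Num.Theory.
Import numFieldNormedType.Exports.

Local Open Scope ring_scope.

(** * Alternating sums over pairings *)

Section PfaffianSum.
Variable K : comNzRingType.

(** The Pfaffian without its normalisation, which makes sense over any
    commutative ring. *)
Definition pfsum m (A : 'I_m.*2 -> 'I_m.*2 -> K) : K :=
  \sum_(s : 'S_(m.*2))
     (-1) ^+ s * \prod_(i < m) A (s (pf_even i)) (s (pf_odd i)).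

Lemma eq_pfsum m (A B : 'I_m.*2 -> 'I_m.*2 -> K) :
  (forall i j, i != j -> A i j = B i j) -> pfsum A = pfsum B.
Proof.
move=> AB; apply: eq_bigr => s _; congr (_ * _); apply: eq_bigr => i _.
by apply: AB; rewrite (inj_eq perm_inj) -val_eqE /= ltn_eqF.
Qed.

(** Relabelling by t only permutes the summands, up to the sign of t. *)
Lemma pfsum_perm m (A : 'I_m.*2 -> 'I_m.*2 -> K) (t : 'S_(m.*2)) :
  pfsum (fun i j => A (t i) (t j)) = (-1) ^+ t * pfsum A.
Proof.
rewrite /pfsum big_distrr /= [RHS](reindex_inj (mulIg t)) /=.
apply: eq_bigr => s _; rewrite odd_permM mulrA -signr_addb addbA addbAC addbb.
by rewrite addFb; congr (_ * _); apply: eq_bigr => i _; rewrite !permM.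
Qed.

(** Equal rows i0 and j0: composing with the transposition of i0 and j0
    pairs the summands off with opposite signs. *)
Lemma pfsum_alt m (A : 'I_m.*2 -> 'I_m.*2 -> K) i0 j0 : i0 != j0 ->
  (forall j, A i0 j = A j0 j) -> (forall j, A j i0 = A j j0) -> pfsum A = 0.
Proof.
move=> neq_ij Al Ar; pose t := tperm i0 j0.
have At x y : A (t x) (t y) = A x y.
  rewrite /t; case: tpermP => [->|->|_ _]; case: tpermP => [->|->|_ _] //;
    by rewrite ?Al ?Ar.
have oddMt s: (s * t)%g = ~~ s :> bool.
  by rewrite odd_permM odd_tperm neq_ij addbT.
rewrite [pfsum A](bigID (@odd_perm _)) /=.
apply: canLR (subrK _) _; rewrite add0r -sumrN.
rewrite (reindex_inj (mulIg t)); apply: eq_big => //= s.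
rewrite oddMt => /negPf->; rewrite mulN1r mul1r; congr (- _).
by apply: eq_bigr => /= i _; rewrite !permM At.
Qed.

Lemma pf_index m (p : 'I_m.*2) :
  exists i : 'I_m, p = pf_even i \/ p = pf_odd i.
Proof.
have hp : (p./2 < m)%N.
  rewrite -ltn_double (leq_ltn_trans _ (ltn_ord p)) //.
  by rewrite -[leqRHS]odd_double_half leq_addl.
exists (Ordinal hp); have := odd_double_half p; case e1: (odd p) => /= e.
- by right; apply/val_inj; rewrite /= -[in LHS]e add1n.
- by left; apply/val_inj; rewrite /= -[in LHS]e add0n.
Qed.

(** Each summand contains exactly one entry with index k, so the sum is
    linear in row and column k taken together. *)
Lemma pfsum_linear m (I : finType) (c : I -> K)
    (A : 'I_m.*2 -> 'I_m.*2 -> K) (B : I -> 'I_m.*2 -> 'I_m.*2 -> K) k :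
  (forall x i j, i != k -> j != k -> B x i j = A i j) ->
  (forall j, j != k -> A k j = \sum_x c x * B x k j) ->
  (forall j, j != k -> A j k = \sum_x c x * B x j k) ->
  pfsum A = \sum_x c x * pfsum (B x).
Proof.
move=> AB Al Ar.
under [RHS]eq_bigr => x _ do rewrite /pfsum big_distrr /=.
rewrite exchange_big /=; apply: eq_bigr => s _.
under [RHS]eq_bigr => x _ do rewrite mulrCA.
rewrite -big_distrr /=; congr (_ * _).
have [p sp] : exists p, s p = k by exists (s^-1%g k); rewrite permKV.
have [i0 pi0] := pf_index p.
have other x i : i != i0 ->
    B x (s (pf_even i)) (s (pf_odd i)) = A (s (pf_even i)) (s (pf_odd i)).
  move=> ne; apply: AB; rewrite -sp (inj_eq perm_inj) -val_eqE;
    by case: pi0 => ->; rewrite /= ?eqSS ?(inj_eq double_inj) //;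
       apply/eqP => /(congr1 odd); rewrite /= !odd_double.
rewrite (bigD1 i0) //=.
under [RHS]eq_bigr => x _.
  rewrite (bigD1 i0) //=.
  under eq_bigr => i ne do rewrite (other x i ne).
  rewrite mulrA.
  over.
rewrite -big_distrl /=; congr (_ * _).
case: pi0 => epi; move: sp; rewrite epi => sp.
- rewrite !sp Al // -sp (inj_eq perm_inj) -val_eqE /= neq_ltn ltnS leqnn orbT //.
- rewrite !sp Ar // -sp (inj_eq perm_inj) -val_eqE /= neq_ltn ltnS leqnn //.
Qed.

End PfaffianSum.

Section PfaffianEntry.
Variable K : comNzRingType.

Definition pfterm m (A : 'I_m.*2 -> 'I_m.*2 -> K) (s : 'S_(m.*2)) : K :=
  (-1) ^+ s * \prod_(i < m) A (s (pf_even i)) (s (pf_odd i)).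

Lemma pf_even_odd m (i j : 'I_m) : (pf_even i == pf_odd j) = false.
Proof.
by rewrite -val_eqE /=; apply/eqP => /(congr1 odd); rewrite /= !odd_double.
Qed.

Lemma pf_odd_even m (i j : 'I_m) : (pf_odd j == pf_even i) = false.
Proof. by rewrite eq_sym pf_even_odd. Qed.

Lemma pf_even_eq m (i j : 'I_m) : (pf_even i == pf_even j) = (i == j).
Proof. by rewrite -!val_eqE /= (inj_eq double_inj). Qed.

Lemma pf_odd_eq m (i j : 'I_m) : (pf_odd i == pf_odd j) = (i == j).
Proof. by rewrite -!val_eqE /= eqSS (inj_eq double_inj). Qed.

Definition pf_indexE := (pf_even_odd, pf_odd_even, pf_even_eq, pf_odd_eq).

Lemma pfterm_flip m (A : 'I_m.*2 -> 'I_m.*2 -> K) i (s : 'S_(m.*2)) :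
  (forall i j, A i j = - A j i) ->
  pfterm A (tperm (pf_even i) (pf_odd i) * s)%g = pfterm A s.
Proof.
move=> AN; rewrite /pfterm odd_permM odd_tperm pf_even_odd /=.
rewrite (bigD1 i) //= [in RHS](bigD1 i) //= !permM tpermL tpermR AN.
rewrite [in LHS](eq_bigr (fun j => A (s (pf_even j)) (s (pf_odd j)))); last first.
  by move=> j ne; rewrite !permM !tpermD ?pf_indexE // eq_sym.
by case: (odd_perm s); rewrite /= ?expr0 ?expr1 ?mulN1r ?mul1r !mulNr ?opprK.
Qed.

(** Exchanges the i-th and j-th pairs of positions. *)
Definition pf_swap m (i j : 'I_m) : 'S_(m.*2) :=
  (tperm (pf_even i) (pf_even j) * tperm (pf_odd i) (pf_odd j))%g.

Lemma pf_swap_even m (i j k : 'I_m) :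
  pf_swap i j (pf_even k) = pf_even (tperm i j k).
Proof.
rewrite permM; case: (tpermP i j k) => [->|->|/eqP ki /eqP kj].
- by rewrite tpermL tpermD ?pf_indexE.
- by rewrite tpermR tpermD ?pf_indexE.
- by rewrite (tpermD (x := pf_even i)) ?tpermD ?pf_indexE // eq_sym.
Qed.

Lemma pf_swap_odd m (i j k : 'I_m) :
  pf_swap i j (pf_odd k) = pf_odd (tperm i j k).
Proof.
rewrite permM; case: (tpermP i j k) => [->|->|/eqP ki /eqP kj].
- by rewrite (tpermD (x := pf_even i)) ?pf_indexE // tpermL.
- by rewrite (tpermD (x := pf_even i)) ?pf_indexE // tpermR.
- by rewrite (tpermD (x := pf_even i)) ?tpermD ?pf_indexE // eq_sym.
Qed.

Lemma pfterm_swap m (A : 'I_m.*2 -> 'I_m.*2 -> K) i j (s : 'S_(m.*2)) :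
  pfterm A (pf_swap i j * s)%g = pfterm A s.
Proof.
rewrite /pfterm odd_permM odd_permM !odd_tperm !pf_indexE addbb addFb.
congr (_ * _); rewrite [RHS](reindex_inj (@perm_inj _ (tperm i j))) /=.
by apply: eq_bigr => k _; rewrite ![(pf_swap i j * s)%g _]permM pf_swap_even pf_swap_odd.
Qed.

(** Only the summands with u and v at partner positions feel the change of
    the entry (u, v).  There are 2 (m + 1) ordered slots for them, all of which
    contribute equally since exchanging pairs, or flipping one pair, leaves a
    summand invariant; with u and v in the last slot, what remains is a
    permutation of the other indices. *)
Lemma pfsum_entry m (A B : 'I_m.+1.*2 -> 'I_m.+1.*2 -> K) (c : K) :
  let v : 'I_m.+1.*2 := ord_max in
  let u : 'I_m.+1.*2 := lift ord_max (ord_max : 'I_(m.*2.+1)) in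
  let w (i : 'I_m.*2) : 'I_m.+1.*2 := lift ord_max (lift ord_max i) in
  (forall i j, A i j = - A j i) -> (forall i j, B i j = - B j i) ->
  (forall i j, (i != v) || (j != u) -> (i != u) || (j != v) -> B i j = A i j) ->
  B u v = A u v + c ->
  pfsum B = pfsum A + m.+1.*2%:R * c * pfsum (fun i j => A (w i) (w j)).
Proof.
move=> v u w AN BN AB Buv.
pose D (s : 'S_(m.+1.*2)) := pfterm B s - pfterm A s.
have DE : pfsum B - pfsum A = \sum_s D s by rewrite big_split /= sumrN.
apply/eqP; rewrite addrC -subr_eq DE; apply/eqP.
have vE : v = pf_odd (ord_max : 'I_m.+1) by apply/val_inj.
have uE : u = pf_even (ord_max : 'I_m.+1).
  by apply/val_inj; rewrite /= /bump leqNgt ltnSn.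
rewrite (partition_big (fun s : 'S_(m.+1.*2) => s^-1%g v) predT) //=.
(* the position of v may be moved to the last one: t brings its pair to the end
   and flips it if needed *)
have key p : \sum_(s : 'S_(m.+1.*2) | s^-1%g v == p) D s =
    \sum_(s : 'S_(m.+1.*2) | s v == v) D s.
  have [i pi] := pf_index p.
  pose t : 'S_(m.+1.*2) := (pf_swap ord_max i *
    (if p == pf_odd i then 1 else tperm (pf_even i) (pf_odd i)))%g.
  have Dt s : D (t * s)%g = D s.
    rewrite /D /t -mulgA !pfterm_swap; case: ifP; rewrite ?mul1g // => _.
    by rewrite !pfterm_flip.
  have tv : t v = p.
    rewrite vE permM pf_swap_odd tpermL; case: pi => ->; rewrite ?pf_indexE.
    - by rewrite tpermR.
    - by rewrite eqxx perm1.
  rewrite (reindex_inj (mulgI t^-1%g)) /=; apply: eq_big => s; last first.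
    by rewrite -(Dt (t^-1 * s)%g) mulVKg.
  by rewrite invgM invgK permM -{1}tv (inj_eq perm_inj) (canF_eq (permKV s)) eq_sym.
under eq_bigr => p _ do rewrite key.
rewrite sumr_const card_ord -[LHS]mulr_natl -mulrA; congr (_ * _).
rewrite (bigID (fun s : 'S_(m.+1.*2) => s u == u)) /= [X in _ + X]big1 ?addr0; last first.
  move=> s /andP[/eqP sv su]; apply/eqP; rewrite subr_eq0; apply/eqP.
  congr (_ * _); apply: eq_bigr => i _; apply: AB.
  - case: (i =P ord_max) => [->|/eqP ne]; first by rewrite -uE -vE sv neq_lift orbT.
    by rewrite -{1}sv (inj_eq perm_inj) vE pf_indexE.
  - case: (i =P ord_max) => [->|/eqP ne]; first by rewrite -uE su.
    by rewrite orbC -{1}sv (inj_eq perm_inj) vE pf_indexE ne.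
(* the permutations fixing the last two positions are those of the others *)
pose L (s : 'S_(m.*2)) : 'S_(m.+1.*2) :=
  lift_perm ord_max ord_max (lift_perm ord_max ord_max s).
have Lw s i : L s (w i) = w (s i) by rewrite !lift_perm_lift.
have Lv s : L s v = v by rewrite lift_perm_id.
have Lu s : L s u = u by rewrite lift_perm_lift lift_perm_id.
have wE i : val (w i) = val i.
  rewrite /=; have -> : bump m.*2 i = i by rewrite /bump leqNgt ltn_ord.
  by rewrite /bump leqNgt ltnS ltnW.
have winj : injective w by move=> i j /lift_inj/lift_inj.
have wP k : k != u -> k != v -> exists i, k = w i.
  move=> ku; case: (unliftP v k) => [k1 e1|->]; last by rewrite eqxx.
  move: ku; rewrite e1 (inj_eq lift_inj).
  by case: (unliftP ord_max k1) => [k2 -> _ _|->]; [exists k2|rewrite eqxx].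
have wu i : w i != u by rewrite (inj_eq lift_inj) eq_sym neq_lift.
have wv i : w i != v by rewrite eq_sym neq_lift.
have fixw (s : 'S_(m.+1.*2)) : s v = v -> s u = u ->
    forall i, exists j, s (w i) = w j.
  move=> sv su i; apply: wP.
    by apply: contra_neq (wu i) => e; apply/(@perm_inj _ s); rewrite e su.
  by apply: contra_neq (wv i) => e; apply/(@perm_inj _ s); rewrite e sv.
pose j0 (s : 'S_(m.+1.*2)) (i : 'I_m.*2) : 'I_m.*2 :=
  odflt i [pick j | s (w i) == w j].
have j0P (s : 'S_(m.+1.*2)) : s v = v -> s u = u ->
    forall i, s (w i) = w (j0 s i).
  move=> sv su i; rewrite /j0; case: pickP => [j /eqP //|no].
  by have [j e] := fixw s sv su i; move: (no j); rewrite e eqxx.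
have Lsurj (s : 'S_(m.+1.*2)) : s v = v -> s u = u -> exists s', L s' = s.
  move=> sv su; have j0_inj : injective (j0 s).
    move=> i j e; apply/winj/(@perm_inj _ s).
    by rewrite !(j0P s sv su) e.
  exists (perm j0_inj); apply/permP => k.
  have [->|ku] := eqVneq k u; first by rewrite Lu.
  have [->|kv] := eqVneq k v; first by rewrite Lv.
  by have [i ->] := wP k ku kv; rewrite Lw permE j0P.
have Linj : injective L.
  by move=> s t e; apply/permP => i; apply: winj; rewrite -!Lw e.
rewrite (eq_bigl [in [set L s | s in [set: 'S_(m.*2)]]]); last first.
  move=> s; apply/andP/imsetP => [[/eqP sv /eqP su]|[s' _ ->]].
    by have [s' <-] := Lsurj s sv su; exists s'.
  by rewrite Lv Lu.
rewrite big_imset /=; last by move=> s t _ _; exact: Linj.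
rewrite big_distrr /=; apply: eq_big => s; first by rewrite inE.
move=> _; rewrite /D /pfterm -mulrBr.
have -> : odd_perm (L s) = odd_perm s.
  by rewrite !odd_lift_perm addbb addFb addbb.
rewrite [RHS]mulrCA; congr (_ * _).
rewrite !big_ord_recr /= -uE -vE Lu Lv Buv.
have we i : pf_even (widen_ord (leqnSn m) i) = w (pf_even i).
  by apply/val_inj; rewrite [RHS]wE.
have wo i : pf_odd (widen_ord (leqnSn m) i) = w (pf_odd i).
  by apply/val_inj; rewrite [RHS]wE.
under eq_bigr => i _ do rewrite we wo !Lw AB ?wu ?wv //.
under [X in _ - X * _]eq_bigr => i _ do rewrite we wo !Lw.
by rewrite mulrDr addrAC subrr add0r mulrC.
Qed.
End PfaffianEntry.

(** Number of ways to present one perfect matching of 2 m points as a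
    permutation, inverted. *)
Definition pf_norm (R : numFieldType) (m : nat) : R := ((2 ^ m * m`!)%:R)^-1.

Lemma pf_normS (R : numFieldType) m :
  pf_norm R m.+1 * m.+1.*2%:R = pf_norm R m.
Proof.
rewrite /pf_norm.
have -> : (2 ^ m.+1 * m.+1`! = 2 ^ m * m`! * m.+1.*2)%N.
  by rewrite expnS factS -mul2n mulnACA mulnC.
by rewrite natrM invfM mulfVK // pnatr_eq0.
Qed.

(** * Pfaffians of forms on sequences of labels *)

Section PfaffianSeq.
Variables (R : numFieldType) (K : comAlgType R).

(** The labels in s may repeat and may come from an infinite type; pf w s is
    the Pfaffian of the values of the form w at the entries of s.  With odd
    length it is zero, as is natural for an alternating function. *)
Definition pf (Y : Type) (w : Y -> Y -> K) (s : seq Y) : K :=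
  if s is y0 :: _ then
    if odd (size s) then 0 else
    pf_norm R (size s)./2 *: pfsum (m := (size s)./2)
       (fun i j => w (nth y0 s i) (nth y0 s j))
  else 1.

Lemma even_sizeP (Y : Type) (s : seq Y) :
  ~~ odd (size s) -> exists m, size s = m.*2.
Proof. by move=> se; exists (size s)./2; rewrite even_halfK. Qed.

Lemma pf_odd_size Y (w : Y -> Y -> K) s : odd (size s) -> pf w s = 0.
Proof. by case: s => //= y0 s ->. Qed.

Lemma pfE Y (w : Y -> Y -> K) y0 s m : size s = m.*2 ->
  pf w s = pf_norm R m *: pfsum (m := m) (fun i j => w (nth y0 s i) (nth y0 s j)).
Proof.
case: s => [|x s] sz.
  have -> : m = 0%N by case: m sz.
  rewrite /pf_norm mul1n invr1 scale1r /pfsum.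
  rewrite (eq_bigr (fun=> 1)) ?sumr_const; last first.
    move=> s _; rewrite big_ord0 mulr1.
    have -> : s = 1%g by apply/permP => -[].
    by rewrite odd_perm1.
  by rewrite card_Sn.
rewrite /pf sz odd_double doubleK; congr (_ *: _); apply: eq_pfsum => i j _.
by rewrite !(set_nth_default y0) // sz.
Qed.

Lemma eq_pf Y (w w' : Y -> Y -> K) s : 
  (forall x y, w x y = w' x y) -> pf w s = pf w' s.
Proof.
move=> ww; case: s => //= y0 s; case: ifP => // _; congr (_ *: _).
by apply: eq_pfsum => i j _; rewrite ww.
Qed.

Lemma pf_map Y Z (f : Y -> Z) (w : Z -> Z -> K) s :
  pf w (map f s) = pf (fun x y => w (f x) (f y)) s.
Proof.
case: s => // y0 s; have [so|/even_sizeP[m sz]] := boolP (odd (size (y0 :: s))).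
  by rewrite !pf_odd_size ?size_map.
rewrite (pfE _ y0 sz) (pfE w (f y0) (m := m)) ?size_map //.
by congr (_ *: _); apply: eq_pfsum => i j _; rewrite !(nth_map y0) // sz.
Qed.

(** Sign change under adjacent transpositions generates the full sign
    character, and is the form convenient for lists. *)
Definition alternating (Y : Type) (F : seq Y -> K) :=
  forall p x y s, F (p ++ x :: y :: s) = - F (p ++ y :: x :: s).

Lemma pf_alternating Y (w : Y -> Y -> K) : alternating (pf w).
Proof.
move=> p x y s; set l := p ++ _; set l' := p ++ _.
have szl : size l' = size l by rewrite !size_cat.
have [so|/even_sizeP[m sz]] := boolP (odd (size l)).
  by rewrite !pf_odd_size ?oppr0 ?szl.
rewrite (pfE w x sz) (pfE w x (m := m)) ?szl //.
have h0 : (size p < m.*2)%N.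
  by rewrite -sz size_cat /= addnS leq_addr.
have h1 : ((size p).+1 < m.*2)%N.
  by rewrite -sz size_cat /= !addnS !ltnS leq_addr.
pose t := tperm (Ordinal h0) (Ordinal h1).
have lt (i : 'I_m.*2) : nth x l i = nth x l' (t i).
  rewrite /t; case: tpermP => [->|->|/eqP n0 /eqP n1] /=.
  - by rewrite !nth_cat ltnn subnn ltnNge leqnSn /= subSnn.
  - by rewrite !nth_cat ltnn subnn ltnNge leqnSn /= subSnn.
  - move: n0 n1; rewrite -!val_eqE /= !nth_cat => n0 n1.
    case: ltnP => // le; have -> : (i - size p)%N = (i - (size p).+2).+2.
      have lt1 : (size p < i)%N by rewrite ltn_neqAle eq_sym n0.
      have lt2 : ((size p).+1 < i)%N by rewrite ltn_neqAle eq_sym n1.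
      by rewrite -subSS -[in RHS]subSS -subSn // -subSn // ltnW.
    by [].
rewrite -scalerN; congr (_ *: _).
transitivity ((-1) ^+ t * pfsum (fun i j : 'I_m.*2 => w (nth x l' i) (nth x l' j))).
  by rewrite -pfsum_perm; apply: eq_pfsum => i j _; rewrite !lt.
by rewrite odd_tperm -val_eqE /= neq_ltn ltnSn /= expr1 mulN1r.
Qed.

(** A repeated label gives two equal rows. *)
Lemma pf_dup (Y : eqType) (w : Y -> Y -> K) s : ~~ uniq s -> pf w s = 0.
Proof.
have [so|/even_sizeP[m sz]] := boolP (odd (size s)); first by rewrite pf_odd_size.
case: s sz => // y0 s sz nu; rewrite (pfE w y0 sz).
have /(uniqPn y0)[i [j []]] := nu; rewrite sz => ij jm e.
rewrite (pfsum_alt (i0 := Ordinal (ltn_trans ij jm)) (j0 := Ordinal jm)) ?scaler0 //.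
- by rewrite -val_eqE /= ltn_eqF.
- by move=> k /=; rewrite e.
- by move=> k /=; rewrite e.
Qed.

Lemma pf_linear (I : finType) (Y : Type) (w : Y -> Y -> K) (c : I -> K)
    (l : I -> Y) p y s :
  (forall z, w y z = \sum_x c x * w (l x) z) ->
  (forall z, w z y = \sum_x c x * w z (l x)) ->
  pf w (p ++ y :: s) = \sum_x c x * pf w (p ++ l x :: s).
Proof.
move=> wl wr; have szl x : size (p ++ l x :: s) = size (p ++ y :: s).
  by rewrite !size_cat.
have [so|/even_sizeP[m sz]] := boolP (odd (size (p ++ y :: s))).
  by rewrite pf_odd_size // big1 // => x _; rewrite pf_odd_size ?mulr0 ?szl.
have h0 : (size p < m.*2)%N by rewrite -sz size_cat /= addnS ltnS leq_addr.
pose A z i j := w (nth y (p ++ z :: s) i) (nth y (p ++ z :: s) j).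
rewrite (pfE w y sz).
under eq_bigr => x _ do rewrite (pfE w y (m := m)) ?szl // -scalerAr.
rewrite -scaler_sumr; congr (_ *: _).
have nk z (i : 'I_m.*2) : i != Ordinal h0 ->
    nth y (p ++ z :: s) i = nth y (p ++ y :: s) i.
  rewrite -val_eqE /= !nth_cat; case: ltnP => // le ne.
  by rewrite -(@subnK 1 (i - size p)) ?addn1 // subn_gt0 ltn_neqAle eq_sym ne.
have k0 z : nth y (p ++ z :: s) (size p) = z by rewrite nth_cat ltnn subnn.
apply: (pfsum_linear (k := Ordinal h0)) => [x i j ni nj|j nj|j nj].
- by rewrite !nk.
- by rewrite /= k0 wl; apply: eq_bigr => x _; rewrite k0 nk.
- by rewrite /= k0 wr; apply: eq_bigr => x _; rewrite k0 nk.
Qed.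

(** Transports pfsum_entry along a labelling g of the positions; the labels
    other than u and v are described by the predicate P. *)
Lemma pfsum_entry_label (Y : Type) (w w' : Y -> Y -> K) (P : Y -> Prop) u v c m
    (g : 'I_m.+1.*2 -> Y) :
  let V : 'I_m.+1.*2 := ord_max in
  let U : 'I_m.+1.*2 := lift ord_max (ord_max : 'I_(m.*2.+1)) in
  (forall x y, w x y = - w y x) -> (forall x y, w' x y = - w' y x) ->
  (forall x y, P x -> P y -> w' x y = w x y) ->
  (forall x, P x -> w' x u = w x u) -> (forall x, P x -> w' x v = w x v) ->
  w' u u = w u u -> w' v v = w v v -> w' u v = w u v + c ->
  (forall i, P (g i) \/ i = U \/ i = V) -> g U = u -> g V = v ->
  pfsum (fun i j => w' (g i) (g j)) = pfsum (fun i j => w (g i) (g j)) +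
    m.+1.*2%:R * c * pfsum (fun i j : 'I_m.*2 =>
      w (g (lift ord_max (lift ord_max i))) (g (lift ord_max (lift ord_max j)))).
Proof.
move=> V U wN wN' wff wfu wfv wuu wvv wuv cls gU gV.
apply: pfsum_entry => [i j|i j|i j|]; [exact: wN|exact: wN'| |]; last first.
  by rewrite -/U -/V gU gV.
rewrite -/U -/V; clearbody U V.
case: (cls i) => [Pi|[->|->]]; case: (cls j) => [Pj|[->|->]];
  rewrite ?gU ?gV ?eqxx // => _ _.
- exact: wff.
- exact: wfu.
- exact: wfv.
- by rewrite wN' wN wfu.
- by rewrite wN' wN wfv.
Qed.

(** The list form of pfsum_entry; the factor 2 (m + 1) found there is the
    ratio of two consecutive normalisations.  The labels of s are taken in the
    image of f so that the two forms need to agree only on labels which are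
    actually used together. *)
Lemma pf_entry (Y : Type) (w w' : Y -> Y -> K) (Z : Type) (f : Z -> Y) u v c s :
  ~~ odd (size s) ->
  (forall x y, w x y = - w y x) -> (forall x y, w' x y = - w' y x) ->
  (forall x y, w' (f x) (f y) = w (f x) (f y)) ->
  (forall x, w' (f x) u = w (f x) u) -> (forall x, w' (f x) v = w (f x) v) ->
  w' u u = w u u -> w' v v = w v v -> w' u v = w u v + c ->
  pf w' (map f s ++ [:: u; v]) =
  pf w (map f s ++ [:: u; v]) + c * pf (fun x y => w (f x) (f y)) s.
Proof.
move=> /even_sizeP[m sz] wN wN' wff wfu wfv wuu wvv wuv.
set l := map f s ++ _.
have szl : size l = m.+1.*2 by rewrite size_cat size_map /= sz addn2.
rewrite -(pf_map f w s) (pfE w u szl) (pfE w' u szl).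
rewrite (pfE w u (m := m)) ?size_map //.
have nv : nth u l (m.*2).+1 = v.
  by rewrite nth_cat size_map sz ltnNge leqnSn /= subSnn.
have nu : nth u l m.*2 = u by rewrite nth_cat size_map sz ltnn subnn.
have nw i : (i < m.*2)%N -> nth u l i = nth u (map f s) i.
  by move=> h; rewrite nth_cat size_map sz h.
have nf i : (i < m.*2)%N -> exists z, nth u l i = f z.
  move=> h; rewrite nw //; case: s sz {l szl nv nu nw} => [|z0 s] sz.
    by rewrite -sz in h.
  by exists (nth z0 (z0 :: s) i); rewrite (nth_map z0) // sz.
pose U : 'I_m.+1.*2 := lift ord_max (ord_max : 'I_(m.*2.+1)).
pose V : 'I_m.+1.*2 := ord_max.
have lE (i : 'I_m.*2) :
    nat_of_ord (lift ord_max (lift ord_max i) : 'I_m.+1.*2) = i.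
  rewrite /= /bump; have -> : (m.*2 <= i)%N = false by rewrite leqNgt ltn_ord.
  have -> : (m.*2.+1 <= 0 + i)%N = false.
    by rewrite add0n leqNgt ltnS (ltnW (valP i)).
  by rewrite !add0n.
have nU : nth u l U = u by rewrite /= /bump leqNgt ltnS leqnn nu.
have nV : nth u l V = v by rewrite nv.
have cls (i : 'I_m.+1.*2) : (exists z, nth u l i = f z) \/ i = U \/ i = V.
  case: (unliftP ord_max i) => [i1 ->|->]; last by right; right.
  case: (unliftP ord_max i1) => [i2 ->|->]; last by right; left.
  by left; apply: nf; rewrite lE.
have := @pfsum_entry_label Y w w' (fun y => exists z, y = f z) u v c m
  (fun i => nth u l i) wN wN'; rewrite -/U -/V => ->//; first last.
- by move=> x [x' ->].
- by move=> x [x' ->].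
- by move=> x y [x' ->] [y' ->].
rewrite scalerDr; congr (_ + _).
rewrite -mulrA mulr_natl -scaler_nat scalerA pf_normS -scalerAr.
congr (_ *: (_ * _)).
by apply: eq_pfsum => i j _; rewrite !lE !nw.
Qed.
End PfaffianSeq.

(** * Rank-two perturbations and bordered Pfaffians *)

Section Pieri.
Variables (R : numFieldType) (K : comAlgType R).

Lemma alternating_null (Y : Type) (F : seq Y -> K) : alternating F ->
  forall p x s, F (p ++ x :: x :: s) = 0.
Proof.
move=> alt p x s; have := alt p x x s; set k := F _ => e.
have h2 : (2%:R : R) != 0 by rewrite pnatr_eq0.
apply: (scalerI h2).
by rewrite scaler0 scaler_nat mulr2n {1}e addNr.
Qed.

(** Moving a pair of labels across a list is an even permutation. *)
Lemma alternating_move (Y : Type) (F : seq Y -> K) : alternating F ->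
  forall p x y s t, F (p ++ x :: y :: s ++ t) = F (p ++ s ++ x :: y :: t).
Proof.
move=> alt p x y s t; elim: s p => // z s IH p.
have := alt (rcons p x) y z (s ++ t); rewrite !cat_rcons => ->.
rewrite alt opprK; have := IH (rcons p z); rewrite !cat_rcons => ->.
by [].
Qed.

Section PieriForm.
Variables (X : eqType) (N : X -> X -> K) (al be : X -> K) (Q : K).
Hypothesis N_anti : forall x y, N x y = - N y x.

Let L : eqType := ((X * K) + bool)%type.

(** The label inl (x, k) stands for row x plus k times the row of
    inr false.  The row of inr true is orthogonal to all inl (x, al x) when
    c = Q, which is what makes the Pfaffian factor. *)
Definition pieri_form (c : K) (a b : L) : K :=
  match a, b with
  | inl (x, k), inl (y, l) => N x y + al x * be y - al y * be x + l * be x - k * be y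
  | inl (x, k), inr true => Q * al x - k * c
  | inr true, inl (x, k) => - (Q * al x - k * c)
  | inl (x, _), inr false => be x
  | inr false, inl (x, _) => - be x
  | inr true, inr false => c
  | inr false, inr true => - c
  | inr _, inr _ => 0
  end.

Lemma pieri_form_anti c a b : pieri_form c a b = - pieri_form c b a.
Proof.
case: a => [[x k]|[]]; case: b => [[y l]|[]] //=; rewrite ?opprK ?oppr0 //.
by rewrite N_anti; ring.
Qed.

(** Adding multiples of the row of inr false, which is already present in
    the list, does not change the Pfaffian. *)
Lemma pieri_form_shear p t :
  pf (pieri_form Q) (p ++ map (fun x => inl (x, al x)) t ++ [:: inr true; inr false])
  = pf (pieri_form Q) (p ++ map (fun x => inl (x, 0)) t ++ [:: inr true; inr false]).
Proof.
elim: t p => // x t IH p /=.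
pose c (b : bool) := if b then 1 else al x.
pose l (b : bool) : L := if b then inl (x, 0) else inr false.
rewrite (pf_linear (w := pieri_form Q) (c := c) (l := l)); first last.
- move=> z; rewrite big_bool /c /l /=.
  by case: z => [[y k]|[]] /=; ring.
- move=> z; rewrite big_bool /c /l /=.
  by case: z => [[y k]|[]] /=; ring.
rewrite big_bool /c /l /= mul1r [X in _ * X]pf_dup ?mulr0 ?addr0; last first.
  by rewrite cat_uniq /= mem_cat !inE eqxx !orbT /= !andbF.
by have := IH (rcons p (inl (x, 0))); rewrite !cat_rcons.
Qed.

(** Raising the entry between the two border labels from Q - 1 to Q adds the
    Pfaffian without border, which is the first term.  After a shear the row of
    inr true has the single nonzero entry Q, and the Pfaffian of the sheared
    form on t is that of N, since the shear removes the rank-two part. *)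
Lemma pieri_rank2 t : ~~ odd (size t) ->
  pf (fun x y => N x y + al x * be y - al y * be x) t +
  pf (pieri_form (Q - 1))
     (map (fun x => inl (x, 0)) t ++ [:: inr true; inr false]) = Q * pf N t.
Proof.
move=> te.
transitivity (pf (pieri_form Q)
     (map (fun x => inl (x, 0)) t ++ [:: inr true; inr false])).
  rewrite (pf_entry (w := pieri_form (Q - 1)) (w' := pieri_form Q) (c := 1)) //=; last 4 first.
  - exact: pieri_form_anti.
  - exact: pieri_form_anti.
  - by move=> x; rewrite !mul0r.
  - by rewrite subrK.
  rewrite mul1r addrC; congr (_ + _); apply: eq_pf => x y /=.
  by rewrite !mul0r addr0 subr0.
rewrite -[LHS](pieri_form_shear [::]) cat0s.
(* compare with the form w in which the row of inr true is erased: its Pfaffian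
   vanishes and the only entry to restore is Q *)
pose isu (a : L) := if a is inr true then true else false.
pose w (a b : L) := if isu a || isu b then 0 else pieri_form Q a b.
rewrite (pf_entry (w := w) (w' := pieri_form Q) (c := Q)) //=; last 4 first.
- by move=> a b; rewrite /w orbC; case: ifP => _; rewrite ?oppr0 // pieri_form_anti.
- exact: pieri_form_anti.
- by move=> x; rewrite /w /=; ring.
- by rewrite /w /= add0r.
rewrite (pf_linear (w := w) (c := fun i : 'I_0 => 0) (l := fun=> inr true)); first last.
- by move=> z; rewrite big_ord0 /w orbT.
- by move=> z; rewrite big_ord0 /w.
rewrite big_ord0 add0r; congr (_ * _); apply: eq_pf => x y.
by rewrite /w /=; ring.
Qed.
End PieriForm.

End Pieri.

(** * Iterated contraction of alternating functions *)

Section PairOperators.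
Variables (R : numFieldType) (K : comAlgType R).

(** Contraction with the two-tensor c.  On a Pfaffian of 2 m labels, m
    contractions produce the pairing of two Pfaffians (pf_pair_op), while as an
    operator on functions of lists the contraction can be expanded
    binomially. *)
Definition pair_op (X : finType) (Y : Type) (c : X -> X -> K) (l : X -> Y)
    (F : seq Y -> K) (s : seq Y) : K :=
  \sum_x \sum_y c x y * F (l x :: l y :: s).

Lemma pair_op_alternating (X : finType) (Y : Type) c (l : X -> Y) F :
  alternating F -> alternating (pair_op c l F).
Proof.
move=> alt p x y s; rewrite /pair_op -sumrN; apply: eq_bigr => a _.
rewrite -sumrN; apply: eq_bigr => b _.
by have := alt [:: l a, l b & p] x y s => /= ->; rewrite mulrN.
Qed.

Section RankTwo.
Variables (X : finType) (Y : Type) (c c' : X -> X -> K) (l l' : X -> Y).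
Variables (T : X -> X -> K) (a b : Y).

(** F treats the label l' r as the linear combination of the labels l x with
    coefficients T x r. *)
Definition slot_linear (F : seq Y -> K) :=
  forall p r s, F (p ++ l' r :: s) = \sum_x T x r * F (p ++ l x :: s).

Definition insert2 (F : seq Y -> K) (s : seq Y) : K := F (a :: b :: s).

Hypothesis step : forall F, alternating F -> slot_linear F ->
  forall s, pair_op c' l F s = pair_op c l' F s + insert2 F s *+ 2.

Lemma pair_op_slot_linear d (m : X -> Y) F :
  slot_linear F -> slot_linear (pair_op d m F).
Proof.
move=> lin p r s; rewrite /pair_op.
under eq_bigr => x _ do under eq_bigr => y _ do
  rewrite -[_ :: _ :: _]/([:: m x, m y & p] ++ l' r :: s) lin big_distrr /=.
under [RHS]eq_bigr => x _ do rewrite big_distrr /=.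
under [RHS]eq_bigr => x _ do under eq_bigr => y _ do rewrite big_distrr /=.
rewrite [RHS]exchange_big /=; apply: eq_bigr => x _.
rewrite [RHS]exchange_big /=; apply: eq_bigr => y _.
by apply: eq_bigr => z _; rewrite mulrCA.
Qed.

Lemma iter_pair_op_alternating d (m : X -> Y) F k :
  alternating F -> alternating (iter k (pair_op d m) F).
Proof. by move=> alt; elim: k => //= k; apply: pair_op_alternating. Qed.

Lemma iter_pair_op_slot_linear d (m : X -> Y) F k :
  slot_linear F -> slot_linear (iter k (pair_op d m) F).
Proof. by move=> lin; elim: k => //= k; apply: pair_op_slot_linear. Qed.

Lemma insert2_alternating F : alternating F -> alternating (insert2 F).
Proof. by move=> alt p x y s; apply: (alt [:: a, b & p]). Qed.

Lemma insert2_slot_linear F : slot_linear F -> slot_linear (insert2 F).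
Proof. by move=> lin p r s; apply: (lin [:: a, b & p]). Qed.

(** The contracted pair passes over the two inserted labels by an even
    permutation. *)
Lemma insert2_pair_op d (m : X -> Y) F : alternating F ->
  insert2 (pair_op d m F) = pair_op d m (insert2 F).
Proof.
move=> alt; apply/funext => s; apply: eq_bigr => x _; apply: eq_bigr => y _.
congr (_ * _).
exact: (alternating_move alt [::] (m x) (m y) [:: a; b] s).
Qed.

Lemma iter_insert2 d (m : X -> Y) F k : alternating F ->
  insert2 (iter k (pair_op d m) F) = iter k (pair_op d m) (insert2 F).
Proof.
move=> alt; elim: k => //= k IH.
by rewrite insert2_pair_op ?IH //; apply: iter_pair_op_alternating.
Qed.

(** The labels a and b would each appear twice. *)
Lemma insert2_twice F : alternating F -> insert2 (insert2 F) = fun=> 0.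
Proof.
move=> alt; apply/funext => s; rewrite /insert2.
have := alt [:: a] b a (b :: s) => /= ->.
by have /= -> := alternating_null alt [::] a (b :: b :: s); rewrite oppr0.
Qed.

Lemma iter_pair_op0 d (m : X -> Y) k : iter k (pair_op d m) (fun=> 0) = fun=> 0.
Proof.
elim: k => //= k ->; apply/funext => s; rewrite /pair_op big1 // => x _.
by rewrite big1 // => y _; rewrite mulr0.
Qed.

Lemma pair_opD d (m : X -> Y) F G k s :
  pair_op d m (fun s => F s + G s *+ k) s = pair_op d m F s + pair_op d m G s *+ k.
Proof.
rewrite /pair_op -sumrMnl -big_split; apply: eq_bigr => x _ /=.
rewrite -sumrMnl -big_split; apply: eq_bigr => y _ /=.
by rewrite mulrDr mulrnAr.
Qed.

(** Binomial expansion of the power of a sum of two commuting operators, the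
    second of which has square zero; only the terms of degree at most one in
    the insertion survive. *)
Lemma iter_pair_op_rank2 F m : alternating F -> slot_linear F -> forall s,
  iter m (pair_op c' l) F s =
  iter m (pair_op c l') F s + iter m.-1 (pair_op c l') (insert2 F) s *+ m.*2.
Proof.
move=> alt lin; elim: m => [|m IH] s; first by rewrite /= mulr0n addr0.
rewrite [LHS]/=; set G := iter m (pair_op c' l) F.
have -> : G = fun s => iter m (pair_op c l') F s +
    iter m.-1 (pair_op c l') (insert2 F) s *+ m.*2 by apply/funext.
rewrite pair_opD.
rewrite step; [|exact: iter_pair_op_alternating|exact: iter_pair_op_slot_linear].
have alt2 := insert2_alternating alt; have lin2 := insert2_slot_linear lin.
rewrite step; [|exact: iter_pair_op_alternating|exact: iter_pair_op_slot_linear].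
rewrite !iter_insert2 // insert2_twice // iter_pair_op0 mul0rn addr0.
rewrite -[in RHS]/(iter m.+1 (pair_op c l') F s) [iter m.+1 _ _ _]/=.
rewrite -addrA; congr (_ + _); rewrite doubleS [LHS]addrC.
by case: m {IH G} => [|m] /=; rewrite ?mulr0n ?mul0rn ?addr0 ?add0r // -mulrnDr addn2.
Qed.
End RankTwo.
End PairOperators.

(** * Polynomials modulo a power of the variable *)

Section TruncatedEq.
Variable R : comNzRingType.

(** Congruence modulo 'X^n.+1. *)
Definition eqm n (p q : {poly R}) := forall i, (i <= n)%N -> p`_i = q`_i.

Lemma eqm_refl n p : eqm n p p. Proof. by []. Qed.
Lemma eqm_sym n p q : eqm n p q -> eqm n q p.
Proof. by move=> h i /h. Qed.
Lemma eqm_trans n p q r : eqm n p q -> eqm n q r -> eqm n p r.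
Proof. by move=> h1 h2 i hi; rewrite h1 ?h2. Qed.
Lemma eqmD n p p' q q' : eqm n p p' -> eqm n q q' -> eqm n (p + q) (p' + q').
Proof. by move=> h1 h2 i hi; rewrite !coefD h1 ?h2. Qed.
Lemma eqmM n p p' q q' : eqm n p p' -> eqm n q q' -> eqm n (p * q) (p' * q').
Proof.
move=> h1 h2 i hi; rewrite !coefM; apply: eq_bigr => j _.
rewrite h1 ?h2 //; first exact: leq_trans (leq_subr _ _) hi.
by rewrite (leq_trans _ hi) // -ltnS.
Qed.
Lemma eqmZ n c p p' : eqm n p p' -> eqm n (c *: p) (c *: p').
Proof. by move=> h i hi; rewrite !coefZ h. Qed.
Lemma eqm_sum n (I : Type) (r : seq I) (P : pred I) (F G : I -> {poly R}) :
  (forall i, P i -> eqm n (F i) (G i)) ->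
  eqm n (\sum_(i <- r | P i) F i) (\sum_(i <- r | P i) G i).
Proof.
by move=> h; apply: (big_ind2 (eqm n)) => // *; apply: eqmD.
Qed.
Lemma eqm_prod n (I : Type) (r : seq I) (P : pred I) (F G : I -> {poly R}) :
  (forall i, P i -> eqm n (F i) (G i)) ->
  eqm n (\prod_(i <- r | P i) F i) (\prod_(i <- r | P i) G i).
Proof.
by move=> h; apply: (big_ind2 (eqm n)) => // *; apply: eqmM.
Qed.
End TruncatedEq.

(** * The functions q_r and Q_(r,s) *)

Section SchurQFacts.
Variable R : realType.
Implicit Types (A B : seq R).

(** The coefficients of (1 + a z) / (1 - a z). *)
Definition fcoef (a : R) (i : nat) : R := if i == 0%N then 1 else 2 * a ^+ i.

(** The generating function of the q_r, correct up to degree n. *)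
Definition schur_gen n A : {poly R} := \prod_(a <- A) \poly_(i < n.+1) fcoef a i.

Lemma schur_qE n r A : (r <= n)%N -> schur_q r A = (schur_gen n A)`_r.
Proof.
move=> rn; apply: (@eqm_prod _ r) => [a _ i ir|//].
by rewrite !coef_poly !ltnS ir (leq_trans ir rn).
Qed.

Lemma schur_gen_cat n A B : schur_gen n (A ++ B) = schur_gen n A * schur_gen n B.
Proof. by rewrite /schur_gen big_cat. Qed.

Lemma schur_q_cat r A B :
  schur_q r (A ++ B) = \sum_(i < r.+1) schur_q i A * schur_q (r - i) B.
Proof.
rewrite (schur_qE _ (leqnn r)) schur_gen_cat coefM; apply: eq_bigr => i _.
by rewrite -!schur_qE ?leq_subr // -ltnS.
Qed.

Lemma schur_q_nil r : schur_q r [::] = (r == 0%N)%:R :> R.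
Proof. by rewrite /schur_q big_nil coef1. Qed.

Lemma schur_q_seq1 r (a : R) : schur_q r [:: a] = fcoef a r.
Proof. by rewrite /schur_q big_seq1 coef_poly ltnSn. Qed.

Lemma schur_q_cons r a A :
  schur_q r (a :: A) = \sum_(i < r.+1) fcoef a i * schur_q (r - i) A.
Proof.
by rewrite -cat1s schur_q_cat; apply: eq_bigr => i _; rewrite schur_q_seq1.
Qed.

Lemma schur_q_perm r A B : perm_eq A B -> schur_q r A = schur_q r B.
Proof. by move=> AB; rewrite /schur_q (perm_big _ AB). Qed.

Lemma schur_q0 A : schur_q 0 A = 1.
Proof.
elim: A => [|a A IH]; first by rewrite schur_q_nil.
by rewrite schur_q_cons big_ord_recl big_ord0 IH mulr1 addr0.
Qed.

Lemma fcoefM z a i : fcoef (z * a) i = z ^+ i * fcoef a i.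
Proof.
rewrite /fcoef; case: ifP => [/eqP->|_]; first by rewrite mulr1.
by rewrite exprMn mulrCA.
Qed.

Lemma schur_q_scale z r A : schur_q r (scale_alphabet z A) = z ^+ r * schur_q r A.
Proof.
elim: A r => [|a A IH] r.
  by rewrite !schur_q_nil; case: r => [|r]; rewrite ?mulr1 ?mulr0.
rewrite /= !schur_q_cons big_distrr; apply: eq_bigr => i _ /=.
have ir : (i <= r)%N by rewrite -ltnS.
have -> : z ^+ r = z ^+ i * z ^+ (r - i) by rewrite -exprD subnKC.
by rewrite IH fcoefM; ring.
Qed.

(** The series of a and of - a are inverse to each other. *)
Lemma fcoef_inv (a : R) n : (0 < n)%N ->
  \sum_(i < n.+1) fcoef a i * fcoef (-1 * a) (n - i) = 0.
Proof.
case: n => // n _.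
rewrite big_ord_recl big_ord_recr /= subn0 /bump /= subnn add1n.
rewrite /fcoef /= mul1r mulr1.
have -> : \sum_(i < n) fcoef a (bump 0 (widen_ord (leqnSn n) i)) *
    fcoef (-1 * a) (n.+1 - bump 0 (widen_ord (leqnSn n) i)) =
  a ^+ n.+1 * (4 * \sum_(i < n) (-1) ^+ (n - i)).
  rewrite big_distrr /= big_distrr /=; apply: eq_bigr => i _.
  rewrite /bump /= add1n subSS fcoefM /fcoef /= subn_eq0 leqNgt ltn_ord /=.
  have -> : a ^+ n.+1 = a ^+ i.+1 * a ^+ (n - i) by rewrite -exprD addSn subnKC // ltnW.
  by ring.
have -> : 4 * \sum_(i < n) (-1) ^+ (n - i) = 2 * ((-1) ^+ n - 1) :> R.
  elim: n => [|n IH]; first by rewrite big_ord0 subrr !mulr0.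
  rewrite big_ord_recl /= subn0 mulrDr.
  under eq_bigr => i _ do rewrite /bump /= add1n subSS.
  by rewrite IH exprS; ring.
by rewrite exprMn (exprS (-1) n); ring.
Qed.

(** Reflecting z |-> - z inverts the generating function of the q_r. *)
Lemma schur_q_inv A n : (0 < n)%N ->
  \sum_(i < n.+1) (-1) ^+ i * schur_q i A * schur_q (n - i) A = 0.
Proof.
move=> n0.
have -> : \sum_(i < n.+1) (-1) ^+ i * schur_q i A * schur_q (n - i) A =
    schur_q n (scale_alphabet (-1) A ++ A).
  by rewrite schur_q_cat; apply: eq_bigr => i _; rewrite schur_q_scale.
elim: A => [|a A IH]; first by rewrite schur_q_nil gtn_eqF.
have -> : schur_q n (scale_alphabet (-1) (a :: A) ++ a :: A) =
    schur_q n ([:: a; -1 * a] ++ (scale_alphabet (-1) A ++ A)).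
  apply: schur_q_perm; rewrite /= -[_ :: _ ++ _]/((-1 * a :: scale_alphabet (-1) A) ++ _).
  by rewrite perm_catC /= perm_cons -cat_cons perm_catC.
rewrite schur_q_cat big_ord_recl big1 ?addr0.
  by rewrite schur_q0 mul1r subn0.
move=> i _; rewrite schur_q_cons.
under eq_bigr => j _ do rewrite schur_q_seq1.
by rewrite fcoef_inv ?mul0r.
Qed.

(** The boundary terms of two neighbouring alternating sums are all that is
    left when they are added.  This recurrence together with the values at
    s = 0 determines the functions Q_(r,s). *)
Lemma schur_Q2_rec r s A : schur_Q2 r s.+1 A + schur_Q2 r.+1 s A =
  schur_q r A * schur_q s.+1 A - schur_q r.+1 A * schur_q s A.
Proof.
rewrite /schur_Q2 big_nat_recl //= expr1 addn1 subSS subn0.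
have -> : \sum_(1 <= i < s.+1) (-1) ^+ i.+1 * schur_q (r + i.+1) A * schur_q (s.+1 - i.+1) A
  = - \sum_(1 <= i < s.+1) (-1) ^+ i * schur_q (r.+1 + i) A * schur_q (s - i) A.
  rewrite -sumrN; apply: eq_bigr => i _.
  by rewrite exprS addnS addSn subSS; ring.
by ring.
Qed.

Lemma schur_Q2r0 r A : schur_Q2 r 0 A = schur_q r A.
Proof. by rewrite /schur_Q2 big_geq // schur_q0; ring. Qed.

(** This is the defining sum evaluated with the relation between the q_r and
    the q_r of the negated alphabet. *)
Lemma schur_Q20r s A : schur_Q2 0 s A = 2 * (s == 0%N)%:R - schur_q s A.
Proof.
case: s => [|s]; first by rewrite schur_Q2r0 schur_q0 eqxx /=; ring.
have := schur_q_inv A (ltn0Sn s); rewrite big_ord_recl /= expr0 schur_q0 subn0.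
rewrite /schur_Q2 big_add1 /= big_mkord schur_q0 mulr0 sub0r !mul1r => /eqP.
rewrite addr_eq0 => /eqP e.
have -> : \sum_(i < s.+1) (-1) ^+ i.+1 * schur_q (0 + i.+1) A * schur_q (s.+1 - i.+1) A
   = - schur_q s.+1 A by rewrite e opprK.
by ring.
Qed.

Lemma schur_Q2_anti r s A : (0 < r + s)%N -> schur_Q2 r s A = - schur_Q2 s r A.
Proof.
elim: s r => [|s IH] r; rewrite ?addn0.
  by move=> r0; rewrite schur_Q2r0 schur_Q20r gtn_eqF // mulr0 sub0r opprK.
move=> _; have e1 := schur_Q2_rec r s A; have e2 := schur_Q2_rec s r A.
have e3 := IH r.+1 isT.
by move: e1 e2; rewrite e3 => e1 e2; lra.
Qed.

Lemma schur_Q2_pair r s c t A : (t < c)%N ->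
  schur_Q2 (r + t) (s + (c - t)) A + schur_Q2 (r + t.+1) (s + (c - t.+1)) A =
  schur_q (r + t) A * schur_q (s + (c - t)) A -
  schur_q (r + t.+1) A * schur_q (s + (c - t.+1)) A.
Proof. by move=> tc; rewrite -(subnSK tc) !addnS schur_Q2_rec. Qed.

Lemma telescope_ord (u : nat -> R) c :
  \sum_(t < c) (u t - u t.+1) = u 0%N - u c.
Proof.
rewrite -(big_mkord xpredT (fun t => u t - u t.+1)) -opprB -telescope_sumr //.
by rewrite -sumrN; apply: eq_bigr => i _; rewrite opprB.
Qed.

Lemma fcoef1 t : fcoef 1 t = 1 + (0 < t)%:R.
Proof.
by rewrite /fcoef lt0n; case: eqP => //= _; rewrite ?addr0 // expr1n mulr1.
Qed.

(** The weights fcoef 1 are 1, 2, 2, ..., so that the sum splits into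
    neighbouring pairs, each of which is a difference by schur_Q2_rec; these
    differences telescope. *)
Lemma schur_Q2_conv1 r c A :
  \sum_(t < c.+1) fcoef 1 t * schur_Q2 (r + t) (c - t) A
  = schur_q r A * schur_q c A.
Proof.
under eq_bigr => t _ do rewrite fcoef1 mulrDl mul1r.
rewrite big_split /= [X in _ + X]big_ord_recl /= mul0r add0r.
rewrite big_ord_recr /= subnn schur_Q2r0.
have -> : forall x y z : R, x + y + z = (x + z) + y by move=> *; ring.
rewrite -big_split /=.
under eq_bigr => t _.
  rewrite mul1r /bump /= add1n (schur_Q2_pair r 0) ?ltn_ord //.
  over.
rewrite (telescope_ord (fun t => schur_q (r + t) A * schur_q (0 + (c - t)) A)).
by rewrite addn0 subn0 subnn schur_q0 add0n; ring.
Qed.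

(** Same telescoping; here both ends carry weight 2 and the inner terms
    weight 4, that is, each neighbouring pair occurs twice. *)
Lemma schur_Q2_conv2 r s c A : (0 < c)%N ->
  \sum_(t < c.+1) fcoef 1 t * fcoef 1 (c - t) * schur_Q2 (r + t) (s + (c - t)) A
  = 2 * (schur_q r A * schur_q (s + c) A - schur_q (r + c) A * schur_q s A).
Proof.
move=> c0.
pose G t := schur_Q2 (r + t) (s + (c - t)) A.
transitivity (\sum_(t < c.+1) ((t < c)%:R * (2 * G t) + (0 < t)%:R * (2 * G t))).
  apply: eq_bigr => t _; rewrite !fcoef1 subn_gt0 -/(G t).
  case: (ltnP t c) => tc; case: (posnP t) => t0; rewrite /=; try by ring.
  by move: tc; rewrite t0 leqNgt c0.
rewrite big_split /= big_ord_recr /= ltnn mul0r addr0.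
rewrite [X in _ + X]big_ord_recl /= mul0r add0r -big_split /=.
transitivity (2 * \sum_(t < c) (G t + G t.+1)).
  rewrite big_distrr; apply: eq_bigr => t _ /=.
  by rewrite /bump /= add1n ltn_ord /=; ring.
under eq_bigr => t _ do rewrite /G (schur_Q2_pair r s) ?ltn_ord //.
rewrite (telescope_ord (fun t => schur_q (r + t) A * schur_q (s + (c - t)) A)).
by rewrite addn0 subn0 subnn addn0.
Qed.
End SchurQFacts.

(** * Adding one variable *)

Section Branching.
Variable R : realType.
Implicit Types (A B : seq R).

(** The Toeplitz matrix of multiplication by (1 + a z) / (1 - a z). *)
Definition toep (a : R) (r s : nat) : R := if (s <= r)%N then fcoef a (r - s) else 0.

Lemma toep_sum n a r (F : nat -> R) : (r <= n)%N ->
  \sum_(x < n.+1) toep a r x * F x = \sum_(i < r.+1) fcoef a i * F (r - i)%N.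
Proof.
move=> rn.
rewrite (bigID (fun x : 'I_n.+1 => (x < r.+1)%N)) /= [X in _ + X]big1 ?addr0; last first.
  by move=> x; rewrite ltnS /toep => /negbTE ->; rewrite mul0r.
rewrite -(big_ord_widen _ (fun x => toep a r x * F x)) ?ltnS //.
rewrite (reindex_inj rev_ord_inj) /=; apply: eq_bigr => i _.
have ir : (i <= r)%N by rewrite -ltnS.
by rewrite subSS /toep leq_subr subKn.
Qed.

(** The entry (r, s) of T G T^t, with the Toeplitz sums written as
    convolutions. *)
Definition toep2 (a : R) (G : nat -> nat -> R) r s : R :=
  \sum_(i < r.+1) \sum_(j < s.+1) fcoef a i * fcoef a j * G (r - i)%N (s - j)%N.

Lemma toep2_sum n a (G : nat -> nat -> R) r s : (r <= n)%N -> (s <= n)%N ->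
  \sum_(x < n.+1) \sum_(y < n.+1) toep a r x * toep a s y * G x y = toep2 a G r s.
Proof.
move=> rn sn.
under eq_bigr => x _.
  under eq_bigr => y _ do rewrite -mulrA.
  rewrite -big_distrr /= (@toep_sum n a s (fun y => G x y)) //.
  over.
rewrite (@toep_sum n a r (fun x => \sum_(j < s.+1) fcoef a j * G x (s - j)%N)) //.
apply: eq_bigr => i _; rewrite big_distrr; apply: eq_bigr => j _ /=.
by rewrite mulrA.
Qed.

Lemma schur_q_cons_tail r a A :
  \sum_(i < r.+1) fcoef a i * schur_q (r.+1 - i) A =
  schur_q r.+1 (a :: A) - fcoef a r.+1.
Proof. by rewrite schur_q_cons [in RHS]big_ord_recr /= subnn schur_q0 mulr1 addrK. Qed.

(** Up to a rank-one correction, T M T^t satisfies the recurrence of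
    Q_(r,s) for the enlarged alphabet; the correction comes from the boundary
    values at 0. *)
Lemma toep2_schur_rec a A r s :
  toep2 a (fun r s => schur_Q2 r s A) r s.+1 +
  toep2 a (fun r s => schur_Q2 r s A) r.+1 s =
  schur_q r (a :: A) * schur_q s.+1 (a :: A) -
  schur_q r.+1 (a :: A) * schur_q s (a :: A) + 2 * fcoef a r.+1 * fcoef a s.
Proof.
rewrite /toep2.
under eq_bigr => i _ do rewrite big_ord_recr /= subnn schur_Q2r0.
rewrite big_split /= [X in _ + X]big_ord_recr /= subnn.
have -> : \sum_(i < r.+1) fcoef a i * fcoef a s.+1 * schur_q (r - i) A =
   fcoef a s.+1 * schur_q r (a :: A).
  by rewrite schur_q_cons big_distrr; apply: eq_bigr => i _ /=; ring.
have -> : \sum_(j < s.+1) fcoef a r.+1 * fcoef a j * schur_Q2 0 (s - j) A =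
   fcoef a r.+1 * (2 * fcoef a s - schur_q s (a :: A)).
  under eq_bigr => j _ do rewrite schur_Q20r -mulrA mulrBr.
  rewrite -big_distrr /= sumrB schur_q_cons; congr (_ * (_ - _)).
  rewrite big_ord_recr /= subnn eqxx big1 ?add0r => [|i _]; first by rewrite mulr1 mulrC.
  by rewrite subn_eq0 leqNgt ltn_ord mulr0 mulr0.
have -> : forall x y z t : R, x + y + (z + t) = (x + z) + y + t by move=> *; ring.
rewrite -big_split /=.
transitivity (\sum_(i < r.+1) \sum_(j < s.+1)
   fcoef a i * fcoef a j * (schur_q (r - i) A * schur_q (s.+1 - j) A
     - schur_q (r.+1 - i) A * schur_q (s - j) A)
   + fcoef a s.+1 * schur_q r (a :: A)
   + fcoef a r.+1 * (2 * fcoef a s - schur_q s (a :: A))).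
  congr (_ + _ + _); apply: eq_bigr => i _; rewrite -big_split; apply: eq_bigr => j _ /=.
  have ir : (i <= r)%N by rewrite -ltnS.
  have js : (j <= s)%N by rewrite -ltnS.
  by rewrite -mulrDr !subSn // schur_Q2_rec.
have -> : \sum_(i < r.+1) \sum_(j < s.+1)
   fcoef a i * fcoef a j * (schur_q (r - i) A * schur_q (s.+1 - j) A
     - schur_q (r.+1 - i) A * schur_q (s - j) A) =
  schur_q r (a :: A) * (schur_q s.+1 (a :: A) - fcoef a s.+1) -
  (schur_q r.+1 (a :: A) - fcoef a r.+1) * schur_q s (a :: A).
  rewrite -!schur_q_cons_tail (schur_q_cons r) (schur_q_cons s) !big_distrlr /=.
  rewrite -sumrB; apply: eq_bigr => i _; rewrite -sumrB; apply: eq_bigr => j _.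
  by ring.
by ring.
Qed.

(** Both sides satisfy the same recurrence in s and agree at s = 0. *)
Lemma schur_Q2_branch a A r s :
  schur_Q2 r s (a :: A) = toep2 a (fun r s => schur_Q2 r s A) r s
   - fcoef a r * fcoef a s + fcoef a r * (s == 0%N)%:R - (r == 0%N)%:R * fcoef a s
   + (r == 0%N)%:R * (s == 0%N)%:R.
Proof.
elim: s r => [|s IH] r.
  rewrite schur_Q2r0 /toep2.
  under eq_bigr => i _ do rewrite big_ord_recl big_ord0 /= addr0 schur_Q2r0.
  rewrite schur_q_cons eqxx /= [fcoef a 0]/fcoef /= !mulr1.
  under [in RHS]eq_bigr => i _ do rewrite mulr1.
  by ring.
have e1 := schur_Q2_rec r s (a :: A); have e2 := toep2_schur_rec a A r s.
have e3 := IH r.+1; move: e1 e2; rewrite e3 /= => e1 e2.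
have -> : toep2 a (fun r s => schur_Q2 r s A) r s.+1 =
  schur_q r (a :: A) * schur_q s.+1 (a :: A) -
  schur_q r.+1 (a :: A) * schur_q s (a :: A) + 2 * fcoef a r.+1 * fcoef a s
  - toep2 a (fun r s => schur_Q2 r s A) r.+1 s by rewrite -e2; ring.
have -> : schur_Q2 r s.+1 (a :: A) = schur_q r (a :: A) * schur_q s.+1 (a :: A) -
  schur_q r.+1 (a :: A) * schur_q s (a :: A) -
  (toep2 a (fun r s => schur_Q2 r s A) r.+1 s - fcoef a r.+1 * fcoef a s
  + fcoef a r.+1 * (s == 0%N)%:R - 0 * fcoef a s + 0 * (s == 0%N)%:R).
  by rewrite -e1; ring.
rewrite /fcoef /=; case: r {IH e1 e2 e3} => [|r]; case: s => [|s];
  rewrite /= ?exprS; ring.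
Qed.

(** The value at (0, 0) is put to 0, instead of Q_(0,0) = 1, to make the
    matrix antisymmetric.  The index 0 is then the padding part of a strict
    partition of odd length. *)
Definition schur_M A (r s : nat) : R :=
  if (r == 0%N) && (s == 0%N) then 0 else schur_Q2 r s A.

Lemma schur_ME A r s :
  schur_M A r s = schur_Q2 r s A - (r == 0%N)%:R * (s == 0%N)%:R.
Proof.
rewrite /schur_M; case: r s => [|r] [|s] //=; rewrite ?mulr0 ?mul0r ?subr0 //.
by rewrite schur_Q2r0 schur_q0 mulr1 subrr.
Qed.

Lemma schur_M_anti A r s : schur_M A r s = - schur_M A s r.
Proof.
rewrite /schur_M [in RHS]andbC; case: ifP => [|h]; first by rewrite oppr0.
by apply: schur_Q2_anti; rewrite lt0n addn_eq0 h.
Qed.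

(** M_(a + A) = T M_A T^t + (T e_0 /\ e_0): one more variable changes the
    matrix by a congruence and a perturbation of rank two. *)
Lemma schur_M_branch n a A r s : (r <= n)%N -> (s <= n)%N ->
  schur_M (a :: A) r s =
  \sum_(x < n.+1) \sum_(y < n.+1) toep a r x * toep a s y * schur_M A x y
  + toep a r 0 * (s == 0%N)%:R - (r == 0%N)%:R * toep a s 0.
Proof.
move=> rn sn; rewrite schur_ME schur_Q2_branch.
have -> : \sum_(x < n.+1) \sum_(y < n.+1) toep a r x * toep a s y * schur_M A x y
  = toep2 a (fun r s => schur_Q2 r s A) r s - fcoef a r * fcoef a s.
  rewrite -(toep2_sum _ _ rn sn).
  under eq_bigr => x _ do under eq_bigr => y _ do rewrite schur_ME mulrBr.
  under eq_bigr => x _ do rewrite sumrB.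
  rewrite sumrB; congr (_ - _).
  rewrite big_ord_recl [X in _ + X]big1 ?addr0 => [|i _]; last first.
    by rewrite big1 // => j _; rewrite /= mul0r mulr0.
  rewrite big_ord_recl [X in _ + X]big1 ?addr0 => [|i _]; last first.
    by rewrite /= mulr0 mulr0.
  by rewrite /= /toep !leq0n !subn0 !mulr1.
by rewrite /toep !leq0n !subn0; ring.
Qed.

Lemma schur_M_nil r s : schur_M [::] r s = 0.
Proof.
rewrite schur_ME; elim: s r => [|s IH] r.
  by rewrite schur_Q2r0 schur_q_nil mulr1 subrr.
have e1 := schur_Q2_rec r s ([::] : seq R); have := IH r.+1.
move: e1; rewrite !schur_q_nil /= mul0r !mulr0 !subr0 => e1 e2.
by rewrite e2 addr0 in e1.
Qed.

End Branching.

(** * The Pieri rule *)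

Section PieriSchur.
Variables (R : realType) (n : nat) (a : R) (B : seq R).
Let X := 'I_n.+1.
Let K := {poly R}.

Lemma eqm_pf (Y : Type) (w w' : Y -> Y -> K) s :
  (forall x y, eqm n (w x y) (w' x y)) -> eqm n (pf w s) (pf w' s).
Proof.
move=> ww; case: s => [|y0 s] /=; first exact: eqm_refl.
case: ifP => // _; apply: eqmZ; apply: eqm_sum => t _; apply: eqmM => //.
by apply: eqm_prod => i _; apply: ww.
Qed.

(** One factor 1/2 per nonzero part, as in P_lam = 2^-l(lam) Q_lam. *)
Definition half_pos (r : nat) : R := if r == 0%N then 1 else 2^-1.

(** Its sub-Pfaffians are the P_lam(B), with 'X recording |lam|. *)
Definition graded_M (r s : nat) : K :=
  (half_pos r * half_pos s * schur_M B r s) *: 'X^(r + s).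

Lemma graded_M_anti r s : graded_M r s = - graded_M s r.
Proof.
by rewrite /graded_M schur_M_anti addnC mulrN scaleNr [half_pos r * _]mulrC.
Qed.

(** inl x denotes the basis vector e_x and inr r the column r of the Toeplitz
    matrix, so that T^t N T is the form on the labels inr. *)
Definition label_vec (y : X + X) (z : X) : K :=
  match y with inl x => (x == z)%:R | inr r => (toep a z r)%:P end.

Definition label_form (y y' : X + X) : K :=
  \sum_z \sum_z' label_vec y z * label_vec y' z' * graded_M z z'.

Lemma label_form_anti y y' : label_form y y' = - label_form y' y.
Proof.
rewrite /label_form exchange_big /= -sumrN; apply: eq_bigr => z _.
rewrite -sumrN; apply: eq_bigr => z' _.
by rewrite graded_M_anti mulrN [label_vec y _ * _]mulrC.
Qed.

Lemma label_formll x y : label_form (inl x) (inl y) = graded_M x y.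
Proof.
rewrite /label_form (bigD1 x) //= [X in _ + X]big1 ?addr0 => [|i ne]; last first.
  by rewrite big1 // => j _; rewrite eq_sym (negbTE ne) !mul0r.
rewrite (bigD1 y) //= [X in _ + X]big1 ?addr0 => [|i ne]; last first.
  by rewrite [y == i]eq_sym (negbTE ne) mulr0 mul0r.
by rewrite !eqxx !mul1r.
Qed.

Lemma label_vecr r z : label_vec (inr r) z =
  \sum_(x : X) (toep a x r)%:P * label_vec (inl x) z.
Proof.
rewrite (bigD1 z) //= [X in _ + X]big1 ?addr0 => [|i ne]; last first.
  by rewrite (negbTE ne) mulr0.
by rewrite eqxx mulr1.
Qed.

Lemma label_form_linear r y : label_form (inr r) y =
  \sum_(x : X) (toep a x r)%:P * label_form (inl x) y.
Proof.
rewrite /label_form; under [RHS]eq_bigr => x _ do rewrite big_distrr.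
rewrite [RHS]exchange_big /=; apply: eq_bigr => z _.
under [RHS]eq_bigr => x _ do rewrite big_distrr.
rewrite [RHS]exchange_big /=; apply: eq_bigr => z' _.
rewrite -/(label_vec (inr r) z) label_vecr !big_distrl /=.
by apply: eq_bigr => x _; rewrite -!mulrA.
Qed.

Lemma label_form_slot : slot_linear inl inr (fun x r : X => (toep a x r)%:P)
  (pf label_form).
Proof.
move=> p r s.
apply: (pf_linear (c := fun x : X => (toep a x r)%:P) (l := inl)) => z.
  exact: label_form_linear.
rewrite label_form_anti label_form_linear -sumrN; apply: eq_bigr => x _.
by rewrite [in RHS]label_form_anti mulrN.
Qed.

(** The two outer indices range up to n only, but a coefficient of index at
    most n does not see the truncation. *)
Lemma dblsum_coef (phi : nat -> nat -> R) k : (k <= n)%N ->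
  (\sum_(g < n.+1) \sum_(h < n.+1) phi g h *: 'X^(g + h))`_k =
  \sum_(g < k.+1) phi g (k - g)%N.
Proof.
move=> kn; rewrite coef_sum.
rewrite (bigID (fun x : 'I_n.+1 => (x < k.+1)%N)) /= [X in _ + X]big1 ?addr0; last first.
  move=> g gk; rewrite coef_sum big1 // => h _.
  rewrite coefZ coefXn [k == _]ltn_eqF ?mulr0 // (leq_trans _ (leq_addr _ _)) //.
  by rewrite ltnNge.
rewrite [RHS](big_ord_widen n.+1 (fun g => phi g (k - g)%N)) ?ltnS //.
apply: eq_bigr => g gk; rewrite coef_sum.
have h0 : (k - g < n.+1)%N by rewrite ltnS (leq_trans (leq_subr _ _)).
rewrite (bigD1 (Ordinal h0)) //= big1 ?addr0 => [|h ne]; last first.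
  rewrite coefZ coefXn; case: eqP => [e|]; rewrite ?mulr0 //.
  by move: ne; rewrite -val_eqE /= e addKn eqxx.
by rewrite coefZ coefXn subnKC // eqxx mulr1.
Qed.

Lemma shift_sum (psi : nat -> R) r s k : (r + s <= k)%N ->
  (forall g, (g < r)%N -> psi g = 0) ->
  (forall g, (k - s < g <= k)%N -> psi g = 0) ->
  \sum_(g < k.+1) psi g = \sum_(t < (k - (r + s)).+1) psi (r + t)%N.
Proof.
move=> rsk lo hi.
rewrite -(big_mkord xpredT) (@big_cat_nat _ _ _ r) //=; last by lia.
rewrite big_nat_cond big1 ?add0r; last by move=> g /andP[/andP[_ gr] _]; apply: lo.
rewrite (@big_cat_nat _ _ _ (k - s).+1) //=; [|lia..].
rewrite [X in _ + X]big_nat_cond [X in _ + X]big1 ?addr0; last first.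
  by move=> g /andP[/andP[h1 h2] _]; apply: hi; lia.
rewrite -{1}[r]add0n big_addn big_mkord.
have -> : ((k - s).+1 - r = (k - (r + s)).+1)%N by lia.
by apply: eq_bigr => i _; rewrite addnC.
Qed.

(** The coefficients of (T^t N T)(r, s) / 'X^(r + s), N being graded_M. *)
Definition conv_coef r s c : R := \sum_(t < c.+1)
  fcoef a t * fcoef a (c - t) * (half_pos (r + t) * half_pos (s + (c - t)) *
    schur_M B (r + t) (s + (c - t))).

Lemma label_formrr r s : eqm n (label_form (inr r) (inr s))
  ('X^(r + s) * \poly_(c < n.+1) conv_coef r s c).
Proof.
move=> k kn; rewrite /label_form /=.
pose phi g h := toep a g r * toep a h s * (half_pos g * half_pos h * schur_M B g h).
have -> : \sum_(z < n.+1) \sum_(z' < n.+1) (toep a z r)%:P * (toep a z' s)%:P *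
   graded_M z z' = \sum_(z < n.+1) \sum_(z' < n.+1) phi z z' *: 'X^(z + z').
  by apply: eq_bigr => z _; apply: eq_bigr => z' _; rewrite -polyCM mul_polyC scalerA.
rewrite dblsum_coef // coefXnM; case: ltnP => [lt|le].
  rewrite big1 // => g _; rewrite /phi /toep; case: leqP => h1; last by rewrite !mul0r.
  case: leqP => h2; last by rewrite mulr0 mul0r.
  by have := ltn_ord g; lia.
rewrite coef_poly ltnS (leq_trans (leq_subr _ _) kn).
rewrite (@shift_sum (fun g => phi g (k - g)%N) r s) //; first last.
- move=> g h; rewrite /phi /toep (leqNgt s); have -> : (k - g < s)%N by lia.
  by rewrite mulr0 mul0r.
- by move=> g h; rewrite /phi /toep leqNgt h /= !mul0r.
apply: eq_bigr => t _; rewrite /phi /toep leq_addr addKn.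
have e : (k - (r + t) = s + (k - (r + s) - t))%N by have := ltn_ord t; lia.
by rewrite e leq_addr addKn.
Qed.

(** The generating function q_B at a 'X, the factor contributed by the
    variable a. *)
Definition Qpoly : K := \poly_(c < n.+1) (a ^+ c * schur_q c B).
Definition ypoly s : K := \poly_(c < n.+1) (fcoef a c * schur_q (s + c) B).
(** The congruence by T changes N = graded_M by a perturbation of rank two,
    T^t N T = N + (al /\ be) modulo 'X^n.+1; alv and bev are its two vectors. *)
Definition alv (r : nat) : K :=
  if r == 0%N then 0 else (2^-1 * schur_q r B) *: 'X^r.
Definition bev (r : nat) : K :=
  if r == 0%N then Qpoly - 1 else 2^-1 *: ('X^r * ypoly r).

Lemma fcoefE t : fcoef a t = a ^+ t * fcoef 1 t.
Proof. by rewrite -fcoefM mulr1. Qed.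

Lemma fcoef_half t : fcoef a t * half_pos t = a ^+ t.
Proof.
rewrite /fcoef /half_pos; case: eqP => [->|_]; first by rewrite mulr1.
by rewrite mulrAC divff ?mul1r // pnatr_eq0.
Qed.

Lemma half_posS t : half_pos t.+1 = 2^-1. Proof. by []. Qed.

(** Between positive indices the double weights of half_pos cancel the 2 in
    fcoef, and schur_Q2_conv2 evaluates the convolution. *)
Lemma conv_coef_pos r s c : conv_coef r.+1 s.+1 c = 4^-1 * (
  (c == 0%N)%:R * schur_M B r.+1 s.+1 +
  schur_q r.+1 B * (fcoef a c * schur_q (s.+1 + c) B)
  - schur_q s.+1 B * (fcoef a c * schur_q (r.+1 + c) B)).
Proof.
have -> : conv_coef r.+1 s.+1 c = 4^-1 * (a ^+ c * \sum_(t < c.+1)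
    fcoef 1 t * fcoef 1 (c - t) * schur_Q2 (r.+1 + t) (s.+1 + (c - t)) B).
  rewrite /conv_coef !big_distrr; apply: eq_bigr => t _ /=.
  rewrite fcoefE [fcoef a (c - t)]fcoefE /schur_M !addSn /= !half_posS.
  have -> : a ^+ c = a ^+ t * a ^+ (c - t) by rewrite -exprD subnKC // -ltnS.
  by field.
congr (_ * _); case: c => [|c].
  rewrite big_ord_recl big_ord0 /= !addn0 subn0 /fcoef /schur_M /= expr0.
  by rewrite !mul1r addr0 [schur_q s.+1 B * _]mulrC addrK.
by rewrite schur_Q2_conv2 // /fcoef /=; ring.
Qed.

(** Here half_pos (c - t) turns one of the factors fcoef into a plain power,
    and schur_Q2_conv1 evaluates the convolution. *)
Lemma conv_coef_r0 r c : conv_coef r.+1 0 c =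
  2^-1 * schur_q r.+1 B * (a ^+ c * schur_q c B).
Proof.
have -> : conv_coef r.+1 0 c = 2^-1 * (a ^+ c * \sum_(t < c.+1)
    fcoef 1 t * schur_Q2 (r.+1 + t) (c - t) B).
  rewrite /conv_coef !big_distrr; apply: eq_bigr => t _ /=.
  have -> : a ^+ c = a ^+ t * a ^+ (c - t) by rewrite -exprD subnKC // -ltnS.
  rewrite -(fcoef_half (c - t)) (fcoefE t) /schur_M !addSn !add0n /= !half_posS.
  by ring.
by rewrite schur_Q2_conv1; ring.
Qed.

Lemma label_form_rr_E1 r s : (0 < r)%N -> (0 < s)%N ->
  'X^(r + s) * \poly_(c < n.+1) conv_coef r s c =
  graded_M r s + alv r * bev s - alv s * bev r.
Proof.
case: r s => [|r] [|s] // _ _; rewrite /alv /bev /graded_M /= !half_posS.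
have -> : \poly_(c < n.+1) conv_coef r.+1 s.+1 c = 4^-1 *: (
   (schur_M B r.+1 s.+1)%:P + schur_q r.+1 B *: ypoly s.+1 - schur_q s.+1 B *: ypoly r.+1).
  apply/polyP => i; rewrite coef_poly coefZ coefB coefD !coefZ coefC !coef_poly.
  case: ltnP => ilt; last first.
    by rewrite gtn_eqF ?(leq_trans _ ilt) // !mulr0 addr0 subrr mulr0.
  by rewrite conv_coef_pos; case: eqP => _ /=; ring.
rewrite -!mul_polyC exprD !polyCM.
have -> : (4^-1 : R)%:P = (2^-1)%:P * (2^-1)%:P.
  by rewrite -polyCM -invfM -natrM.
by ring.
Qed.

Lemma label_form_rr_E2 r : (0 < r)%N ->
  'X^(r + 0) * \poly_(c < n.+1) conv_coef r 0 c = Qpoly * alv r.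
Proof.
case: r => // r _; rewrite /alv addn0 /=.
have -> : \poly_(c < n.+1) conv_coef r.+1 0 c = (2^-1 * schur_q r.+1 B) *: Qpoly.
  apply/polyP => i; rewrite coefZ !coef_poly; case: ltnP => // _.
    by rewrite conv_coef_r0.
  by rewrite mulr0.
by rewrite -!mul_polyC; ring.
Qed.

(** The vector be is the row of T^t N at the index 0, that is, the form
    between T-columns and e_0. *)
Lemma label_formrl0 r : eqm n (label_form (inr r) (inl ord0)) (bev r).
Proof.
move=> k kn; rewrite label_form_linear.
under eq_bigr => x _ do rewrite label_formll /graded_M addn0 mul_polyC scalerA.
have -> : (\sum_(x < n.+1) (toep a x r * (half_pos x * half_pos (ord0 : X) *
     schur_M B x (ord0 : X))) *: 'X^x)`_k =
     toep a k r * (half_pos k * schur_M B k 0).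
  rewrite -(@poly_def _ n.+1 (fun x => toep a x r * (half_pos x * 1 * schur_M B x 0))).
  by rewrite coef_poly ltnS kn mulr1.
rewrite /bev /toep; case: (posnP r) => [->|r0].
  rewrite leq0n subn0 coefB coef1 coef_poly ltnS kn mulrA fcoef_half schur_ME.
  by rewrite eqxx mulr1 schur_Q2r0; case: k {kn} => [|k] /=; rewrite ?expr0 ?schur_q0; ring.
case: leqP => rk; last by rewrite coefZ coefXnM rk mulr0 mul0r.
rewrite coefZ coefXnM ltnNge rk /= coef_poly ltnS (leq_trans (leq_subr _ _) kn).
rewrite subnKC // /half_pos /schur_M; have -> : (k == 0)%N = false.
  by rewrite gtn_eqF // (leq_trans r0).
by rewrite /= schur_Q2r0; ring.
Qed.

(** The generic case is conv_coef_pos; the indices 0 are treated apart, since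
    there half_pos and schur_M take exceptional values. *)
Lemma label_formrr_E r s :
  eqm n (label_form (inr r) (inr s)) (graded_M r s + alv r * bev s - alv s * bev r).
Proof.
have half0 m : (0 < m)%N -> graded_M m 0 = alv m.
  case: m => // m _; rewrite /graded_M /alv /= addn0 /schur_M /= schur_Q2r0.
  by rewrite half_posS /half_pos /= mulr1.
have r0E m : eqm n (label_form (inr m) (inr ord0))
    (graded_M m (ord0 : X) + alv m * bev (ord0 : X) - alv (ord0 : X) * bev m).
  apply: (eqm_trans (@label_formrr _ _)).
  case: (posnP m) => m0.
    have -> : m = ord0 by apply/val_inj.
    have -> : \poly_(c < n.+1) conv_coef (ord0 : X) (ord0 : X) c = 0.
      apply/polyP => c; rewrite coef0 coef_poly; case: ifP => // _.
      rewrite /conv_coef.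
      have h : forall x : R, x = - x -> x = 0.
        by move=> x /eqP; rewrite -subr_eq0 opprK -mulr2n mulrn_eq0 /= => /eqP.
      apply: h; rewrite {1}(reindex_inj rev_ord_inj) /= -sumrN.
      apply: eq_bigr => t _; rewrite subSS !add0n subKn -1?ltnS //.
      by rewrite schur_M_anti; ring.
    rewrite mulr0 addrK /graded_M /schur_M /= mulr0 scale0r.
    exact: eqm_refl.
  rewrite /= label_form_rr_E2 // half0 // {2}/alv /= mul0r subr0 /bev /=.
  have -> : alv m + alv m * (Qpoly - 1) = Qpoly * alv m by ring.
  exact: eqm_refl.
case: (posnP s) => s0.
  by have -> : s = ord0 by apply/val_inj.
case: (posnP r) => r0.
  have -> : r = ord0 by apply/val_inj.
  rewrite label_form_anti graded_M_anti.
  set p := graded_M _ _; set u := alv _ * _; set v := alv _ * _.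
  have -> : - p + u - v = - (p + v - u) by ring.
  by move=> k kn; rewrite !coefN r0E.
apply: (eqm_trans (@label_formrr _ _)).
by rewrite label_form_rr_E1.
Qed.

(** The border labels of pieri_form become T e_0 and e_0. *)
Definition insert_form (z : X + bool) : X + X :=
  match z with inl x => inr x | inr true => inr ord0 | inr false => inl ord0 end.
Definition insert_label (z : X + bool) : (X * K) + bool :=
  match z with inl x => inl (x, 0) | inr b => inr b end.

(** The bordered Pfaffian identity for N = graded_M: the border labels are
    T e_0 and e_0, whose values against the other labels are Q al and be, and
    whose mutual value is Q - 1. *)
Lemma pieri_schur (t : seq X) : ~~ odd (size t) ->
  eqm n (pf label_form (map inr t) +
         pf label_form (inr ord0 :: inl ord0 :: map inr t))
        (Qpoly * pf label_form (map inl t)).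
Proof.
move=> te.
pose N (x y : X) := graded_M x y.
pose al (x : X) := alv x; pose be (x : X) := bev x.
have NA x y : N x y = - N y x by exact: graded_M_anti.
have -> : pf label_form (map inl t) = pf N t.
  by rewrite pf_map; apply: eq_pf => x y; rewrite label_formll.
rewrite -(pieri_rank2 al be Qpoly NA te); apply: eqmD.
  by rewrite pf_map; apply: eqm_pf => x y; apply: label_formrr_E.
have := alternating_move (pf_alternating label_form) [::]
  (inr ord0) (inl ord0) (map inr t) [::].
rewrite /= cats0 => ->.
have -> : map inr t ++ [:: inr ord0; inl ord0] =
    map insert_form (map inl t ++ [:: inr true; inr false]).
  by rewrite map_cat -map_comp.
have -> : map (fun x => inl (x, 0)) t ++ [:: inr true; inr false] =
    map insert_label (map inl t ++ [:: inr true; inr false]) :> seq ((X * K) + bool).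
  by rewrite map_cat -map_comp.
rewrite !pf_map; apply: eqm_pf.
have E2 x : eqm n (label_form (inr x) (inr ord0)) (Qpoly * al x).
  apply: (eqm_trans (@label_formrr_E _ _)); rewrite /al {2}/alv /= mul0r subr0.
  rewrite /graded_M /alv /bev /=; case: eqP => [->|/eqP x0].
    by rewrite /schur_M /= mulr0 scale0r mul0r mulr0 addr0; exact: eqm_refl.
  have -> : half_pos x * half_pos (ord0 : X) * schur_M B x (ord0 : X) =
     2^-1 * schur_q x B.
    by rewrite /half_pos /schur_M (negbTE x0) /= mulr1 schur_Q2r0.
  rewrite addn0; set u := _ *: _.
  have -> : u + u * (Qpoly - 1) = Qpoly * u by ring.
  exact: eqm_refl.
have zz (y : X + X) : label_form y y = 0.
  have := label_form_anti y y => /eqP; rewrite -subr_eq0 opprK -mulr2n.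
  by rewrite -mulr_natl mulf_eq0 -polyC_natr polyC_eq0 pnatr_eq0 /= => /eqP.
have opp y y' p : eqm n (label_form y y') p -> eqm n (label_form y' y) (- p).
  by move=> h k kn; rewrite label_form_anti !coefN h.
case=> [x|[]]; case=> [y|[]] /=; rewrite ?mul0r ?subr0 ?addr0 ?zz;
  try exact: eqm_refl.
- exact: label_formrr_E.
- exact: E2.
- exact: label_formrl0.
- exact/opp/E2.
- exact: label_formrl0.
- exact/opp/label_formrl0.
- exact/opp/(@label_formrl0 ord0).
Qed.
End PieriSchur.

(** * The Cauchy sum as an iterated contraction *)

Section CauchyOperator.
Variables (R : realType) (n : nat) (B : seq R).
Let X := 'I_n.+1.
Let K := {poly R}.

Lemma iter_pair_op_map (Y : Type) (l : X -> Y) (c : X -> X -> K) (F : seq Y -> K) m t :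
  iter m (pair_op c l) F (map l t) = iter m (pair_op c id) (fun t => F (map l t)) t.
Proof.
elim: m t => //= m IH t; apply: eq_bigr => x _; apply: eq_bigr => y _.
by rewrite -(IH (x :: y :: t)).
Qed.

Lemma eqm_iter_pair_op (c : X -> X -> K) (G G' : seq X -> K) Q m t :
  (forall s, size s = (size t + m.*2)%N -> eqm n (G s) (Q * G' s)) ->
  eqm n (iter m (pair_op c id) G t) (Q * iter m (pair_op c id) G' t).
Proof.
elim: m t => [|m IH] t h /=; first by apply: h; rewrite addn0.
rewrite /pair_op big_distrr; apply: eqm_sum => x _ /=.
rewrite big_distrr; apply: eqm_sum => y _ /=.
rewrite mulrCA; apply: eqmM => //; apply: (IH (x :: y :: t)) => s sz.
by apply: h; rewrite sz /=; lia.
Qed.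

(** The Cauchy sum, by the number 2 m of indices, as contractions of the
    Pfaffians of B with the matrix of A.  At most n + 1 indices are distinct, so
    the range of m covers all nonzero terms. *)
Definition schur_Z (A : seq R) : K := \sum_(m < n.+2) pf_norm R m *:
  iter m (pair_op (fun x y : X => (schur_M A x y)%:P) id)
    (pf (fun x y : X => graded_M B x y)) [::].

Lemma schur_Z_nil : schur_Z [::] = 1.
Proof.
have h m F : iter m.+1 (pair_op (fun x y : X => (schur_M ([::] : seq R) x y)%:P) id) F [::] = 0 :> K.
  rewrite iterS /pair_op big1 // => x _; rewrite big1 // => y _.
  by rewrite schur_M_nil polyC0 mul0r.
rewrite /schur_Z big_ord_recl big1 ?addr0 => [|i _].
  by rewrite /pf_norm invr1 scale1r.
by rewrite [iter _ _ _ _](h i) scaler0.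
Qed.

Section OneVariable.
Variables (a : R) (A : seq R).
Let c (x y : X) : K := (schur_M A x y)%:P.
Let c' (x y : X) : K := (schur_M (a :: A) x y)%:P.
Let F : seq (X + X) -> K := pf (label_form a B).

(** Contraction with T M_A T^t is contraction with M_A along the columns of
    T.  The perturbation (T e_0 /\ e_0) inserts T e_0 and e_0, in both orders;
    alternation makes the two orders equal, whence the factor 2. *)
Lemma schur_pair_op_step (G : seq (X + X) -> K) : alternating G ->
  slot_linear inl inr (fun x r : X => (toep a x r)%:P) G ->
  forall s, pair_op c' inl G s =
    pair_op c inr G s + insert2 (inr ord0) (inl ord0) G s *+ 2.
Proof.
move=> alt lin s.
have lin1 r p : G (inr r :: p) = \sum_(x : X) (toep a x r)%:P * G (inl x :: p).
  exact: (lin [::]).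
have lin2 r p x : G (inl x :: inr r :: p) =
    \sum_(y : X) (toep a y r)%:P * G (inl x :: inl y :: p).
  exact: (lin [:: inl x]).
have -> : pair_op c inr G s = \sum_(x : X) \sum_(y : X)
    (\sum_(r : X) \sum_(r' : X) toep a x r * toep a y r' * schur_M A r r')%:P *
    G (inl x :: inl y :: s).
  transitivity (\sum_(r : X) \sum_(r' : X) \sum_(x : X) \sum_(y : X)
    (toep a x r * toep a y r' * schur_M A r r')%:P * G (inl x :: inl y :: s)).
    apply: eq_bigr => r _; apply: eq_bigr => r' _.
    rewrite lin1 big_distrr; apply: eq_bigr => x _ /=.
    rewrite lin2 !big_distrr; apply: eq_bigr => y _ /=.
    by rewrite !polyCM /c; ring.
  under eq_bigr => r _ do rewrite exchange_big /=.
  rewrite exchange_big /=; apply: eq_bigr => x _.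
  under eq_bigr => r _ do rewrite exchange_big /=.
  rewrite exchange_big /=; apply: eq_bigr => y _.
  rewrite rmorph_sum /= big_distrl; apply: eq_bigr => r _ /=.
  by rewrite rmorph_sum /= big_distrl.
have -> : insert2 (inr ord0) (inl ord0) G s *+ 2 = \sum_(x : X) \sum_(y : X)
   (toep a x (ord0 : X) * (y == 0%N :> nat)%:R - (x == 0%N :> nat)%:R * toep a y (ord0 : X))%:P
     * G (inl x :: inl y :: s).
  under eq_bigr => x _ do under eq_bigr => y _ do rewrite polyCB mulrBl.
  under eq_bigr => x _ do rewrite sumrB.
  rewrite sumrB mulr2n; congr (_ + _).
    rewrite /insert2 lin1; apply: eq_bigr => x _.
    rewrite (bigD1 ord0) //= mulr1 big1 ?addr0 // => y y0.
    by rewrite -[(y == 0%N :> nat)]/(y == ord0) (negbTE y0) mulr0 polyC0 mul0r.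
  rewrite /insert2 lin1 [in RHS](bigD1 ord0) //= [X in - (_ + X)]big1 ?addr0; last first.
    move=> x x0; rewrite big1 // => y _.
    by rewrite -[(x == 0%N :> nat)]/(x == ord0) (negbTE x0) mul0r polyC0 mul0r.
  rewrite -sumrN; apply: eq_bigr => y _; rewrite mul1r -mulrN.
  by rewrite (alt [::] (inl y) (inl ord0) s).
rewrite -big_split; apply: eq_bigr => x _ /=.
rewrite -big_split; apply: eq_bigr => y _ /=.
rewrite -mulrDl -polyCD /c' (@schur_M_branch _ n); first by rewrite addrA.
  by rewrite -ltnS ltn_ord.
by rewrite -ltnS ltn_ord.
Qed.

(** The linear term of the expansion has a factor 2 m, which the
    normalisation absorbs while lowering m by one; after this shift both terms
    run over the same m and the Pieri rule applies to each summand. *)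
Lemma schur_Z_cons : eqm n (schur_Z (a :: A)) (Qpoly n a B * schur_Z A).
Proof.
pose N (x y : X) := graded_M B x y.
have FlE : (fun t : seq X => F (map inl t)) = pf N.
  apply/funext => t; rewrite /F pf_map; apply: eq_pf => x y.
  exact: label_formll.
have altF : alternating F by exact: pf_alternating.
have linF : slot_linear inl inr (fun x r : X => (toep a x r)%:P) F.
  exact: label_form_slot.
pose F2 := insert2 (inr (ord0 : X)) (inl (ord0 : X)) F.
have key m : iter m (pair_op c' id) (pf N) [::] =
    iter m (pair_op c id) (fun t => F (map inr t)) [::] +
    iter m.-1 (pair_op c id) (fun t => F2 (map inr t)) [::] *+ m.*2.
  rewrite -FlE -(iter_pair_op_map inl c' F m [::]) /=.
  rewrite (iter_pair_op_rank2 schur_pair_op_step) //.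
  by rewrite -(iter_pair_op_map inr c F m [::]) -(iter_pair_op_map inr c _ m.-1 [::]).
pose S1 := \sum_(m < n.+2) pf_norm R m *: iter m (pair_op c id) (fun t => F (map inr t)) [::].
pose S2 := \sum_(m < n.+2) pf_norm R m *: iter m (pair_op c id) (fun t => F2 (map inr t)) [::].
have pieri t : ~~ odd (size t) ->
    eqm n (F (map inr t) + F2 (map inr t)) (Qpoly n a B * pf N t).
  by move=> te; rewrite -FlE; apply: pieri_schur.
(* lists of more than n + 1 indices have a repetition: this discards the extra
   term produced by the shift of m *)
have dup0 m (t : seq X) : size t = (size ([::] : seq X) + m.*2)%N -> (n < m)%N -> ~~ uniq t.
  move=> sz nm; apply/negP => /card_uniqP e.
  have := max_card (mem t); rewrite e card_ord sz add0n => h.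
  by have := leq_trans h nm; rewrite -addnn; lia.
have e1 : eqm n (schur_Z (a :: A)) (S1 + S2).
  rewrite /schur_Z.
  under eq_bigr => m _ do rewrite -/N key scalerDr.
  rewrite big_split /=; apply: eqmD => //.
  rewrite big_ord_recl /= mulr0n scaler0 add0r /S2 [X in eqm _ _ X]big_ord_recr.
  rewrite -[X in eqm n X _]addr0; apply: eqmD.
    apply: eqm_sum => m _ /=; rewrite -/N.
    by rewrite /bump /= add1n -scaler_nat scalerA pf_normS.
  apply: eqm_sym.
  rewrite -[X in eqm _ _ X](scaler0 _ (pf_norm R n.+1)); apply: eqmZ.
  rewrite -[X in eqm _ _ X](mul0r (iter n.+1 (pair_op c id) (pf N) [::])).
  apply: eqm_iter_pair_op => s sz; rewrite mul0r.
  have nu := dup0 _ _ sz (leqnn n.+1).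
  have := pieri s; rewrite sz odd_double => /(_ isT).
  rewrite (pf_dup _ nu) mulr0 [F (map inr s)]pf_dup ?add0r //.
  by rewrite map_inj_uniq // => x y [].
apply: (eqm_trans e1).
rewrite /S1 /S2 -big_split /= /schur_Z big_distrr; apply: eqm_sum => m _ /=.
rewrite -scalerDr -scalerAr; apply: eqmZ.
have -> : iter m (pair_op c id) (fun t => F (map inr t)) [::] +
   iter m (pair_op c id) (fun t => F2 (map inr t)) [::] =
   iter m (pair_op c id) (fun t => F (map inr t) + F2 (map inr t)) [::].
  move: [::]; elim: (m : nat) => //= k IH t.
  by rewrite -[RHS](eq_bigr _ (fun x _ => eq_bigr _ (fun y _ => congr1 _ (IH _)))) -(pair_opD _ _ _ _ 1).
apply: eqm_iter_pair_op => s sz; apply: pieri.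
by rewrite sz odd_double.
Qed.
End OneVariable.

Lemma schur_Z_prod A : eqm n (schur_Z A) (\prod_(a <- A) Qpoly n a B).
Proof.
elim: A => [|a A IH]; first by rewrite schur_Z_nil big_nil; exact: eqm_refl.
rewrite big_cons; apply: (eqm_trans (@schur_Z_cons _ _)).
exact: eqmM.
Qed.

(** The product of the factors Qpoly over A is the generating function of the
    alphabet of products, up to degree n. *)
Lemma schur_Z_coef A : (schur_Z A)`_n = schur_q n [seq a * b | a <- A, b <- B].
Proof.
rewrite (@schur_Z_prod A n) // (schur_qE _ (leqnn n)).
have -> : schur_gen n [seq a * b | a <- A, b <- B] =
    \prod_(a <- A) schur_gen n (scale_alphabet a B).
  elim: A => [|a A IH]; first by rewrite /schur_gen /= !big_nil.
  by rewrite /= big_cons -IH schur_gen_cat.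
suff h : eqm n (\prod_(a <- A) Qpoly n a B) (\prod_(a <- A) schur_gen n (scale_alphabet a B)).
  by rewrite h.
apply: eqm_prod => a _ k kn.
by rewrite coef_poly ltnS kn -(schur_qE _ kn) schur_q_scale.
Qed.

End CauchyOperator.

(** * From contractions to sums over subsets *)

Section TupleSums.
Variables (R : numFieldType) (K : comAlgType R) (X : finType).

Lemma sum_tuple_cons k (phi : seq X -> K) :
  \sum_(t : k.+1.-tuple X) phi t = \sum_x \sum_(t : k.-tuple X) phi (x :: t).
Proof.
rewrite pair_big /= (reindex (fun p : X * k.-tuple X => [tuple of p.1 :: p.2])) //=.
exists (fun t : k.+1.-tuple X => (thead t, [tuple of behead t])) => [[x t] _|t _] /=.
  by congr (_, _); apply/val_inj.
by rewrite [RHS]tuple_eta; apply/val_inj.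
Qed.

(** Unfolding of the iterated sums; the innermost contraction adds the first
    two entries of the tuple. *)
Lemma iter_pair_op_tuple (x0 : X) (c : X -> X -> K) (F : seq X -> K) m :
  iter m (pair_op c id) F [::] = \sum_(t : (m.*2).-tuple X)
    (\prod_(i < m) c (nth x0 t i.*2) (nth x0 t i.*2.+1)) * F t.
Proof.
elim: m F => [|m IH] F.
  rewrite (eq_bigr (fun=> F [::])) => [|t _]; last first.
    by rewrite big_ord0 mul1r tuple0.
  by rewrite sumr_const card_tuple expn0.
rewrite iterSr IH doubleS.
pose phi (t : seq X) := (\prod_(i < m.+1) c (nth x0 t i.*2) (nth x0 t i.*2.+1)) * F t.
rewrite (sum_tuple_cons _ phi).
under [RHS]eq_bigr => x _ do rewrite (sum_tuple_cons _ (fun t => phi (x :: t))).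
transitivity (\sum_(t : (m.*2).-tuple X) \sum_x \sum_y
    (\prod_(i < m) c (nth x0 t i.*2) (nth x0 t i.*2.+1)) *
    (c x y * F (x :: y :: t))).
  apply: eq_bigr => t _; rewrite big_distrr; apply: eq_bigr => x _ /=.
  by rewrite big_distrr.
rewrite exchange_big /=; apply: eq_bigr => x _.
rewrite exchange_big /=; apply: eq_bigr => y _.
apply: eq_bigr => t _; rewrite /phi big_ord_recl /= mulrA; congr (_ * _).
by rewrite mulrC; congr (_ * _).
Qed.

Lemma pf_tuple_perm (w : X -> X -> K) m (t : (m.*2).-tuple X) (s : 'S_(m.*2)) :
  pf w [tuple tnth t (s i) | i < m.*2] = (-1) ^+ s * pf w t.
Proof.
case: m t s => [|m] t s.
  by rewrite [in LHS]tuple0 [in RHS]tuple0 (_ : s = 1%g) ?odd_perm1 ?mul1r //;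
    apply/permP => -[].
have x0 := thead t.
rewrite (pfE w x0 (m := m.+1)) ?size_tuple // (pfE w x0 (m := m.+1) (s := t)) ?size_tuple //.
rewrite -scalerAr -pfsum_perm; congr (_ *: _); apply: eq_pfsum => i j _.
by rewrite -!tnth_nth !tnth_mktuple.
Qed.

(** Both factors change by the sign of the permutation. *)
Lemma pf_perm_eq_mul (c w : X -> X -> K) (s s' : seq X) : perm_eq s s' ->
  pf c s * pf w s = pf c s' * pf w s'.
Proof.
move=> ss; have sz := perm_size ss.
have [so|/even_sizeP[m szm]] := boolP (odd (size s)).
  by rewrite !pf_odd_size // -sz.
have szm' : size s' == m.*2 by rewrite -sz szm.
move/eqP: szm => szm.
move: ss; rewrite -[s]/(val (Tuple szm)) -[s']/(val (Tuple szm')).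
move/tuple_permP => [p ->]; rewrite !pf_tuple_perm.
by rewrite mulrACA -signr_addb addbb mul1r.
Qed.

(** Averaging the summand over all reorderings of a tuple turns the product
    of entries of c into the Pfaffian of c.  Tuples with a repetition vanish, and
    each subset of 2 m elements is the content of (2 m)! tuples. *)
Lemma pf_pair_op (x0 : X) (c w : X -> X -> K) m :
  pf_norm R m *: iter m (pair_op c id) (pf w) [::] =
  \sum_(S : {set X} | #|S| == m.*2) pf c (enum S) * pf w (enum S).
Proof.
pose H (t : seq X) := pf c t * pf w t.
have tE : \sum_(t : (m.*2).-tuple X) H t =
    ((m.*2)`!)%:R * \sum_(S : {set X} | #|S| == m.*2) H (enum S).
  rewrite (bigID (fun t : (m.*2).-tuple X => uniq t)) /= [X in _ + X]big1 ?addr0; last first.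
    by move=> t nu; rewrite /H (pf_dup _ nu) mul0r.
  rewrite (partition_big (fun t : (m.*2).-tuple X => [set x in t])
    (fun S : {set X} => #|S| == m.*2)) /=; last first.
    by move=> t ut; rewrite cardsE (card_uniqP ut) size_tuple.
  rewrite big_distrr; apply: eq_bigr => S /eqP cS /=.
  rewrite (eq_bigr (fun=> H (enum S))); last first.
    move=> t /andP[ut /eqP tS]; apply: pf_perm_eq_mul; apply: uniq_perm => //.
      exact: enum_uniq.
    by move=> x; rewrite mem_enum -tS inE.
  rewrite sumr_const -[LHS]mulr_natl; congr (_%:R * _).
  transitivity #|[set t : (m.*2).-tuple X | all (mem S) t & uniq t]|.
    rewrite cardsE; apply: eq_card => t; rewrite -!topredE /= [RHS]andbC; case ut: (uniq t) => //=.
    apply/eqP/idP => [<-|/allP h]; first by apply/allP => x xt; rewrite /= inE.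
    apply/eqP; rewrite eqEcard cS cardsE (card_uniqP ut) size_tuple leqnn andbT.
    by apply/fintype.subsetP => x; rewrite inE => /h.
  by rewrite card_uniq_tuples cS ffactnn.
have fne : ((m.*2)`!)%:R != 0 :> R by rewrite pnatr_eq0 -lt0n fact_gt0.
apply: (scalerI fne); rewrite [RHS]scaler_nat -[RHS]mulr_natl -tE (iter_pair_op_tuple x0).
transitivity (pf_norm R m *: \sum_(s : 'S_(m.*2)) \sum_(t : (m.*2).-tuple X)
   (\prod_(i < m) c (nth x0 t i.*2) (nth x0 t i.*2.+1)) * pf w t).
  rewrite scalerA mulrC -scalerA; congr (_ *: _).
  by rewrite sumr_const card_Sn scaler_nat.
under [RHS]eq_bigr => t _ do
  rewrite /H (pfE c x0 (m := m)) ?size_tuple // -scalerAl /pfsum big_distrl.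
rewrite -scaler_sumr [in RHS]exchange_big /=; congr (_ *: _); apply: eq_bigr => s _.
pose g (t : (m.*2).-tuple X) := [tuple tnth t (s i) | i < m.*2].
have gK : bijective g.
  exists (fun t => [tuple tnth t ((s^-1)%g i) | i < m.*2]) => t;
    by apply: eq_from_tnth => i; rewrite !tnth_mktuple ?permK ?permKV.
rewrite (reindex g) /=; last exact: onW_bij.
apply: eq_bigr => t _; rewrite pf_tuple_perm mulrCA mulrA; congr (_ * _ * _).
have e (j : 'I_m.*2) : nth x0 (g t) j = nth x0 t (s j).
  by rewrite -!tnth_nth tnth_mktuple.
by apply: eq_bigr => i _; exact: (congr2 c (e (pf_even i)) (e (pf_odd i))).
Qed.
End TupleSums.

Section PfScaling.
Variable K : comNzRingType.

Lemma prod_pairs m (u : nat -> K) :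
  \prod_(i < m) (u i.*2 * u i.*2.+1) = \prod_(i < m.*2) u i.
Proof.
elim: m => [|m IH]; first by rewrite !big_ord0.
by rewrite doubleS !big_ord_recr /= IH mulrA.
Qed.

(** Every index occurs exactly once in each summand. *)
Lemma pfsum_scale m (u : 'I_m.*2 -> K) (A B : 'I_m.*2 -> 'I_m.*2 -> K) :
  (forall i j, i != j -> A i j = u i * u j * B i j) ->
  pfsum A = (\prod_i u i) * pfsum B.
Proof.
move=> AB; rewrite /pfsum big_distrr; apply: eq_bigr => s _ /=.
rewrite mulrCA; congr (_ * _).
have -> : \prod_i u i = \prod_(i < m) (u (s (pf_even i)) * u (s (pf_odd i))).
  rewrite (reindex_inj (@perm_inj _ s)) /=.
  case: m u s {A B AB} => [|m] u s; first by rewrite !big_ord0.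
  have h (i : 'I_m.+1.*2) : u (s i) = (fun k => u (s (inord k))) (nat_of_ord i).
    by congr (u (s _)); apply/val_inj; rewrite /= inordK.
  rewrite (eq_bigr _ (fun i _ => h i)).
  rewrite -(@prod_pairs m.+1 (fun k => u (s (inord k)))); apply: eq_bigr => i _.
  by congr (u (s _) * u (s _)); apply/val_inj; rewrite /= inordK // -?doubleS ?ltn_double ?ltn_Sdouble.
rewrite -big_split; apply: eq_bigr => i _ /=.
by apply: AB; rewrite (inj_eq perm_inj) pf_even_odd.
Qed.
End PfScaling.

(** * Strict partitions and the graded Cauchy identity *)

Section StrictPartitions.
Variable R : realType.
Implicit Types A B : seq R.

Lemma strict_nth_gt0 (lam : strict_part) i : (i < size lam)%N ->
  (0 < nth 0%N lam i)%N.
Proof.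
case: lam => l /= /andP[_ n0] il; rewrite lt0n; apply: contraNneq n0 => <-.
exact: mem_nth.
Qed.

Lemma uphalf_double_le s : ((uphalf s).*2 <= s.+1)%N.
Proof. by rewrite -[leqRHS]odd_double_half leq_addl. Qed.

Lemma uphalf_double_ge s : (s <= (uphalf s).*2)%N.
Proof. by have := odd_double_half s.+1; rewrite -[s.+1./2]/(uphalf s); case: (odd _) => /=; lia. Qed.

(** The size of lam is rounded up to the even number m.*2; the entry nth
    past the end is the padding part 0, where schur_M and the defining matrix
    agree off the diagonal. *)
Lemma schur_QE (lam : strict_part) A m : uphalf (size lam) = m ->
  schur_Q lam A = pf_norm R m *
    pfsum (fun i j : 'I_m.*2 => schur_M A (nth 0%N lam i) (nth 0%N lam j)).
Proof.
move=> <-; rewrite /schur_Q /pfaffian -/(pf_norm R _); congr (_ * _).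
set f := fun_of_matrix _; rewrite -[LHS]/(pfsum f); apply: eq_pfsum => i j ij.
rewrite /f mxE.
have up (k l : 'I_(uphalf (size lam)).*2) : (k < l)%N ->
    schur_Q2 (nth 0%N lam k) (nth 0%N lam l) A = schur_M A (nth 0%N lam k) (nth 0%N lam l).
  move=> kl; rewrite /schur_M; have : (0 < nth 0%N lam k)%N.
    apply: strict_nth_gt0.
    by have := leq_trans (leq_ltn_trans kl (ltn_ord l)) (uphalf_double_le _).
  by rewrite lt0n => /negbTE ->.
case: ltngtP => h.
- exact: up.
- by rewrite up // [RHS]schur_M_anti.
- by move/val_inj: h ij => ->; rewrite eqxx.
Qed.

Lemma prod_nth_pad (T : comNzRingType) (u : nat -> T) (l : seq nat) m :
  u 0%N = 1 -> (size l <= m)%N -> \prod_(i < m) u (nth 0%N l i) = \prod_(x <- l) u x.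
Proof.
move=> u0 lm; rewrite (big_nth 0%N) big_mkord.
rewrite [RHS](big_ord_widen m (fun i => u (nth 0%N l i))) // [RHS]big_mkcond /=.
apply: eq_bigr => i _; case: ltnP => // h.
by rewrite nth_default.
Qed.

Lemma prodX_sumn (z : R) (l : seq nat) : \prod_(x <- l) z ^+ x = z ^+ sumn l.
Proof.
elim: l => [|x l IH]; first by rewrite big_nil.
by rewrite big_cons IH -exprD.
Qed.

(** Q_(r,s) is homogeneous of degree r + s, and the index set of the Pfaffian
    sums up to |lam|. *)
Lemma schur_Q_scale (lam : strict_part) (z : R) A :
  schur_Q lam (scale_alphabet z A) = z ^+ sumn lam * schur_Q lam A.
Proof.
rewrite !(schur_QE _ erefl) mulrCA; congr (_ * _).
rewrite (pfsum_scale (u := fun i => z ^+ nth 0%N lam i)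
  (B := fun i j => schur_M A (nth 0%N lam i) (nth 0%N lam j))); last first.
  move=> i j _; rewrite -exprD /schur_M; case: ifP => _; first by rewrite mulr0.
  rewrite /schur_Q2 !schur_q_scale mulrDr exprD; congr (_ + _); first by ring.
  rewrite mulrCA; congr (_ * _); rewrite big_distrr; apply: eq_big_nat => k /andP[_ ks] /=.
  rewrite !schur_q_scale.
  have -> : z ^+ nth 0%N lam j = z ^+ k * z ^+ (nth 0%N lam j - k).
    by rewrite -exprD subnKC.
  by rewrite exprD; ring.
rewrite (@prod_nth_pad _ (fun k => z ^+ k)) ?expr0 ?prodX_sumn //.
exact: uphalf_double_ge.
Qed.

Section Enumeration.
Variable n : nat.
Let X := 'I_n.+1.

(** Strict partitions with parts at most n are subsets of {1, ..., n}; the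
    element 0 of X is available to make the cardinality even, so that they
    correspond bijectively to the subsets of X of even cardinality. *)
Definition parts_of_set (S : {set X}) : seq nat :=
  rev [seq x <- map val (enum S) | x != 0%N].

Lemma sorted_enum_set (S : {set X}) : sorted ltn (map val (enum S)).
Proof.
rewrite sorted_map; apply: (@subseq_sorted _ _ _ (enum S) (enum X)).
- by move=> x y z /= h1 h2; exact: ltn_trans h1 h2.
- by rewrite enumT; exact: filter_subseq.
- by rewrite -sorted_map val_enum_ord iota_ltn_sorted.
Qed.

Lemma parts_of_set_strict (S : {set X}) : is_strict_part (parts_of_set S).
Proof.
apply/andP; split; last by rewrite mem_rev mem_filter.
rewrite rev_sorted; apply: sorted_filter; last exact: sorted_enum_set.
by move=> x y z /= h1 h2; exact: ltn_trans h1 h2.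
Qed.

Definition strict_of_set (S : {set X}) : strict_part :=
  exist _ (parts_of_set S) (parts_of_set_strict S).

Lemma mem_parts_of_set (S : {set X}) x :
  (x \in parts_of_set S) = (x != 0%N) && [exists y in S, val y == x].
Proof.
rewrite mem_rev mem_filter; congr (_ && _).
apply/mapP/exists_inP => [[y yS ->]|[y yS /eqP <-]].
  by exists y => //; rewrite mem_enum in yS.
by exists y => //; rewrite mem_enum.
Qed.

Lemma enum_set0 (S : {set X}) : (ord0 : X) \in S -> map val (rev (enum S)) = rcons (parts_of_set S) 0%N.
Proof.
move=> S0; rewrite map_rev /parts_of_set; have := sorted_enum_set S.
have : 0%N \in map val (enum S) by apply/mapP; exists ord0; rewrite ?mem_enum.
case: (map val (enum S)) => // x l; rewrite inE => /orP[/eqP <-|l0] /=.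
  rewrite (path_sortedE) => [/andP[/allP h _]|a b c /= h1 h2]; last exact: ltn_trans h1 h2.
  rewrite rev_cons; congr (rcons (rev _) _); apply/esym/all_filterP/allP => y /h /=.
  by rewrite lt0n.
rewrite (path_sortedE) => [/andP[/allP /(_ _ l0)]//|a b c /= h1 h2].
exact: ltn_trans h1 h2.
Qed.

Lemma enum_setN0 (S : {set X}) : (ord0 : X) \notin S -> map val (rev (enum S)) = parts_of_set S.
Proof.
move=> S0; rewrite map_rev /parts_of_set; congr rev; apply/esym/all_filterP/allP => y.
case/mapP => z; rewrite mem_enum => zS ->; apply: contraNneq S0 => z0.
by rewrite (_ : ord0 = z) //; apply/val_inj.
Qed.

Lemma nth_parts_of_set (S : {set X}) i :
  nth 0%N (parts_of_set S) i = nth 0%N (map val (rev (enum S))) i.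
Proof.
have [S0|S0] := boolP ((ord0 : X) \in S); last by rewrite enum_setN0.
by rewrite enum_set0 // nth_rcons; case: ltnP => h; rewrite ?if_same // nth_default.
Qed.

Lemma size_parts_of_set (S : {set X}) : size (parts_of_set S) = (#|S| - ((ord0 : X) \in S))%N.
Proof.
have e : size (map val (rev (enum S))) = #|S| by rewrite size_map size_rev -cardE.
rewrite -e; have [S0|S0] := boolP ((ord0 : X) \in S); last by rewrite enum_setN0 ?subn0.
by rewrite enum_set0 // size_rcons subn1.
Qed.

Lemma uphalf_parts_of_set (S : {set X}) m : #|S| = m.*2 -> uphalf (size (parts_of_set S)) = m.
Proof.
move=> cS; rewrite size_parts_of_set cS.
have [S0|S0] := boolP ((ord0 : X) \in S); last by rewrite subn0 uphalf_double.
have : (0 < #|S|)%N by apply/card_gt0P; exists ord0.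
rewrite cS double_gt0; case: m {cS} => // m _.
by rewrite doubleS subn1 /= doubleK.
Qed.

Lemma sumn_parts_of_set (S : {set X}) : sumn (parts_of_set S) = (\sum_(i in S) i)%N.
Proof.
rewrite sumn_rev sumnE big_filter big_map [LHS]big_mkcond /= big_enum /=.
by apply: eq_bigr => i _; case: eqP => [->|].
Qed.

Lemma odd_size_parts_of_set (S : {set X}) : ~~ odd #|S| ->
  odd (size (parts_of_set S)) = ((ord0 : X) \in S).
Proof.
move=> eS; rewrite size_parts_of_set.
have [S0|S0] := boolP ((ord0 : X) \in S); last by rewrite subn0 (negbTE eS).
have : (0 < #|S|)%N by apply/card_gt0P; exists ord0.
by rewrite subn1; case: #|S| eS => //= k; rewrite negbK.
Qed.

Lemma strict_of_set_inj (S S' : {set X}) : ~~ odd #|S| -> ~~ odd #|S'| ->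
  strict_of_set S = strict_of_set S' -> S = S'.
Proof.
move=> eS eS' /(congr1 parts) /= e.
have h : (ord0 \in S) = (ord0 \in S') by rewrite -!odd_size_parts_of_set // e.
apply/setP => x; have [->//|x0] := eqVneq x ord0.
have pE (T : {set X}) : (x \in T) = (val x \in parts_of_set T).
  rewrite mem_parts_of_set [val x != _]x0 /=; apply/idP/exists_inP => [xT|[y yT /eqP]].
    by exists x.
  by move/val_inj => <-.
by rewrite !pE e.
Qed.

Lemma strict_of_set_surj (lam : strict_part) : (sumn lam <= n)%N ->
  exists2 S : {set X}, ~~ odd #|S| & strict_of_set S = lam.
Proof.
move=> ln; have le x : x \in parts lam -> (x <= n)%N.
  move=> xl; apply: leq_trans ln; elim: (parts lam) xl => //= y l IH.
  by rewrite inE => /orP[/eqP->|/IH h]; lia.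
pose S0 : {set X} := [set x | (val x != 0%N) && (val x \in parts lam)].
pose S : {set X} := if odd #|S0| then ord0 |: S0 else S0.
have n0 : (ord0 : X) \notin S0 by rewrite inE.
exists S.
  rewrite /S; case: ifP => h; last by rewrite h.
  by rewrite cardsU1 n0 /= h.
have mS y : (y \in parts_of_set S) = (y \in parts lam).
  rewrite mem_parts_of_set; case: (eqVneq y 0%N) => [->|y0] /=.
    by case: (lam) => l /= /andP[_ /negbTE ->].
  apply/exists_inP/idP => [[x xS /eqP xy]|yl].
    have : x \in S0.
      move: xS; rewrite /S; case: ifP => // _; rewrite in_setU1 => /orP[/eqP x0|//].
      by move: y0; rewrite -xy x0.
    by rewrite inE -xy => /andP[].
  exists (inord y); last by rewrite /= inordK ?ltnS ?le.
  have : inord y \in S0 by rewrite inE /= inordK ?ltnS ?le // y0.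
  by rewrite /S; case: ifP => // _; rewrite in_setU1 orbC => ->.
apply/val_inj; apply: (irr_sorted_eq (leT := gtn)) => //=.
- by move=> x y z /= h1 h2; exact: ltn_trans h2 h1.
- by move=> x; rewrite /= ltnn.
- by have /andP[] := parts_of_set_strict S.
- by have /andP[] := valP lam.
Qed.

(** All strict partitions of n, obtained from the even subsets with sum n. *)
Definition strict_parts : seq strict_part :=
  [seq strict_of_set U | U : {set X} in [pred U : {set X} | ~~ odd #|U| &
     (\sum_(i in U) i == n)%N]].

Lemma strict_parts_uniq : uniq strict_parts.
Proof.
rewrite map_inj_in_uniq ?enum_uniq // => S S'.
rewrite !mem_enum !inE => /andP[eS _] /andP[eS' _]; exact: strict_of_set_inj.
Qed.

Lemma mem_strict_parts (lam : strict_part) : (lam \in strict_parts) = (sumn lam == n).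
Proof.
apply/mapP/eqP => [[S]|ln].
  by rewrite mem_enum inE => /andP[_ /eqP <-] ->; rewrite -sumn_parts_of_set.
have [S eS SE] := strict_of_set_surj (eq_leq ln).
exists S => //; rewrite mem_enum inE eS /= -sumn_parts_of_set.
by rewrite -ln -SE.
Qed.

Let K := {poly R}.

Lemma pf_schur_M (S : {set X}) A : ~~ odd #|S| ->
  pf (fun x y : X => (schur_M A x y)%:P : K) (rev (enum S)) =
  (schur_Q (strict_of_set S) A)%:P.
Proof.
move=> /even_halfK; set m := #|S|./2 => /esym cS.
have sz : size (rev (enum S)) = m.*2 by rewrite size_rev -cardE.
rewrite (pfE _ ord0 sz) (@schur_QE (strict_of_set S) A m (uphalf_parts_of_set cS)).
rewrite polyCM -mul_polyC; congr (_ * _).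
rewrite /pfsum rmorph_sum; apply: eq_bigr => s _ /=.
rewrite rmorphM rmorph_prod rmorph_sign; congr (_ * _); apply: eq_bigr => i _.
by rewrite !nth_parts_of_set !(nth_map ord0) ?sz ?ltn_ord.
Qed.

(** The factors half_pos give 2^-l(lam), as the padding 0 has weight 1. *)
Lemma pf_graded_M (S : {set X}) B : ~~ odd #|S| ->
  pf (fun x y : X => graded_M B x y) (rev (enum S)) =
  schur_P (strict_of_set S) B *: 'X^(\sum_(i in S) i).
Proof.
move=> eS; have eS' := eS.
move: eS' => /even_halfK; set m := #|S|./2 => /esym cS.
have sz : size (rev (enum S)) = m.*2 by rewrite size_rev -cardE.
rewrite /schur_P -scalerA -mul_polyC -mul_polyC -pf_schur_M //.
rewrite !(pfE _ ord0 sz) -scalerAl -scalerAr; congr (_ *: _).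
pose u (k : nat) : K := (half_pos R k)%:P * 'X^k.
rewrite (pfsum_scale (u := fun i : 'I_m.*2 => u (nth ord0 (rev (enum S)) i))
  (B := fun i j => (schur_M B (nth ord0 (rev (enum S)) i) (nth ord0 (rev (enum S)) j))%:P)); last first.
  by move=> i j _; rewrite /u /graded_M -mul_polyC !polyCM exprD; ring.
rewrite [RHS]mulrCA [RHS]mulrC; congr (_ * _).
have -> : \prod_(i < m.*2) u (nth ord0 (rev (enum S)) i) =
    \prod_(i < m.*2) u (nth 0%N (strict_of_set S) i).
  by apply: eq_bigr => i _; rewrite nth_parts_of_set (nth_map ord0) ?sz.
rewrite prod_nth_pad; last 2 first.
- by rewrite /u /half_pos /= expr0 mulr1.
- by rewrite size_parts_of_set cS leq_subr.
rewrite /u big_split /= -sumn_parts_of_set -rmorph_prod; congr (_%:P * _); last first.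
  by elim: (parts_of_set S) => [|x l IH]; rewrite ?big_nil // big_cons IH -exprD.
have := strict_nth_gt0 (lam := strict_of_set S) => pos.
rewrite (big_nth 0%N) big_mkord (eq_bigr (fun=> 2^-1)) => [|i _]; last first.
  by rewrite /half_pos gtn_eqF // pos.
by rewrite prodr_const card_ord exprVn.
Qed.

(** The coefficient of 'X^n selects the subsets with sum n in the expansion
    of schur_Z over all even subsets. *)
Lemma schur_Cauchy A B :
  \sum_(lam <- strict_parts) schur_Q lam A * schur_P lam B =
  schur_q n [seq a * b | a <- A, b <- B].
Proof.
rewrite -schur_Z_coef /strict_parts big_map big_enum /=.
have -> : schur_Z n B A = \sum_(m < n.+2) \sum_(S : {set X} | #|S| == m.*2)
    pf (fun x y : X => (schur_M A x y)%:P : K) (enum S) *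
    pf (fun x y : X => graded_M B x y) (enum S).
  by apply: eq_bigr => m _; exact: (pf_pair_op ord0).
rewrite coef_sum.
transitivity (\sum_(m < n.+2) \sum_(S : {set X} | #|S| == m.*2)
   ((\sum_(i in S) i)%N == n)%:R * (schur_Q (strict_of_set S) A * schur_P (strict_of_set S) B)).
  rewrite big_mkcondr big_mkcond /=.
  under [RHS]eq_bigr => m _ do rewrite big_mkcond.
  rewrite exchange_big /=; apply: eq_bigr => S _.
  have [oS|eS] := boolP (odd #|S|).
    rewrite [RHS]big1 // => m _; case: eqP => // cS.
    by move: oS; rewrite cS odd_double.
  have lt : (#|S|./2 < n.+2)%N.
    have h : (#|S| <= n.+1)%N by rewrite -[leqRHS](card_ord n.+1) max_card.
    by move: h; move: #|S| => k hk; have := odd_double_half k; lia.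
  rewrite [RHS](bigD1 (Ordinal lt)) //=.
  rewrite (even_halfK eS) eqxx [X in _ = _ + X]big1 ?addr0 => [|m ne].
    by case: (_ == n); rewrite /= ?mul1r ?mul0r.
  case: eqP => // cS; move: ne; rewrite -val_eqE /= cS doubleK eqxx //.
apply: eq_bigr => m _; rewrite coef_sum; apply: eq_bigr => S /eqP cS.
have eS : ~~ odd #|S| by rewrite cS odd_double.
rewrite (pf_perm_eq_mul _ _ (s' := rev (enum S))); last by rewrite perm_sym perm_rev.
rewrite pf_schur_M // pf_graded_M // mul_polyC !coefZ coefXn.
by rewrite eq_sym [in LHS]mulrC -mulrA mulrA.
Qed.
End Enumeration.
End StrictPartitions.

(** * Summing the weights over pairs of given sizes *)

Section SkewSum.
Variable R : realType.
Implicit Types (A B X Y : seq R) (S : strict_part -> strict_part -> seq R -> R).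

(** A polynomial with infinitely many roots is zero. *)
Lemma poly_sum_inj n (c d : nat -> R) :
  (forall z : R, \sum_(i < n.+1) z ^+ i * c i = \sum_(i < n.+1) z ^+ i * d i) ->
  forall i, (i <= n)%N -> c i = d i.
Proof.
move=> h i ni; pose p : {poly R} := \poly_(j < n.+1) (c j - d j).
have p0 : p = 0.
  apply/eqP; apply: contraT => pn0.
  (* the integers below the size of p would be too many roots *)
  pose rs : seq R := [seq j%:R | j <- iota 0 (size p)].
  have := max_poly_roots pn0 (rs := rs).
  rewrite size_map size_iota ltnn; apply.
    apply/allP => z _; rewrite /root horner_poly; apply/eqP.
    transitivity (\sum_(i < n.+1) z ^+ i * c i - \sum_(i < n.+1) z ^+ i * d i).
      by rewrite -sumrB; apply: eq_bigr => j _; ring.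
    by rewrite h subrr.
  rewrite map_inj_uniq ?iota_uniq // => j k /eqP.
  by rewrite eqr_nat => /eqP.
have := coef_poly n.+1 (fun j => c j - d j) i; rewrite -/p p0 coef0 ltnS ni.
by move/esym/eqP; rewrite subr_eq0 => /eqP.
Qed.

Lemma part_sub_sumn (l m : seq nat) : part_sub l m -> (sumn l <= sumn m)%N.
Proof.
elim: l m => [|x l IH] [|y m] //=; rewrite /part_sub /=.
  case/andP => /=; rewrite leqn0 => /eqP -> /allP h.
  rewrite leqn0 add0n; apply/eqP/eqP; rewrite sumnE big_seq big1 // => z zl.
  have := h (index z l).+1; rewrite mem_iota /= add1n ltnS index_mem zl => /(_ isT).
  by rewrite nth_index // leqn0 => /eqP.
case/andP => /= xy /allP h; apply: leq_add => //; apply: IH.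
apply/allP => i; rewrite mem_iota /= add0n => il.
by have := h i.+1; rewrite mem_iota /= add1n ltnS il => /(_ isT).
Qed.

(** A partition included in lam has size at most |lam|, so the sum over the
    set of all mu has finite support and can be sorted by size. *)
Lemma skew_sum_graded (lam : strict_part) (F : strict_part -> R) n : (sumn lam <= n)%N ->
  \sum_(mu \in [set mu : strict_part | part_sub mu lam]%classic) F mu =
  \sum_(i < n.+1) \sum_(mu <- strict_parts i | part_sub mu lam) F mu.
Proof.
move=> ln; pose r : seq strict_part :=
  [seq mu : strict_part <- flatten [seq strict_parts i | i <- iota 0 n.+1] | part_sub mu lam].
have memr (mu : strict_part) : (mu \in r) = part_sub mu lam.
  rewrite mem_filter andbC; apply/andP/idP => [[]//|h]; split=> //.
  apply/flatten_mapP; exists (sumn mu); last by rewrite mem_strict_parts.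
  by rewrite mem_iota /= add0n ltnS (leq_trans (part_sub_sumn h)).
rewrite (@fsbig_fwiden _ _ _ _ r) /=; first last.
- by move=> mu [] /=; rewrite memr.
- rewrite filter_uniq //; have : uniq (iota 0 n.+1) by exact: iota_uniq.
  elim: (iota _ _) => //= i s IH /andP[nis us]; rewrite cat_uniq strict_parts_uniq IH // andbT.
  apply/hasPn => mu /flatten_mapP[j js]; rewrite !mem_strict_parts => /eqP ->.
  by apply: contraNneq nis => <-.
- by move=> mu /=; rewrite memr.
rewrite big_filter big_flatten big_map.
have -> : iota 0 n.+1 = index_iota 0 n.+1 by rewrite /index_iota subn0.
by rewrite big_mkord.
Qed.

Lemma scale_allpairs z A B :
  [seq a * b | a <- scale_alphabet z A, b <- B] =
  scale_alphabet z [seq a * b | a <- A, b <- B].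
Proof.
elim: A => //= a A IH; rewrite /scale_alphabet map_cat; congr (_ ++ _); last exact: IH.
by rewrite -map_comp; apply: eq_map => b /=; rewrite mulrA.
Qed.

(** Both sides are the coefficients of powers of z in the Cauchy sum for the
    alphabets X + z q X and Y: on the left expand Q_lam of the union by its skew
    functions, on the right use that the generating function is multiplicative
    in the alphabet. *)
Lemma skew_pair_sum S (skewS : is_skew_schur_Q S) (q : R) X Y i n : (i <= n)%N ->
  \sum_(lam <- strict_parts n) \sum_(mu <- strict_parts i | part_sub mu lam)
     schur_Q mu (scale_alphabet q X) * S lam mu X * schur_P lam Y =
  schur_q i [seq a * b | a <- scale_alphabet q X, b <- Y] *
  schur_q (n - i) [seq a * b | a <- X, b <- Y].
Proof.
pose c i := \sum_(lam <- strict_parts n) \sum_(mu <- strict_parts i | part_sub mu lam)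
     schur_Q mu (scale_alphabet q X) * S lam mu X * schur_P lam Y.
pose d i := schur_q i [seq a * b | a <- scale_alphabet q X, b <- Y] *
  schur_q (n - i) [seq a * b | a <- X, b <- Y].
apply: (@poly_sum_inj n c d) => z.
transitivity (schur_q n [seq a * b | a <- X ++ scale_alphabet z (scale_alphabet q X), b <- Y]).
  rewrite -schur_Cauchy; under eq_bigr => j _ do rewrite /c big_distrr.
  rewrite exchange_big big_seq [RHS]big_seq; apply: eq_bigr => lam /=.
  rewrite mem_strict_parts => /eqP ln.
  rewrite skewS (skew_sum_graded _ (eq_leq ln)) big_distrl; apply: eq_bigr => j _ /=.
  rewrite big_distrl big_distrr big_seq_cond [RHS]big_seq_cond; apply: eq_bigr => mu /=.
  rewrite mem_strict_parts => /andP[/eqP mj _].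
  by rewrite (schur_Q_scale mu z) mj; ring.
rewrite allpairs_cat scale_allpairs schur_q_cat (reindex_inj rev_ord_inj) /=.
apply: eq_bigr => j _; have jn : (j <= n)%N by rewrite -ltnS.
by rewrite subSS (schur_q_scale z) subKn // /d; ring.
Qed.
End SkewSum.

Local Open Scope classical_set_scope.
Local Open Scope ring_scope.

(** * Derivative bounds *)

Section MeanValueBounds.
Variable R : realType.

(** The rules of derivation are restated for functions written pointwise,
    which lets explicit expressions be differentiated by nesting them. *)
Lemma is_derive_add (f g : R -> R) (x a b : R) : is_derive x 1 f a ->
  is_derive x 1 g b -> is_derive x 1 (fun t => f t + g t) (a + b).
Proof. by move=> *; apply: (@is_deriveD _ _ _ f g). Qed.

Lemma is_derive_mul (f g : R -> R) (x a b : R) : is_derive x 1 f a ->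
  is_derive x 1 g b -> is_derive x 1 (fun t => f t * g t) (f x * b + g x * a).
Proof. by move=> *; apply: (@is_deriveM _ _ f g). Qed.

Lemma is_derive_opp (f : R -> R) (x a : R) : is_derive x 1 f a ->
  is_derive x 1 (fun t => - f t) (- a).
Proof. by move=> *; apply: (@is_deriveN _ _ _ f). Qed.

Lemma is_derive_const (c x : R) : is_derive x 1 (fun=> c) 0.
Proof. exact: is_derive_cst. Qed.

Lemma is_derive_var (x : R) : is_derive x 1 (fun t => t) 1.
Proof. exact: is_derive_id. Qed.

Lemma is_derive_chain (f g : R -> R) (x a b : R) : is_derive (g x) 1 f a ->
  is_derive x 1 g b -> is_derive x 1 (fun t => f (g t)) (a * b).
Proof. by move=> *; apply: (@is_derive1_comp _ f g). Qed.

Lemma is_derive_continuous (f : R -> R) (x df : R) : is_derive x 1 f df ->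
  {for x, continuous f}.
Proof. by move=> [h _]; apply/differentiable_continuous/derivable1_diffP. Qed.

(** Integrating a bound on the derivative raises the exponent by one; used
    repeatedly, this yields Taylor remainders.  Only points t between 0 and d
    are considered, whatever the sign of d. *)
Lemma mvt_bound (f f' : R -> R) (C : R) (k : nat) (d : R) : 0 <= C ->
  (forall t : R, `|t| <= `|d| -> 0 <= t * d -> is_derive t 1 f (f' t)) ->
  f 0 = 0 -> (forall t : R, `|t| <= `|d| -> 0 <= t * d -> `|f' t| <= C * `|t| ^+ k) ->
  `|f d| <= C * `|d| ^+ k.+1.
Proof.
move=> C0 df f0 bf.
wlog d0 : d f f' df f0 bf / 0 <= d.
  move=> wl; have [d0|/ltW d0] := leP 0 d; first exact: (wl d f f').
  have := wl (- d) (fun t => f (- t)) (fun t => - f' (- t)).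
  rewrite opprK oppr_ge0 normrN oppr0; apply => // t h1 h2.
    have dt : is_derive (- t) 1 f (f' (- t)).
      by apply: df; rewrite ?normrN // mulNr -mulrN.
    rewrite -[- f' _]mulrN1.
    exact: (is_derive_chain dt (is_derive_opp (is_derive_var t))).
  by rewrite normrN -(normrN t); apply: bf; rewrite ?normrN // mulNr -mulrN.
have tP t : t \in `[0, d]%R -> `|t| <= `|d| /\ 0 <= t * d.
  by rewrite in_itv /= => /andP[t0 td]; rewrite !ger0_norm // mulr_ge0.
have [||c cI] := @MVT_segment R f f' 0 d d0.
- by move=> t tI; have [h1 h2] := tP t (subset_itv_oo_cc tI); exact: df.
- apply: continuous_in_subspaceT => t; rewrite inE /= => /tP[h1 h2].
  exact: is_derive_continuous (df t h1 h2).
rewrite f0 !subr0 => ->; have [h1 h2] := tP c cI.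
rewrite normrM exprSr mulrA ler_wpM2r // (le_trans (bf c h1 h2)) // ler_wpM2l //.
by rewrite lerXn2r ?nnegrE.
Qed.
End MeanValueBounds.

(** * The normal distribution function *)

Section Gaussian.
Variable R : realType.

Definition gaussd (x : R) : R := normal_pdf 0 1 x.
Definition Phi (x : R) : R := fine (normal_prob 0 1 `]-oo, x]).

Lemma gaussdE x : gaussd x = normal_peak 1 * expR (- (x ^+ 2 / 2)).
Proof.
rewrite /gaussd normal_pdfE ?oner_eq0 // /normal_fun subr0 expr1n mulNr.
by rewrite -[1 *+ 2]/(2%:R).
Qed.

Lemma gaussd_ge0 x : 0 <= gaussd x. Proof. exact: normal_pdf_ge0. Qed.

Lemma gaussd_le1 x : gaussd x <= 1.
Proof.
apply: (le_trans (normal_pdf_ub _ _ (oner_neq0 _))).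
rewrite /normal_peak invf_le1 ?expr1n ?mul1r ?sqrtr_gt0.
  rewrite -[leLHS]sqrtr1 ler_wsqrtr //; have := pi_ge2 R; lra.
by have := pi_gt0 R; lra.
Qed.

Lemma is_derive_gaussd (x : R) : is_derive x 1 gaussd (- x * gaussd x).
Proof.
have -> : gaussd = fun x => normal_peak 1 * expR (- (x * x * 2^-1)).
  by apply/funext => y; rewrite gaussdE expr2.
have sq := is_derive_mul (is_derive_var x) (is_derive_var x).
have := is_derive_chain (is_derive_expR _)
  (is_derive_opp (is_derive_mul sq (is_derive_const 2^-1 x))).
move=> /(is_derive_mul (is_derive_const (normal_peak 1) x)) h.
by apply: (is_derive_eq h) => /=; field.
Qed.

Lemma is_derive_Phi (x : R) : is_derive x 1 Phi (gaussd x).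
Proof.
have int : lebesgue_measure.-integrable `]-oo, (x + 1)%R] (EFin \o normal_pdf (0 : R) 1).
  apply: (@integrableS _ _ _ lebesgue_measure setT) => //.
  exact: integrable_normal_pdf.
have [d e] := @continuous_FTC1 R (normal_pdf 0 1) -oo%O x (x + 1)
  (ltr_pwDr ltr01 (lexx x)) int (ltNyr x) (@continuous_normal_pdf R 0 1 (oner_neq0 R) x).
apply: DeriveDef; first exact: d.
by rewrite -derive1E e.
Qed.

Lemma Phi_E (x : R) : (Phi x)%:E = normal_prob 0 1 `]-oo, x].
Proof. by rewrite fineK // fin_num_measure. Qed.

Lemma Phi_ge0 (x : R) : 0 <= Phi x.
Proof. by rewrite -lee_fin Phi_E measure_ge0. Qed.

Lemma Phi_le1 (x : R) : Phi x <= 1.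
Proof. by rewrite -lee_fin Phi_E probability_le1. Qed.

Lemma Phi_ndecr (x y : R) : x <= y -> Phi x <= Phi y.
Proof.
move=> xy; rewrite -lee_fin !Phi_E le_measure ?inE //.
exact: subitvPr.
Qed.

Let idR : measurableTypeR R -> R := idfun.

#[local] HB.instance Definition _ :=
  @isMeasurableFun.Build _ _ _ _ idR (@measurable_id _ _ setT).

Lemma Phi_cvgy : Phi x @[x --> +oo] --> (1 : R).
Proof.
have := cvg_cdfy1 (idR : {RV (normal_prob 0 1) >-> R}).
by move=> /fine_cvg.
Qed.

Lemma Phi_cvgNy : Phi x @[x --> -oo] --> (0 : R).
Proof.
have := cvg_cdfNy0 (idR : {RV (normal_prob 0 1) >-> R}).
by move=> /fine_cvg.
Qed.

(** A crude consequence of exp u >= 1 + u with u = x^2 / 2; it only needs to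
    be uniform in x. *)
Lemma gaussd_poly2 (x : R) : x ^+ 2 * gaussd x <= 2.
Proof.
have p0 : 0 <= x ^+ 2 by exact: sqr_ge0.
have h1 := expR_ge1Dx (x ^+ 2 / 2).
have e0 : 0 < expR (- (x ^+ 2 / 2)) by exact: expR_gt0.
have pk : 0 <= normal_peak (1 : R) <= 1.
  rewrite normal_peak_ge0 /=; have := gaussd_le1 0.
  by rewrite gaussdE expr0n /= mul0r oppr0 expR0 mulr1.
have h2 : x ^+ 2 * expR (- (x ^+ 2 / 2)) <= 2.
  rewrite expRN ler_pdivrMr ?expR_gt0 //; lra.
rewrite gaussdE mulrCA; apply: le_trans h2.
by case/andP: pk => _ pk; rewrite ler_piMl // mulr_ge0 // ltW.
Qed.

Lemma gaussd_poly4 (x : R) : x ^+ 4 * gaussd x <= 16.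
Proof.
have p0 : 0 <= x ^+ 2 by exact: sqr_ge0.
have h1 := expR_ge1Dx (x ^+ 2 / 4).
have e0 : 0 < expR (- (x ^+ 2 / 2)) by exact: expR_gt0.
have pk : 0 <= normal_peak (1 : R) <= 1.
  rewrite normal_peak_ge0 /=; have := gaussd_le1 0.
  by rewrite gaussdE expr0n /= mul0r oppr0 expR0 mulr1.
have h2 : x ^+ 4 * expR (- (x ^+ 2 / 2)) <= 16.
  rewrite expRN ler_pdivrMr ?expR_gt0 //.
  have -> : x ^+ 2 / 2 = x ^+ 2 / 4 + x ^+ 2 / 4 by field.
  rewrite expRD (_ : x ^+ 4 = 16 * ((x ^+ 2 / 4) * (x ^+ 2 / 4))); last by field.
  rewrite ler_pM2l //; apply: ler_pM; rewrite ?divr_ge0 //; lra.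
rewrite gaussdE mulrCA; apply: le_trans h2.
by case/andP: pk => _ pk; rewrite ler_piMl // mulr_ge0 ?exprn_even_ge0 // ltW.
Qed.

Lemma gaussd_abs1 (x : R) : `|x| * gaussd x <= 2.
Proof.
have h := gaussd_poly2 x; have h1 := gaussd_le1 x; have h0 := gaussd_ge0 x.
have : `|x| <= (1 + x ^+ 2) / 2.
  by rewrite -real_normK ?num_real //; have := sqr_ge0 (`|x| - 1); nra.
by move=> hx; have := ler_wpM2r h0 hx; lra.
Qed.

Lemma gaussd_abs3 (x : R) : `|x| ^+ 3 * gaussd x <= 9.
Proof.
have h := gaussd_poly2 x; have h1 := gaussd_poly4 x; have h0 := gaussd_ge0 x.
have : `|x| ^+ 3 <= (x ^+ 2 + x ^+ 4) / 2.
  rewrite (_ : x ^+ 4 = (x ^+ 2) ^+ 2); last by rewrite -exprM.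
  rewrite -real_normK ?num_real //; set y := `|x|.
  have -> : (y ^+ 2 + y ^+ 2 ^+ 2) / 2 = y ^+ 3 + y ^+ 2 * (y - 1) ^+ 2 / 2 by field.
  by rewrite lerDl divr_ge0 // mulr_ge0 // sqr_ge0.
by move=> hx; have := ler_wpM2r h0 hx; lra.
Qed.
End Gaussian.

Section Taylor.
Variable R : realType.

(** Third order Taylor estimate, the derivatives of Phi being g and - x g with
    g the density; the constant bounds the third derivative (x^2 - 1) g. *)
Lemma Phi_taylor (y d : R) :
  `|Phi (y + d) - Phi y - d * gaussd y + d ^+ 2 / 2 * (y * gaussd y)| <= 3 * `|d| ^+ 3.
Proof.
have dsh (f : R -> R) (f' t : R) : is_derive (y + t) 1 f f' ->
    is_derive t 1 (fun t => f (y + t)) f'.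
  move=> h; have := is_derive_chain h (is_derive_add (is_derive_const y t) (is_derive_var t)).
  by rewrite add0r mulr1.
have dg (t : R) := dsh _ _ _ (is_derive_gaussd (y + t)).
have dP (t : R) := dsh _ _ _ (is_derive_Phi (y + t)).
have dK (t : R) : is_derive t 1 (fun t => - ((y + t) * gaussd (y + t)) + y * gaussd y)
    (((y + t) ^+ 2 - 1) * gaussd (y + t)).
  have h := is_derive_add (is_derive_opp (is_derive_mul
    (is_derive_add (is_derive_const y t) (is_derive_var t)) (dg t)))
    (is_derive_const (y * gaussd y) t).
  by apply: (is_derive_eq h); ring.
have b2 (t : R) : `|- ((y + t) * gaussd (y + t)) + y * gaussd y| <= 3 * `|t| ^+ 1.
  apply: (mvt_bound (f := fun t => - ((y + t) * gaussd (y + t)) + y * gaussd y)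
    (k := 0) _ (fun u _ _ => dK u)) => // [|u _ _].
    by rewrite addr0 addNr.
  rewrite expr0 mulr1; have h := gaussd_poly2 (y + u).
  have h1 := gaussd_le1 (y + u); have h0 := gaussd_ge0 (y + u).
  have h3 : 0 <= (y + u) ^+ 2 * gaussd (y + u) by rewrite mulr_ge0 // sqr_ge0.
  by rewrite mulrBl mul1r ler_norml; lra.
have d1 (t : R) : is_derive t 1 (fun t => gaussd (y + t) - gaussd y + t * (y * gaussd y))
    (- ((y + t) * gaussd (y + t)) + y * gaussd y).
  have h := is_derive_add (is_derive_add (dg t) (is_derive_const (- gaussd y) t))
    (is_derive_mul (is_derive_var t) (is_derive_const (y * gaussd y) t)).
  by apply: (is_derive_eq h); ring.
have b1 (t : R) : `|gaussd (y + t) - gaussd y + t * (y * gaussd y)| <= 3 * `|t| ^+ 2.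
  apply: (mvt_bound (f := fun t => gaussd (y + t) - gaussd y + t * (y * gaussd y))
    (k := 1) _ (fun u _ _ => d1 u)) => //.
  by rewrite addr0 subrr mul0r addr0.
have d0 (t : R) : is_derive t 1 (fun t => Phi (y + t) - Phi y - t * gaussd y + t * t * (2^-1 * (y * gaussd y)))
    (gaussd (y + t) - gaussd y + t * (y * gaussd y)).
  have h := is_derive_add (is_derive_add (is_derive_add (dP t) (is_derive_const (- Phi y) t))
    (is_derive_opp (is_derive_mul (is_derive_var t) (is_derive_const (gaussd y) t))))
    (is_derive_mul (is_derive_mul (is_derive_var t) (is_derive_var t))
      (is_derive_const (2^-1 * (y * gaussd y)) t)).
  by apply: (is_derive_eq h); field.
have -> : d ^+ 2 / 2 * (y * gaussd y) = d * d * (2^-1 * (y * gaussd y)) by ring.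
apply: (mvt_bound (f := fun t => Phi (y + t) - Phi y - t * gaussd y + t * t * (2^-1 * (y * gaussd y)))
    (k := 2) _ (fun u _ _ => d0 u)) => //.
by rewrite addr0 subrr !mul0r oppr0 !addr0.
Qed.

(** First order Taylor estimate of Phi (x / sqrt (s + t)) in t.  The first
    derivative at t = 0 is half the second derivative in x, so that it will
    cancel the second order term of Phi_taylor: this is the heat equation. *)
Lemma Phi_time (s tau x y : R) : 0 < s -> 0 <= tau -> y = x / Num.sqrt s ->
  `|Phi (x / Num.sqrt (s + tau)) - Phi y + tau / (2 * s) * (y * gaussd y)|
    <= 4 / s ^+ 2 * tau ^+ 2.
Proof.
move=> s0 tau0 yE.
have pos (t : R) : `|t| <= `|tau| -> 0 <= t * tau -> 0 <= t.
  move=> h1 h2; move: tau0; rewrite le_eqVlt => /predU1P[e|tp].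
    by move: h1; rewrite -e normr0 normr_le0 => /eqP ->.
  by rewrite -(pmulr_lge0 _ tp).
pose u (t : R) := Num.sqrt (s + t); pose v (t : R) := x / u t.
have up (t : R) : 0 <= t -> 0 < u t by move=> t0; rewrite sqrtr_gt0; lra.
have u2 (t : R) : 0 <= t -> u t ^+ 2 = s + t by move=> t0; rewrite sqr_sqrtr //; lra.
have du (t : R) : 0 <= t -> is_derive t 1 u (2 * u t)^-1.
  move=> t0; have st : 0 < s + t by lra.
  have h := is_derive_chain (is_derive1_sqrt st)
    (is_derive_add (is_derive_const s t) (is_derive_var t)).
  by apply: (is_derive_eq h); rewrite add0r mulr1.
have dv (t : R) : 0 <= t -> is_derive t 1 v (- v t / (2 * (s + t))).
  move=> t0; have ut := up t t0.
  have h := is_derive_mul (is_derive_const x t) (is_deriveV (lt0r_neq0 ut) (du t t0)).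
  apply: (is_derive_eq h); rewrite -(u2 t t0) /v.
  rewrite mulr0 addr0 -[_ *: _]/(_ * _); field; exact: lt0r_neq0.
have dP (t : R) : 0 <= t -> is_derive t 1 (fun t => Phi (v t) - Phi y + t * ((2 * s)^-1 * (y * gaussd y)))
    (- ((2 * (s + t))^-1 * (v t * gaussd (v t))) + (2 * s)^-1 * (y * gaussd y)).
  move=> t0; have st : 0 < s + t by lra.
  have h := is_derive_add (is_derive_add (is_derive_chain (is_derive_Phi (v t)) (dv t t0))
     (is_derive_const (- Phi y) t))
    (is_derive_mul (is_derive_var t) (is_derive_const ((2 * s)^-1 * (y * gaussd y)) t)).
  by apply: (is_derive_eq h); field; rewrite !lt0r_neq0.
have dK (t : R) : 0 <= t -> is_derive t 1 (fun t => - ((2 * (s + t))^-1 * (v t * gaussd (v t))) + (2 * s)^-1 * (y * gaussd y))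
   ((s + t) ^- 2 * (2^-1 * (v t * gaussd (v t)) + 4^-1 * (v t * gaussd (v t) - v t ^+ 3 * gaussd (v t)))).
  move=> t0; have st : 0 < s + t by lra.
  have st2 : 2 * (s + t) != 0 by rewrite lt0r_neq0 // mulr_gt0.
  have dst := is_derive_mul (is_derive_const 2 t) (is_derive_add (is_derive_const s t) (is_derive_var t)).
  have h := is_derive_add (is_derive_opp (is_derive_mul (@is_deriveV _ (fun t : R => 2 * (s + t)) t _ _ st2 dst)
    (is_derive_mul (dv t t0) (is_derive_chain (is_derive_gaussd (v t)) (dv t t0)))))
    (is_derive_const ((2 * s)^-1 * (y * gaussd y)) t).
  apply: (is_derive_eq h); rewrite -[_ *: _]/(_ * _); field.
  by rewrite lt0r_neq0.
have b1 (t : R) : 0 <= t -> `|- ((2 * (s + t))^-1 * (v t * gaussd (v t))) + (2 * s)^-1 * (y * gaussd y)|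
    <= 4 / s ^+ 2 * `|t| ^+ 1.
  move=> t0; have sub (w : R) : `|w| <= `|t| -> 0 <= w * t -> 0 <= w.
    move=> h1 h2; move: t0; rewrite le_eqVlt => /predU1P[e|tp].
      by move: h1; rewrite -e normr0 normr_le0 => /eqP ->.
    by rewrite -(pmulr_lge0 _ tp).
  apply: (mvt_bound (f := fun t => - ((2 * (s + t))^-1 * (v t * gaussd (v t))) + (2 * s)^-1 * (y * gaussd y))
    (k := 0) _ (fun w h1 h2 => dK w (sub w h1 h2))) => // [||w h1 h2].
  - by rewrite divr_ge0 // sqr_ge0.
  - by rewrite /v /u addr0 -yE addNr.
  have w0 := sub w h1 h2; rewrite expr0 mulr1 normrM.
  have sw : 0 < s + w by lra.
  have -> : `|(s + w) ^- 2| = (s + w) ^- 2.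
    by rewrite ger0_norm // invr_ge0 exprn_ge0 // ltW.
  rewrite [leLHS]mulrC; apply: ler_pM => //.
  + by rewrite invr_ge0 exprn_ge0 // ltW.
  + have a1 := gaussd_abs1 (v w); have a3 := gaussd_abs3 (v w).
    have g0 := gaussd_ge0 (v w).
    have n1 : `|v w * gaussd (v w)| <= 2 by rewrite normrM (ger0_norm g0).
    have n3 : `|v w ^+ 3 * gaussd (v w)| <= 9 by rewrite normrM (ger0_norm g0) normrX.
    move: n1 n3; rewrite !ler_norml => /andP[p1 p2] /andP[p3 p4]; lra.
  + rewrite lef_pV2 ?posrE ?exprn_gt0 //.
    by apply: lerXn2r; rewrite ?nnegrE; lra.
have -> : tau / (2 * s) * (y * gaussd y) = tau * ((2 * s)^-1 * (y * gaussd y)) by ring.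
have := @mvt_bound R (fun t => Phi (v t) - Phi y + t * ((2 * s)^-1 * (y * gaussd y)))
  (fun t => - ((2 * (s + t))^-1 * (v t * gaussd (v t))) + (2 * s)^-1 * (y * gaussd y))
  (4 / s ^+ 2) 1 tau.
rewrite (ger0_norm tau0); apply.
- by rewrite divr_ge0 // sqr_ge0.
- by move=> t h1 h2; apply: dP; apply: pos => //; rewrite (ger0_norm tau0).
- by rewrite /v /u addr0 -yE subrr mul0r addr0.
- by move=> t h1 h2; apply: b1; apply: pos => //; rewrite (ger0_norm tau0).
Qed.
End Taylor.

(** * The law of one step *)

Section StepExpectation.
Variables (R : realType) (a : R).
Hypothesis a01 : 0 < a < 1.

(** Cubic growth is what the third absolute moment of a step requires. *)
Definition cubic (G : nat -> R) := exists C, forall j, `|G j| <= C * (j.+1%:R) ^+ 3.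

Lemma cubic_bounded G C : (forall j, `|G j| <= C) -> cubic G.
Proof.
move=> h; exists C => j; apply: (le_trans (h j)).
have C0 : 0 <= C by apply: le_trans (h 0%N).
by rewrite ler_peMr // exprn_ege1 // ler1n.
Qed.

Lemma cubicD G H : cubic G -> cubic H -> cubic (fun j => G j + H j).
Proof.
move=> [C hC] [D hD]; exists (C + D) => j.
by rewrite (le_trans (ler_normD _ _)) // mulrDl lerD.
Qed.

Lemma cubicZ c G : cubic G -> cubic (fun j => c * G j).
Proof.
move=> [C hC]; exists (`|c| * C) => j.
by rewrite normrM -mulrA ler_wpM2l.
Qed.

Lemma cubic_shift G : cubic G -> cubic (fun j => G j.+1).
Proof.
move=> [C hC]; exists (C * 8) => j; apply: (le_trans (hC _)).
have C0 : 0 <= C by have := hC 0%N; rewrite expr1n mulr1; apply: le_trans.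
rewrite -mulrA ler_wpM2l // (_ : 8 = 2 ^+ 3); last by rewrite -natrX.
by rewrite -exprMn; apply: lerXn2r; rewrite ?nnegrE -?natrM ?ler_nat ?ler0n //; lia.
Qed.

Lemma cubic_pow k c : (k <= 3)%N -> cubic (fun j => `|j%:R - c| ^+ k).
Proof.
move=> k3; exists ((1 + `|c|) ^+ k) => j; rewrite ger0_norm ?exprn_ge0 //.
apply: (@le_trans _ _ ((1 + `|c|) ^+ k * j.+1%:R ^+ k)); last first.
  rewrite ler_wpM2l ?exprn_ge0 ?addr_ge0 // -!natrX ler_nat.
  by apply: leq_pexp2l.
rewrite -exprMn; apply: lerXn2r; rewrite ?nnegrE ?mulr_ge0 ?addr_ge0 //.
apply: (le_trans (ler_normB _ _)); rewrite mulrDl mul1r ger0_norm ?ler0n //.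
apply: lerD; first by rewrite ler_nat.
by rewrite ler_peMr // ler1n.
Qed.

(** The geometric series in a weighted by G. *)
Definition geom_sum (G : nat -> R) : R := limn (series (fun j => a ^+ j * G j)).

(** By Bernoulli's inequality a cubic factor is dominated by (1 + t)^(3 j),
    and t can be chosen so small that (1 + t)^3 a < 1. *)
Lemma geom_sum_cvg G : cubic G -> cvgn (series (fun j => a ^+ j * G j)).
Proof.
case/andP: a01 => a0 a1 [C hC]; apply: normed_cvg.
(* (1 + t)^3 <= 1 + 7 t for t <= 1, and (1 + 7 t) a < 1 for this t *)
pose t := (1 - a) / 8; have t0 : 0 < t by rewrite divr_gt0 ?subr_gt0.
have t0' := ltW t0.
have tE : 8 * t = 1 - a by rewrite /t; field.
clearbody t.
have t1 : t <= 1 by lra.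
pose r := (1 + t) ^+ 3 * a.
have r0 : 0 < r by rewrite mulr_gt0 // exprn_gt0 //; lra.
have r1 : r < 1.
  have : (1 + t) ^+ 3 <= 1 + 7 * t.
    have -> : (1 + t) ^+ 3 = 1 + 3 * t + 3 * t ^+ 2 + t ^+ 3 by ring.
    have h2 : t ^+ 2 <= t by rewrite expr2 ler_piMl.
    have h3 : t ^+ 3 <= t by rewrite exprS ler_piMr // (le_trans h2).
    by lra.
  move=> h; apply: (@le_lt_trans _ _ ((1 + 7 * t) * a)).
    by rewrite ler_pM2r.
  have -> : (1 + 7 * t) * a = a + 7 * (t * a) by ring.
  have : t * a < t by rewrite gtr_pMr.
  lra.
have bern j : t * j.+1%:R <= (1 + t) ^+ j.
  elim: j => [|j IH]; first by rewrite mulr1 expr0.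
  rewrite exprSr -(natr1 j.+1) !mulrDr !mulr1; apply: lerD => //.
  have : t <= (1 + t) ^+ j * t.
    by rewrite ler_peMl // exprn_ege1 // lerDl.
  by apply: le_trans.
apply: (@series_le_cvg _ _ (geometric (C / t ^+ 3) r)) => [j|j|j|].
- exact: normr_ge0.
- rewrite /geometric /= mulr_ge0 ?exprn_ge0 ?(ltW r0) // divr_ge0 ?exprn_ge0 ?(ltW t0) //.
  by have := hC 0%N; rewrite expr1n mulr1; apply: le_trans.
- have -> : geometric (C / t ^+ 3) r j = a ^+ j * (C / t ^+ 3 * (1 + t) ^+ 3 ^+ j).
    by rewrite /geometric /= /r exprMn [LHS]mulrA [RHS]mulrC.
  rewrite /= normrM normrX (gtr0_norm a0) ler_wpM2l ?exprn_ge0 ?(ltW a0) //.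
  apply: (le_trans (hC j)); rewrite -mulrA.
  have C0 : 0 <= C by have := hC 0%N; rewrite expr1n mulr1; apply: le_trans.
  rewrite ler_wpM2l // mulrC ler_pdivlMr ?exprn_gt0 // -exprMn exprAC.
  apply: lerXn2r; rewrite ?nnegrE ?mulr_ge0 ?exprn_ge0 //; last by rewrite mulrC.
  by lra.
- by apply: is_cvg_geometric_series; rewrite gtr0_norm.
Qed.

Lemma geom_sumD G H : cubic G -> cubic H ->
  geom_sum (fun j => G j + H j) = geom_sum G + geom_sum H.
Proof.
move=> cG cH; rewrite /geom_sum -(lim_seriesD (geom_sum_cvg cG) (geom_sum_cvg cH)).
by congr (limn (series _)); apply/funext => j; rewrite mulrDr.
Qed.

Lemma geom_sumZ c G : cubic G -> geom_sum (fun j => c * G j) = c * geom_sum G.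
Proof.
move=> cG; rewrite /geom_sum -[RHS]/(c *: _) -(lim_seriesZ c (geom_sum_cvg cG)).
by congr (limn (series _)); apply/funext => j; rewrite mulrCA.
Qed.

Lemma geom_sum_le G H : cubic G -> cubic H -> (forall j, G j <= H j) -> geom_sum G <= geom_sum H.
Proof.
move=> cG cH GH; apply: lim_series_le; [exact: geom_sum_cvg|exact: geom_sum_cvg|] => j.
by rewrite ler_wpM2l // exprn_ge0 //; case/andP: a01 => /ltW.
Qed.

(** Splitting off the first term gives a linear equation for the series,
    from which all moments are computed. *)
Lemma geom_sum_rec G : cubic G -> geom_sum G = G 0%N + a * geom_sum (fun j => G j.+1).
Proof.
move=> cG; have cS := cubic_shift cG.
apply/cvg_lim => //; rewrite -cvg_shiftS.
have -> : (fun n => series (fun j => a ^+ j * G j) n.+1) =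
    (fun n => G 0%N + a * series (fun j => a ^+ j * G j.+1) n).
  apply/funext => n; rewrite /series /= big_nat_recl // expr0 mul1r; congr (_ + _).
  by rewrite big_distrr; apply: eq_bigr => j _ /=; rewrite exprS mulrA.
apply: cvgD; first exact: cvg_cst.
by apply: cvgMr; exact: geom_sum_cvg.
Qed.

(** The value of (1 + a z) / (1 - a z) at z = 1. *)
Definition step_mass : R := (1 + a) / (1 - a).
(** The expectation for the law with masses proportional to the coefficients
    of (1 + a z) / (1 - a z), that is 1, 2 a, 2 a^2, ... *)
Definition step_exp (G : nat -> R) : R :=
  (G 0%N + 2 * (a * geom_sum (fun j => G j.+1))) / step_mass.

Lemma step_mass_gt0 : 0 < step_mass.
Proof. by case/andP: a01 => a0 a1; rewrite divr_gt0 //; lra. Qed.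

Lemma step_expD G H : cubic G -> cubic H -> step_exp (fun j => G j + H j) = step_exp G + step_exp H.
Proof. by move=> cG cH; rewrite /step_exp geom_sumD ?cubic_shift //; [ring|exact: cubic_shift..]. Qed.

Lemma step_expZ c G : cubic G -> step_exp (fun j => c * G j) = c * step_exp G.
Proof. by move=> cG; rewrite /step_exp geom_sumZ; [ring|exact: cubic_shift]. Qed.

Lemma step_exp_le G H : cubic G -> cubic H -> (forall j, G j <= H j) -> step_exp G <= step_exp H.
Proof.
move=> cG cH GH; case/andP: (a01) => a0 a1.
rewrite /step_exp ler_pM2r ?invr_gt0 ?step_mass_gt0 //; apply: lerD => //.
rewrite ler_pM2l // ler_pM2l //.
by apply: geom_sum_le => //; apply: cubic_shift.
Qed.

Lemma cubic_cst c : cubic (fun=> c).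
Proof. exact: (@cubic_bounded _ `|c|). Qed.

Lemma cubic_nat : cubic (fun j => j%:R).
Proof.
have [C hC] := @cubic_pow 1 0 isT; exists C => j; apply: le_trans (hC j).
by rewrite subr0 expr1 normr_id.
Qed.

Lemma cubic_nat2 : cubic (fun j => j%:R ^+ 2).
Proof.
have [C hC] := @cubic_pow 2 0 isT; exists C => j; apply: le_trans (hC j).
by rewrite subr0 -normrX normr_id.
Qed.

Lemma geom_sum_cst : geom_sum (fun=> 1) = (1 - a)^-1.
Proof.
case/andP: a01 => a0 a1; have n0 : 1 - a != 0 by rewrite subr_eq0 gt_eqF.
have := geom_sum_rec (cubic_cst 1); set g := geom_sum _ => e.
by apply: (mulfI n0); rewrite divff // mulrBl mul1r {1}e addrK.
Qed.

Lemma geom_sum_nat : geom_sum (fun j => j%:R) = a / (1 - a) ^+ 2.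
Proof.
case/andP: a01 => a0 a1; have n0 : 1 - a != 0 by rewrite subr_eq0 gt_eqF.
have := geom_sum_rec cubic_nat.
have -> : (fun j : nat => j.+1%:R : R) = (fun j => j%:R + 1).
  by apply/funext => j; rewrite natr1.
rewrite (geom_sumD cubic_nat (cubic_cst 1)) geom_sum_cst add0r; set g := geom_sum _ => e.
apply: (mulfI n0); rewrite mulrBl mul1r {1}e.
by field.
Qed.

Lemma geom_sum_nat2 : geom_sum (fun j => j%:R ^+ 2) = a * (1 + a) / (1 - a) ^+ 3.
Proof.
case/andP: a01 => a0 a1; have n0 : 1 - a != 0 by rewrite subr_eq0 gt_eqF.
have := geom_sum_rec cubic_nat2.
have -> : (fun j : nat => j.+1%:R ^+ 2 : R) = (fun j => j%:R ^+ 2 + (2 * j%:R + 1)).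
  by apply/funext => j; rewrite -natr1; ring.
have c2 := cubicZ 2 cubic_nat.
rewrite (geom_sumD cubic_nat2 (cubicD c2 (cubic_cst 1))) (geom_sumD c2 (cubic_cst 1)).
rewrite (geom_sumZ 2 cubic_nat) geom_sum_cst geom_sum_nat expr0n add0r; set g := geom_sum _ => e.
apply: (mulfI n0); rewrite mulrBl mul1r {1}e.
by field.
Qed.

Lemma step_exp_cst c : step_exp (fun=> c) = c.
Proof.
case/andP: a01 => a0 a1; have n0 : 1 - a != 0 by rewrite subr_eq0 gt_eqF.
have n1 : 1 + a != 0 by rewrite lt0r_neq0 //; lra.
have -> : (fun=> c) = (fun j : nat => c * 1) by apply/funext => j; rewrite mulr1.
rewrite (step_expZ c (cubic_cst 1)) /step_exp geom_sum_cst /step_mass.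
by field; rewrite n0 n1.
Qed.

Definition step_mean : R := 2 * a / (1 - a ^+ 2).
Definition step_var : R := 2 * a * (1 + a ^+ 2) / (1 - a ^+ 2) ^+ 2.

Lemma step_exp_nat : step_exp (fun j => j%:R) = step_mean.
Proof.
case/andP: a01 => a0 a1; have n0 : 1 - a != 0 by rewrite subr_eq0 gt_eqF.
have n1 : 1 + a != 0 by rewrite lt0r_neq0 //; lra.
rewrite /step_exp /step_mean /step_mass.
have -> : (fun j : nat => j.+1%:R : R) = (fun j => j%:R + 1).
  by apply/funext => j; rewrite natr1.
rewrite (geom_sumD cubic_nat (cubic_cst 1)) geom_sum_cst geom_sum_nat.
have -> : 1 - a ^+ 2 = (1 - a) * (1 + a) by ring.
by field; rewrite n0 n1.
Qed.

Lemma step_exp_nat2 : step_exp (fun j => j%:R ^+ 2) = 2 * a / (1 - a) ^+ 2.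
Proof.
case/andP: a01 => a0 a1; have n0 : 1 - a != 0 by rewrite subr_eq0 gt_eqF.
have n1 : 1 + a != 0 by rewrite lt0r_neq0 //; lra.
rewrite /step_exp /step_mass.
have -> : (fun j : nat => j.+1%:R ^+ 2 : R) = (fun j => j%:R ^+ 2 + (2 * j%:R + 1)).
  by apply/funext => j; rewrite -natr1; ring.
have c2 := cubicZ 2 cubic_nat.
rewrite (geom_sumD cubic_nat2 (cubicD c2 (cubic_cst 1))) (geom_sumD c2 (cubic_cst 1)).
rewrite (geom_sumZ 2 cubic_nat) geom_sum_cst geom_sum_nat geom_sum_nat2 expr0n /=.
by field; rewrite n0 n1.
Qed.

(** This says that the mean and the variance of a step are step_mean and
    step_var, in the form in which the Taylor polynomial is integrated. *)
Lemma step_exp_quadratic c0 c1 c2 :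
  step_exp (fun j => c0 + c1 * (j%:R - step_mean) + c2 * (j%:R - step_mean) ^+ 2)
  = c0 + c2 * step_var.
Proof.
case/andP: a01 => a0 a1; have n0 : 1 - a != 0 by rewrite subr_eq0 gt_eqF.
have n1 : 1 + a != 0 by rewrite lt0r_neq0 //; lra.
set m := step_mean.
have -> : (fun j : nat => c0 + c1 * (j%:R - m) + c2 * (j%:R - m) ^+ 2) =
  (fun j => (c0 - c1 * m + c2 * m ^+ 2) + ((c1 - 2 * c2 * m) * j%:R + c2 * j%:R ^+ 2)).
  by apply/funext => j; ring.
have e1 := cubicZ (c1 - 2 * c2 * m) cubic_nat; have e2 := cubicZ c2 cubic_nat2.
rewrite (step_expD (cubic_cst _) (cubicD e1 e2)) (step_expD e1 e2) step_exp_cst.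
rewrite (step_expZ _ cubic_nat) (step_expZ _ cubic_nat2) step_exp_nat step_exp_nat2 -/m.
rewrite /m /step_mean /step_var.
have -> : 1 - a ^+ 2 = (1 - a) * (1 + a) by ring.
by field; rewrite n0 n1.
Qed.

Lemma step_exp_norm_le G H : cubic G -> cubic H -> (forall j, `|G j| <= H j) -> `|step_exp G| <= step_exp H.
Proof.
move=> cG cH GH; rewrite ler_norml; apply/andP; split; last first.
  by apply: step_exp_le => // j; apply: le_trans (GH j); exact: ler_norm.
rewrite -mulN1r -(step_expZ _ cH); apply: step_exp_le => //; first exact: cubicZ.
by move=> j; rewrite mulN1r lerNl; apply: le_trans (GH j); rewrite ler_normr lexx orbT.
Qed.
End StepExpectation.

(** * Sums of independent steps *)

Section CentralLimit.
Variables (R : realType) (a : R).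
Hypothesis a01 : 0 < a < 1.

(** The expectation of G at the sum of l independent steps. *)
Fixpoint walk_exp (l : nat) (G : nat -> R) : R :=
  if l is l'.+1 then walk_exp l' (fun i => step_exp a (fun j => G (i + j)%N)) else G 0%N.

Definition bounded_seq (G : nat -> R) := exists C, forall i, `|G i| <= C.

Lemma bounded_seq_shift G i : bounded_seq G -> cubic (fun j => G (i + j)%N).
Proof. by move=> [C h]; apply: (@cubic_bounded _ _ C). Qed.

Lemma bounded_step_exp G : bounded_seq G -> bounded_seq (fun i => step_exp a (fun j => G (i + j)%N)).
Proof.
move=> bG; have [C h] := bG; exists C => i; rewrite -[leRHS](step_exp_cst a01).
by apply: step_exp_norm_le => //; [exact: bounded_seq_shift|exact: cubic_cst].
Qed.

Lemma walk_exp_le l G H : bounded_seq G -> bounded_seq H -> (forall i, G i <= H i) ->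
  walk_exp l G <= walk_exp l H.
Proof.
elim: l G H => [|l IH] G H bG bH GH //=; apply: IH; try exact: bounded_step_exp.
by move=> i; apply: step_exp_le => //; exact: bounded_seq_shift.
Qed.

Lemma walk_expD l G H : bounded_seq G -> bounded_seq H ->
  walk_exp l (fun i => G i + H i) = walk_exp l G + walk_exp l H.
Proof.
elim: l G H => [|l IH] G H bG bH //=; rewrite -IH; try exact: bounded_step_exp.
congr (walk_exp l _); apply/funext => i.
by rewrite step_expD //; exact: bounded_seq_shift.
Qed.

Lemma walk_expZ l c G : bounded_seq G -> walk_exp l (fun i => c * G i) = c * walk_exp l G.
Proof.
elim: l G => [|l IH] G bG //=; rewrite -IH; last exact: bounded_step_exp.
congr (walk_exp l _); apply/funext => i.
by rewrite step_expZ //; exact: bounded_seq_shift.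
Qed.

Lemma walk_exp_cst l c : walk_exp l (fun=> c) = c.
Proof.
elim: l => //= l IH; rewrite -[RHS]IH; congr (walk_exp l _).
by apply/funext => i; rewrite step_exp_cst.
Qed.

Lemma bounded_seq_cst c : bounded_seq (fun=> c).
Proof. by exists `|c|. Qed.

Lemma boundedD G H : bounded_seq G -> bounded_seq H -> bounded_seq (fun i => G i + H i).
Proof.
move=> [C h] [D k]; exists (C + D) => i.
by rewrite (le_trans (ler_normD _ _)) // lerD.
Qed.

Lemma boundedZ c G : bounded_seq G -> bounded_seq (fun i => c * G i).
Proof. by move=> [C h]; exists (`|c| * C) => i; rewrite normrM ler_wpM2l. Qed.

Lemma bounded_bool (P : nat -> bool) : bounded_seq (fun i => (P i)%:R).
Proof. by exists 1 => i; case: (P i); rewrite ?normr1 ?normr0. Qed.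

Lemma bounded_Phi (f : nat -> R) : bounded_seq (fun i => Phi (f i)).
Proof. by exists 1 => i; rewrite ger0_norm ?Phi_ge0 ?Phi_le1. Qed.

(** Expectations are monotone and preserve constants, hence do not increase
    the uniform distance. *)
Lemma walk_exp_dist l G H d : bounded_seq G -> bounded_seq H ->
  (forall i, `|G i - H i| <= d) -> `|walk_exp l G - walk_exp l H| <= d.
Proof.
move=> bG bH GH.
have up (G' H' : nat -> R) : bounded_seq G' -> bounded_seq H' ->
    (forall i, `|G' i - H' i| <= d) -> walk_exp l G' <= walk_exp l H' + d.
  move=> bG' bH' h; rewrite -[d in leRHS](walk_exp_cst l) -walk_expD //; last exact: bounded_seq_cst.
  apply: walk_exp_le => //; first by apply: boundedD => //; exact: bounded_seq_cst.
  by move=> i; have := h i; rewrite ler_norml => /andP[_]; lra.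
rewrite ler_norml; have h1 := up G H bG bH GH.
have h2 : walk_exp l H <= walk_exp l G + d by apply: up => // i; rewrite distrC.
by lra.
Qed.

Lemma step_exp_delta k : step_exp a (fun j => (j == k)%:R) = fcoef a k / step_mass a.
Proof.
have cd k' : cubic (fun j => (j == k')%:R : R).
  by apply: (@cubic_bounded _ _ 1) => j; case: (j == k'); rewrite ?normr1 ?normr0.
have c0 : cubic (fun=> 0 : R) by exact: cubic_cst.
have g0 : geom_sum a (fun=> 0) = 0.
  have := geom_sumZ a01 0 (cubic_cst (1 : R)).
  have -> : (fun j : nat => 0 * 1) = (fun=> 0 : R) by apply/funext => j; rewrite mul0r.
  by rewrite mul0r.
have gd k' : geom_sum a (fun j => (j == k')%:R) = a ^+ k'.
  elim: k' => [|k' IH]; rewrite (geom_sum_rec a01 (cd _)).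
    by rewrite /= g0 mulr0 addr0.
  by rewrite /= -[X in geom_sum a X]/(fun j => (j == k')%:R) IH add0r -exprS.
rewrite /step_exp /fcoef; case: k => [|k] /=; first by rewrite g0 !mulr0 addr0.
by rewrite -[X in geom_sum a X]/(fun j => (j == k)%:R) gd add0r -exprS.
Qed.

Lemma bounded_sum (I : Type) (r : seq I) (F : I -> nat -> R) :
  (forall k, bounded_seq (F k)) -> bounded_seq (fun i => \sum_(k <- r) F k i).
Proof.
move=> h; elim: r => [|k r IH].
  by exists 0 => i; rewrite big_nil normr0.
have := boundedD (h k) IH; case=> C hC; exists C => i.
by rewrite big_cons.
Qed.

Lemma walk_exp_sum (I : Type) (r : seq I) (F : I -> nat -> R) l :
  (forall k, bounded_seq (F k)) ->
  walk_exp l (fun i => \sum_(k <- r) F k i) = \sum_(k <- r) walk_exp l (F k).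
Proof.
move=> h; elim: r => [|k r IH].
  rewrite big_nil -[RHS](walk_exp_cst l); congr (walk_exp l _); apply/funext => i.
  by rewrite big_nil.
rewrite big_cons -IH -walk_expD //; last exact: bounded_sum.
by congr (walk_exp l _); apply/funext => i; rewrite big_cons.
Qed.

(** The masses of the sum of l steps are the coefficients of the l-th power
    of the generating function of one step. *)
Lemma walk_exp_delta l n : walk_exp l (fun i => (i == n)%:R) = schur_q n (nseq l a) / step_mass a ^+ l.
Proof.
elim: l n => [|l IH] n; first by rewrite /= schur_q_nil expr0 divr1 eq_sym.
rewrite [walk_exp _ _]/= schur_q_cons big_distrl /=.
have -> : (fun i => step_exp a (fun j => ((i + j)%N == n)%:R)) =
    (fun i => \sum_(k < n.+1) (fcoef a k / step_mass a) * (i == n - k)%N%:R).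
  apply/funext => i; case: (leqP i n) => ilen.
    have -> : (fun j => ((i + j)%N == n)%:R : R) = (fun j => (j == n - i)%N%:R).
      by apply/funext => j; congr (_%:R); lia.
    rewrite step_exp_delta.
    have hi : (n - i < n.+1)%N by lia.
    rewrite (bigD1 (Ordinal hi)) //= subKn // eqxx mulr1 big1 ?addr0 // => k.
    rewrite -val_eqE /= => ne; case: eqP => [e|]; rewrite ?mulr0 //.
    by move: ne; rewrite e subKn ?eqxx // -ltnS.
  have -> : (fun j => ((i + j)%N == n)%:R : R) = (fun=> 0).
    by apply/funext => j; case: eqP => //; lia.
  rewrite step_exp_cst // big1 // => k _; case: eqP => [e|]; rewrite ?mulr0 //.
  by move: ilen; rewrite e ltnNge leq_subr.
rewrite walk_exp_sum => [|k]; last by apply: boundedZ; exact: bounded_bool.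
apply: eq_bigr => k _; rewrite walk_expZ ?IH; last exact: bounded_bool.
have := step_mass_gt0 a01; move: (step_mass a) => w w0.
by rewrite exprS; field; rewrite !expf_neq0 ?lt0r_neq0.
Qed.

Let m := step_mean a.
Let v := step_var a.

Lemma step_var_gt0 : 0 < v.
Proof.
case/andP: a01 => a0 a1; rewrite /v /step_var divr_gt0 ?exprn_gt0 //.
  by rewrite mulr_gt0 ?mulr_gt0 // ltr_pwDl // sqr_ge0.
by rewrite subr_gt0 expr_lt1 // ltW.
Qed.

(** The density is bounded by 1. *)
Lemma Phi_lip (u w : R) : `|Phi u - Phi w| <= `|u - w|.
Proof.
have := @mvt_bound R (fun t => Phi (w + t) - Phi w) (fun t => gaussd (w + t)) 1 0 (u - w) ler01.
rewrite /= expr1 mul1r; have -> : w + (u - w) = u by ring.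
apply.
- move=> t _ _; have h := is_derive_add (is_derive_chain (is_derive_Phi (w + t))
    (is_derive_add (is_derive_const w t) (is_derive_var t))) (is_derive_const (- Phi w) t).
  by apply: (is_derive_eq h); ring.
- by rewrite addr0 subrr.
- move=> t _ _; rewrite expr0 mulr1 ger0_norm ?gaussd_ge0 //.
  exact: gaussd_le1.
Qed.

Let M3 := step_exp a (fun j => `|j%:R - m| ^+ 3).

Lemma M3_ge0 : 0 <= M3.
Proof.
rewrite -[leLHS](step_exp_cst a01); apply: step_exp_le => //; first exact: cubic_cst.
  exact: cubic_pow.
Qed.

(** One Lindeberg replacement: a step of size h replaced by a normal variable
    of the same variance, which increases s by h^2 v.  Up to second order the two
    expectations agree, by Phi_taylor and Phi_time; the errors are of third order
    from the step and of fourth order from the normal variable. *)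
Lemma step_bound (s h x : R) : 0 < s -> 0 <= h ->
  `|step_exp a (fun j => Phi ((x - h * (j%:R - m)) / Num.sqrt s)) -
    Phi (x / Num.sqrt (s + h ^+ 2 * v))| <=
  3 * (h / Num.sqrt s) ^+ 3 * M3 + 4 / s ^+ 2 * (h ^+ 2 * v) ^+ 2.
Proof.
move=> s0 h0; set r := Num.sqrt s; have r0 : 0 < r by rewrite sqrtr_gt0.
have r2 : r ^+ 2 = s by rewrite sqr_sqrtr // ltW.
set y := x / r; pose c := h / r.
have c0 : 0 <= c by rewrite divr_ge0 // ltW.
have tE := @Phi_time R s (h ^+ 2 * v) x y s0 (mulr_ge0 (sqr_ge0 _) (ltW step_var_gt0)) erefl.
(* the Taylor polynomial of the integrand at the mean of the step *)
pose Bq := fun j : nat => Phi y + (- c * gaussd y) * (j%:R - m) +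
  (- (c ^+ 2 / 2 * (y * gaussd y))) * (j%:R - m) ^+ 2.
have EB : step_exp a Bq = Phi y + (- (c ^+ 2 / 2 * (y * gaussd y))) * v by exact: step_exp_quadratic.
have cB : cubic Bq.
  have q1 : cubic (fun j => j%:R - m).
    have [C hC] := @cubic_pow _ 1 m isT; exists C => j; apply: le_trans (hC j).
    by rewrite expr1 normr_id.
  have q2 : cubic (fun j => (j%:R - m) ^+ 2).
    have [C hC] := @cubic_pow _ 2 m isT; exists C => j; apply: le_trans (hC j).
    by rewrite -normrX normr_id.
  exact: (cubicD (cubicD (cubic_cst _) (cubicZ _ q1)) (cubicZ _ q2)).
have cA : cubic (fun j => Phi ((x - h * (j%:R - m)) / r)).
  by apply: (@cubic_bounded _ _ 1) => j; rewrite ger0_norm ?Phi_ge0 ?Phi_le1.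
have c3 : cubic (fun j => `|j%:R - m| ^+ 3) by exact: cubic_pow.
have h1 : `|step_exp a (fun j => Phi ((x - h * (j%:R - m)) / r)) - step_exp a Bq| <= 3 * c ^+ 3 * M3.
  have -> : step_exp a (fun j => Phi ((x - h * (j%:R - m)) / r)) - step_exp a Bq =
     step_exp a (fun j => Phi ((x - h * (j%:R - m)) / r) + (-1) * Bq j).
    by rewrite step_expD //; [rewrite step_expZ // mulN1r|exact: cubicZ].
  rewrite -(step_expZ a01 _ c3); apply: step_exp_norm_le => //.
  - by apply: cubicD => //; exact: cubicZ.
  - exact: cubicZ.
  move=> j; have := Phi_taylor y (- c * (j%:R - m)).
  have -> : y + - c * (j%:R - m) = (x - h * (j%:R - m)) / r.
    by rewrite /y /c; field; rewrite lt0r_neq0.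
  rewrite [`|- c * _|]normrM normrN (ger0_norm c0) [(c * _) ^+ 3]exprMn => hT.
  rewrite -(mulrA 3); apply: (le_trans _ hT).
  by rewrite le_eqVlt; apply/orP; left; apply/eqP; congr `|_|; rewrite /Bq; ring.
rewrite -/c.
(* heat equation: both second order terms are equal *)
have e2 : (h ^+ 2 * v) / (2 * s) * (y * gaussd y) = c ^+ 2 / 2 * (y * gaussd y) * v.
  by rewrite -r2 /c; field; rewrite lt0r_neq0.
move: tE; rewrite e2 => tE; move: EB h1; move: (step_exp a Bq) => eb -> h1.
apply: (le_trans (y := `|step_exp a (fun j => Phi ((x - h * (j%:R - m)) / r)) -
  (Phi y + - (c ^+ 2 / 2 * (y * gaussd y)) * v)| +
  `|Phi (x / Num.sqrt (s + h ^+ 2 * v)) - Phi y + c ^+ 2 / 2 * (y * gaussd y) * v|)); last exact: lerD.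
rewrite -[X in _ <= _ + X]normrN; apply: le_trans (ler_normD _ _).
by rewrite le_eqVlt; apply/orP; left; apply/eqP; congr `|_|; ring.
Qed.
End CentralLimit.

(** * The central limit theorem *)

Section CentralLimitTheorem.
Variables (R : realType) (a : R).
Hypothesis a01 : 0 < a < 1.
Let m := step_mean a.
Let v := step_var a.
Let M3 := step_exp a (fun j => `|j%:R - m| ^+ 3).

(** The steps are replaced one by one.  The replaced ones have merged into
    the variance of the test function, which only increases, so the error of
    each replacement is bounded by the one at the initial value s0. *)
Lemma lindeberg (h x s0 s : R) l : 0 < s0 -> s0 <= s -> 0 <= h ->
  `|walk_exp a l (fun i => Phi ((x - h * (i%:R - l%:R * m)) / Num.sqrt s)) -
    Phi (x / Num.sqrt (s + l%:R * (h ^+ 2 * v)))| <=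
  l%:R * (3 * (h / Num.sqrt s0) ^+ 3 * M3 + 4 / s0 ^+ 2 * (h ^+ 2 * v) ^+ 2).
Proof.
move=> s00 + h0; set e := (X in _ <= _ * X).
have v0 : 0 <= h ^+ 2 * v by rewrite mulr_ge0 ?sqr_ge0 // (ltW (step_var_gt0 a01)).
elim: l s => [|l IH] s ss.
  by rewrite /= !mul0r subr0 mulr0 subr0 addr0 subrr normr0.
have s1 : 0 < s by exact: lt_le_trans ss.
have s1' := ltW s1; have s00' := ltW s00.
have := IH (s + h ^+ 2 * v) (le_trans ss (ler_wpDr v0 (lexx _))).
have -> : s + h ^+ 2 * v + l%:R * (h ^+ 2 * v) = s + l.+1%:R * (h ^+ 2 * v).
  by rewrite -natr1; ring.
set A := walk_exp a l _ => hA.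
rewrite [walk_exp a l.+1 _]/=; set A' := walk_exp a l _.
have hAA : `|A' - A| <= e.
  apply: (walk_exp_dist a01).
  - apply: (bounded_step_exp a01 (G := fun i => Phi ((x - h * (i%:R - l.+1%:R * m)) / Num.sqrt s))).
    exact: bounded_Phi.
  - exact: bounded_Phi.
  move=> i; have := step_bound a01 (x - h * (i%:R - l%:R * m)) s1 h0.
  have -> : (fun j => Phi ((x - h * (i%:R - l%:R * m) - h * (j%:R - step_mean a)) / Num.sqrt s)) =
     (fun j => Phi ((x - h * ((i + j)%:R - l.+1%:R * m)) / Num.sqrt s)).
    have sh (r1 r2 r3 r4 r5 r6 : R) :
      r1 - r2 * (r3 - r4 * r5) - r2 * (r6 - r5) = r1 - r2 * (r3 + r6 - (r4 + 1) * r5) by ring.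
    by apply/funext => j; rewrite -natr1 natrD -sh.
  move/le_trans; apply; rewrite /e lerD //.
    have q t : 0 <= h / Num.sqrt t by rewrite divr_ge0 ?sqrtr_ge0.
    rewrite ler_wpM2r ?(M3_ge0 a01) // ler_wpM2l // lerXn2r ?nnegrE ?q //.
    rewrite ler_wpM2l // lef_pV2 ?posrE ?sqrtr_gt0 // ler_sqrt //.
  rewrite ler_wpM2r ?sqr_ge0 // ler_wpM2l // lef_pV2 ?posrE ?exprn_gt0 //.
  by rewrite lerXn2r ?nnegrE.
rewrite -[X in X * e]natr1 mulrDl mul1r [leRHS]addrC.
by apply: le_trans (ler_distD A _ _) _; rewrite lerD.
Qed.

(** Smoothing at scale e changes the variance from 1 to 1 + e^2; this bounds
    the effect on the argument. *)
Lemma rescale_dist (z u d e : R) : `|u - z| <= d ->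
  `|u / Num.sqrt (e ^+ 2 + 1) - z| <= d + `|z| * e ^+ 2.
Proof.
move=> uz; set r := Num.sqrt _.
have e2 := sqr_ge0 e.
have r2 : r ^+ 2 = e ^+ 2 + 1 by rewrite sqr_sqrtr // addr_ge0.
have r0 : 0 <= r by rewrite sqrtr_ge0.
have r1 : 1 <= r by rewrite -(@expr_ge1 _ 2) // r2; lra.
have rp : 0 < r by lra.
have -> : u / r - z = ((u - z) - z * (r - 1)) / r by field; rewrite lt0r_neq0.
rewrite normrM normfV (gtr0_norm rp) ler_pdivrMr //.
have d0 : 0 <= d by apply: le_trans uz.
have h1 : `|u - z - z * (r - 1)| <= d + `|z| * e ^+ 2.
  apply: le_trans (ler_normB _ _) _; rewrite lerD // normrM ler_wpM2l //.
  rewrite ger0_norm; last by lra.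
  have : r <= r ^+ 2 by rewrite expr2 ler_peMr.
  by rewrite r2; lra.
apply: le_trans h1 _; rewrite ler_peMr // addr_ge0 // mulr_ge0 //.
Qed.

(** The indicator of w <= z lies between
    Phi ((z - d - w) / e) - Phi (- d / e) and
    Phi ((z + d - w) / e) + 1 - Phi (d / e).  Their expectations are estimated by
    lindeberg, with steps of size h such that the total variance l h^2 v is 1. *)
Lemma normal_approx (z d e : R) l : 0 < d -> 0 < e -> (0 < l)%N ->
  let h := (Num.sqrt (l%:R * v))^-1 in
  `|walk_exp a l (fun i => ((i%:R - l%:R * m) / Num.sqrt (l%:R * v) <= z)%R%:R) - Phi z| <=
  d + `|z| * e ^+ 2 + (1 - Phi (d / e) + Phi (- d / e)) +
  l%:R * (3 * (h / e) ^+ 3 * M3 + 4 / (e ^+ 2) ^+ 2 * (h ^+ 2 * v) ^+ 2).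
Proof.
move=> d0 e0 l0; lazy zeta; set h := (Num.sqrt _)^-1; have v0 : 0 < v := step_var_gt0 a01.
have lv0 : 0 < l%:R * v by rewrite mulr_gt0 // ltr0n.
have h0 : 0 < h by rewrite invr_gt0 sqrtr_gt0.
have h2 : l%:R * (h ^+ 2 * v) = 1.
  rewrite /h exprVn sqr_sqrtr; last exact: ltW.
  by rewrite mulrCA mulVf // lt0r_neq0.
set err := (X in _ <= _ + X).
have se : Num.sqrt (e ^+ 2) = e by rewrite sqrtr_sqr gtr0_norm.
have lind u : `|u - z| <= d ->
    `|walk_exp a l (fun i => Phi ((u - h * (i%:R - l%:R * m)) / e)) - Phi z| <= err + (d + `|z| * e ^+ 2).
  move=> uz; have := @lindeberg h u (e ^+ 2) (e ^+ 2) l (exprn_gt0 2 e0) (lexx _) (ltW h0).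
  rewrite h2 se -/err => b1; apply: (le_trans (ler_distD (Phi (u / Num.sqrt (e ^+ 2 + 1))) _ _)).
  apply: lerD; first exact: b1.
  exact: le_trans (Phi_lip _ _) (rescale_dist _ uz).
have bI : bounded_seq (fun i => ((i%:R - l%:R * m) * h <= z)%R%:R : R).
  exact: bounded_bool.
have bP u : bounded_seq (fun i => Phi ((u - h * (i%:R - l%:R * m)) / e)) by exact: bounded_Phi.
set I := walk_exp a l _.
have up : I <= walk_exp a l (fun i => Phi ((z + d - h * (i%:R - l%:R * m)) / e)) + (1 - Phi (d / e)).
  rewrite -[X in _ <= _ + X](walk_exp_cst a01 l) -(walk_expD a01 _ (bP _) (bounded_seq_cst _)).
  apply: (walk_exp_le a01) => //; first exact: (boundedD (bP _) (bounded_seq_cst _)).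
  move=> i; case: (boolP (_ <= z)) => /= hz; last first.
    by rewrite addr_ge0 ?Phi_ge0 // subr_ge0 Phi_le1.
  have : Phi (d / e) <= Phi ((z + d - h * (i%:R - l%:R * m)) / e); last by lra.
  apply: Phi_ndecr; rewrite ler_pM2r ?invr_gt0 //.
  by rewrite mulrC -/h in hz; lra.
have lo : walk_exp a l (fun i => Phi ((z - d - h * (i%:R - l%:R * m)) / e)) <= I + Phi (- d / e).
  rewrite /I -[X in _ <= _ + X](walk_exp_cst a01 l) -(walk_expD a01 _ bI (bounded_seq_cst _)).
  apply: (walk_exp_le a01) => //; first exact: (boundedD bI (bounded_seq_cst _)).
  move=> i; case: (boolP (_ <= z)) => /= hz.
    have := Phi_le1 ((z - d - h * (i%:R - l%:R * m)) / e).
    by have := Phi_ge0 (- d / e); lra.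
  rewrite add0r; apply: Phi_ndecr; rewrite ler_pM2r ?invr_gt0 //.
  by move: hz; rewrite -ltNge mulrC -/h => hz; lra.
have b1 := lind (z + d); have b2 := lind (z - d).
have e1 : `|z + d - z| <= d by rewrite addrC addKr gtr0_norm.
have e2 : `|z - d - z| <= d by rewrite addrC addKr normrN gtr0_norm.
have {b1} := b1 e1; have {b2} := b2 e2; rewrite !ler_norml => /andP[p1 p2] /andP[p3 p4].
have := Phi_ge0 (- d / e); have := Phi_le1 (d / e).
move: (`|z| * _) p1 p2 p3 p4 => w.
by lra.
Qed.

(** In normal_approx choose first d, then e small enough for the tails and
    the rescaling, then l so large that h, hence the Lindeberg error, is
    small. *)
Lemma central_limit (z eta : R) : 0 < eta -> exists l0 : nat, forall l, (l0 <= l)%N ->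
  `|walk_exp a l (fun i => ((i%:R - l%:R * m) / Num.sqrt (l%:R * v) <= z)%R%:R) - Phi z| <= eta.
Proof.
move=> eta0; have v0 : 0 < v := step_var_gt0 a01.
pose d := eta / 8; have d0 : 0 < d by rewrite divr_gt0.
(* a level T beyond which both normal tails are at most d *)
have [T T0 [T1 T2]] : exists2 T : R, 0 < T & 1 - Phi T <= d /\ Phi (- T) <= d.
  have /cvgrPdist_le /(_ d d0) [A [Ar hA]] := @Phi_cvgy R.
  have /cvgrPdist_le /(_ d d0) [B [Br hB]] := @Phi_cvgNy R.
  exists (`|A| + `|B| + 1); first by have := normr_ge0 A; have := normr_ge0 B; lra.
  split.
    apply: le_trans (hA _ _); first exact: ler_norm.
    by have := ler_norm A; have := normr_ge0 B; lra.
  have := hB (- (`|A| + `|B| + 1)); rewrite sub0r normrN => h.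
  apply: le_trans (ler_norm _) (h _).
  by have := ler_normr B; have := normr_ge0 A; have := ler_norm (- B); rewrite normrN; lra.
pose e := Num.min 1 (Num.min (d / T) (d / (`|z| + 1))).
have z1 : 0 < `|z| + 1 by rewrite ltr_wpDl.
have e0 : 0 < e by rewrite !lt_min ltr01 !divr_gt0.
have [e1 eT ez] : [/\ e <= 1, e <= d / T & e <= d / (`|z| + 1)].
  by split; rewrite /e !ge_min lexx ?orbT.
have tail1 : 1 - Phi (d / e) <= d.
  apply: le_trans T1; rewrite lerB // Phi_ndecr // ler_pdivlMr //.
  by rewrite mulrC -ler_pdivlMr.
have tail2 : Phi (- d / e) <= d.
  apply: le_trans T2; rewrite Phi_ndecr // mulNr lerN2 ler_pdivlMr //.
  by rewrite mulrC -ler_pdivlMr.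
have ze : `|z| * e ^+ 2 <= d.
  have he : e ^+ 2 <= e by rewrite expr2 ler_piMl // ltW.
  apply: (@le_trans _ _ (`|z| * e)); first by rewrite ler_wpM2l.
  apply: (@le_trans _ _ ((`|z| + 1) * e)); first by rewrite ler_wpM2r ?lerDl // ltW.
  by rewrite mulrC -ler_pdivlMr.
have M30 : 0 <= M3 by exact: M3_ge0.
(* the Lindeberg error is K1 h + K2 h^2 *)
pose K1 := 3 * M3 / (v * e ^+ 3); pose K2 := 4 * v / (e ^+ 2) ^+ 2.
have e0' := ltW e0; have v0' := ltW v0.
have K10 : 0 <= K1 by rewrite divr_ge0 // mulr_ge0 // exprn_ge0.
have K20 : 0 <= K2 by rewrite divr_ge0 ?exprn_ge0 // mulr_ge0.
pose c := Num.min 1 (d / (K1 + K2 + 1)).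
have k0 : 0 < K1 + K2 + 1 by rewrite ltr_wpDl // addr_ge0.
have c0 : 0 < c by rewrite lt_min ltr01 divr_gt0.
have [c1 cd] : c <= 1 /\ c <= d / (K1 + K2 + 1) by rewrite /c !ge_min !lexx orbT.
(* this makes l v >= c^-2, that is h <= c *)
exists (Num.truncn (1 / (c ^+ 2 * v))).+1 => l hl.
have l0 : (0 < l)%N by exact: leq_trans hl.
have lr : 0 < l%:R :> R by rewrite ltr0n.
have lv : 0 < l%:R * v by rewrite mulr_gt0.
have := @normal_approx z d e l d0 e0 l0; lazy zeta; move/le_trans; apply.
set h := (Num.sqrt _)^-1.
have h0 : 0 < h by rewrite invr_gt0 sqrtr_gt0.
have h2 : l%:R * h ^+ 2 = v^-1.
  rewrite /h exprVn sqr_sqrtr; last exact: ltW.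
  by rewrite invfM mulrA divff ?mul1r // lt0r_neq0.
have hc : h <= c.
  have h0' := ltW h0; have c0' := ltW c0.
  rewrite -(@ler_pXn2r _ 2) ?nnegrE // -(ler_pM2l lr) h2.
  have : 1 / (c ^+ 2 * v) <= l%:R.
    apply: ltW; apply: lt_le_trans (truncnS_gt _) _.
    by rewrite ler_nat.
  rewrite ler_pdivrMr; last exact: mulr_gt0 (exprn_gt0 2 c0) v0.
  move=> hh.
  by rewrite -(ler_pM2r v0) mulVf ?lt0r_neq0 // -mulrA.
have errE : l%:R * (3 * (h / e) ^+ 3 * M3 + 4 / (e ^+ 2) ^+ 2 * (h ^+ 2 * v) ^+ 2) =
    K1 * h + K2 * h ^+ 2.
  have -> : l%:R * (3 * (h / e) ^+ 3 * M3 + 4 / (e ^+ 2) ^+ 2 * (h ^+ 2 * v) ^+ 2) =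
    (l%:R * h ^+ 2) * (3 * M3 * h / e ^+ 3 + 4 / (e ^+ 2) ^+ 2 * h ^+ 2 * v ^+ 2).
    by field; rewrite lt0r_neq0.
  by rewrite h2 /K1 /K2; field; rewrite !lt0r_neq0.
rewrite errE.
have : K1 * h + K2 * h ^+ 2 <= d.
  have h0' := ltW h0; have h1 := le_trans hc c1.
  have hh : h ^+ 2 <= h by rewrite expr2 ler_piMl.
  apply: (@le_trans _ _ ((K1 + K2 + 1) * c)); last by rewrite mulrC -ler_pdivlMr.
  apply: (@le_trans _ _ ((K1 + K2 + 1) * h)); last by rewrite ler_wpM2l // ltW.
  by have := ler_wpM2l K20 hh; lra.
have d8 : eta = d * 8 by rewrite /d; field.
by rewrite d8; lra.
Qed.

End CentralLimitTheorem.

(** * Point masses of the sum of steps *)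

Section MassFunction.
Variables (R : realType) (a : R).
Hypothesis a01 : 0 < a < 1.

Definition sum_pmf (l i : nat) := schur_q i (nseq l a) / step_mass a ^+ l.

Lemma sum_pmf_ge0 l i : 0 <= sum_pmf l i.
Proof.
rewrite /sum_pmf -(walk_exp_delta a01) -(walk_exp_cst a01 l 0).
apply: (walk_exp_le a01); [exact: bounded_seq_cst|exact: bounded_bool|by []].
Qed.

Lemma step_exp_tail k : step_exp a (fun j => (k < j)%N%:R) <= 2 * a ^+ k.+1.
Proof.
case/andP: a01 => a0 a1.
have cd k' : cubic (fun j => (k' <= j)%N%:R : R).
  by apply: (@cubic_bounded _ _ 1) => j; case: (k' <= j)%N; rewrite ?normr1 ?normr0.
have gd k' : geom_sum a (fun j => (k' <= j)%N%:R) = a ^+ k' * geom_sum a (fun=> 1).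
  elim: k' => [|k' IH]; first by rewrite expr0 mul1r.
  by rewrite (geom_sum_rec a01 (cd _)) /= add0r -[X in geom_sum a X]/(fun j => (k' <= j)%N%:R) IH exprS mulrA.
rewrite /step_exp /= add0r -[X in geom_sum a X]/(fun j => (k <= j)%N%:R) gd (geom_sum_cst a01) /step_mass.
have n0 : 0 < 1 - a by rewrite subr_gt0.
have n1 : 0 < 1 + a by rewrite addr_gt0.
have -> : 2 * (a * (a ^+ k / (1 - a))) / ((1 + a) / (1 - a)) = 2 * a ^+ k.+1 / (1 + a).
  by rewrite exprS; field; rewrite !lt0r_neq0.
rewrite ler_pdivrMr // ler_peMr ?lerDl ?mulr_ge0 ?exprn_ge0 // ltW //.
Qed.

(** If the sum of l + 1 steps is large, then the sum of the first l or the
    last step is large. *)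
Lemma walk_exp_tail l (eta : R) : 0 < eta ->
  exists k0, forall k, (k0 <= k)%N -> walk_exp a l (fun i => (k < i)%N%:R) <= eta.
Proof.
case/andP: (a01) => a0 a1.
elim: l eta => [|l IH] eta eta0; first by exists 0%N => k _; rewrite /= ltW.
have e2 : 0 < eta / 2 by rewrite divr_gt0.
have [k1 h1] := IH _ e2.
have : (fun n => a ^+ n) @ \oo --> (0 : R) by apply: cvg_expr; rewrite gtr0_norm.
move/cvgrPdist_le => /(_ (eta / 4)) []; first by rewrite divr_gt0.
move=> k2 _ hk2; exists (k1 + k2)%N => k hk.
have step : step_exp a (fun j => (k2 < j)%N%:R) <= eta / 2.
  apply: le_trans (step_exp_tail k2) _.
  have a0' := ltW a0; have := hk2 k2.+1 (leqnSn _); rewrite sub0r normrN ger0_norm ?exprn_ge0 //.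
  by move=> h; lra.
have -> : eta = eta / 2 + eta / 2 by field.
apply: le_trans (lerD (h1 k1 (leqnn _)) (lexx _)).
rewrite -[X in _ <= _ + X](walk_exp_cst a01 l) -(walk_expD a01 _ (bounded_bool _ _) (bounded_seq_cst _)) /=.
have bE : bounded_seq (fun i => step_exp a (fun j => (k < i + j)%N%:R) : R).
  by apply: (bounded_step_exp a01 (G := fun i => (k < i)%N%:R)); exact: bounded_bool.
apply: (walk_exp_le a01) => //.
  by apply: boundedD; [exact: bounded_bool|exact: bounded_seq_cst].
move=> i.
have cb (p : nat -> bool) : cubic (fun j => (p j)%:R : R).
  by apply: (@cubic_bounded _ _ 1) => j; case: (p j); rewrite ?normr1 ?normr0.
case: (leqP i k1) => ik /=.
  rewrite add0r; apply: le_trans step; apply: (step_exp_le a01) => //.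
  by move=> j; rewrite ler_nat; case: (ltnP k2 j) => //= jk; case: ltnP => //; lia.
apply: (@le_trans _ _ 1); last by rewrite lerDl ltW.
rewrite -[leRHS](step_exp_cst a01); apply: (step_exp_le a01) => //; first exact: cubic_cst.
by move=> j; case: ltnP => _; rewrite ?ler01.
Qed.

Lemma walk_exp_sum_pmf (f : nat -> bool) l n :
  \sum_(i < n) (f i)%:R * sum_pmf l i = walk_exp a l (fun i => (f i && (i < n)%N)%:R).
Proof.
under eq_bigr => i _ do rewrite /sum_pmf -(walk_exp_delta a01) -(walk_expZ a01 _ _ (bounded_bool _ _)).
rewrite -(walk_exp_sum a01); last by move=> i; apply: boundedZ; exact: bounded_bool.
congr (walk_exp a l _); apply/funext => i.
case: (ltnP i n) => ik; last first.
  rewrite andbF big1 // => k _.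
  by rewrite gtn_eqF ?mulr0 // (leq_trans _ ik).
rewrite (bigD1 (Ordinal ik)) //= eqxx mulr1 big1 ?addr0 ?andbT // => k.
by rewrite -val_eqE /= eq_sym => /negbTE ->; rewrite mulr0.
Qed.

Lemma walk_exp_cvg (f : nat -> bool) l :
  (fun n => \sum_(i < n) (f i)%:R * sum_pmf l i) @ \oo --> walk_exp a l (fun i => (f i)%:R).
Proof.
apply/cvgrPdist_le => e e0; have [k0 hk] := walk_exp_tail l e0.
exists k0.+1 => // n /= kn; rewrite walk_exp_sum_pmf.
have kn' : (k0 <= n.-1)%N by lia.
have := hk _ kn'; apply: le_trans.
have b1 := bounded_bool R f.
have b2 := bounded_bool R (fun i => f i && (i < n)%N).
have b3 := bounded_bool R (fun i => (n.-1 < i)%N).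
have le1 : walk_exp a l (fun i => (f i && (i < n)%N)%:R) <= walk_exp a l (fun i => (f i)%:R).
  by apply: (walk_exp_le a01) => // i; case: (f i) => //=; case: ltnP.
rewrite ger0_norm ?subr_ge0 // lerBlDl -(walk_expD a01) //.
apply: (walk_exp_le a01) => //; first exact: boundedD.
move=> i; case: (f i) => /=; last by rewrite add0r ler0n.
by rewrite -natrD ler_nat; case: ltnP => /= h; lia.
Qed.

End MassFunction.

Section Triangle.
Variables (R : realType) (a b : R).
Hypotheses (a01 : 0 < a < 1) (b01 : 0 < b < 1).

(** The sum over pairs i <= m < n is a sum over the triangle i + j < n.  It
    contains the square of side n / 2 and is contained in the square of side n,
    and the terms are nonnegative. *)
Lemma triangle_cvg (f g : nat -> bool) l :
  (fun n => \sum_(i < n) \sum_(m < n | (i <= m)%N)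
     (f i)%:R * (g (m - i)%N)%:R * (sum_pmf a l i * sum_pmf b l (m - i))) @ \oo -->
  walk_exp a l (fun i => (f i)%:R) * walk_exp b l (fun j => (g j)%:R).
Proof.
pose u i := (f i)%:R * sum_pmf a l i; pose w j := (g j)%:R * sum_pmf b l j.
have u0 i : 0 <= u i by rewrite mulr_ge0 ?sum_pmf_ge0.
have w0 i : 0 <= w i by rewrite mulr_ge0 ?sum_pmf_ge0.
have TE n : \sum_(i < n) \sum_(m < n | (i <= m)%N)
     (f i)%:R * (g (m - i)%N)%:R * (sum_pmf a l i * sum_pmf b l (m - i)) =
     \sum_(i < n) u i * \sum_(j < n - i) w j.
  apply: eq_bigr => i _.
  rewrite -(big_geq_mkord _ _ xpredT (fun m =>
    (f i)%:R * (g (m - i)%N)%:R * (sum_pmf a l i * sum_pmf b l (m - i)))).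
  rewrite -{1}[nat_of_ord i]add0n big_addn big_mkord big_distrr /=.
  by apply: eq_bigr => j _; rewrite addnK /u /w; ring.
have cu := @walk_exp_cvg _ _ a01 f l; have cw := @walk_exp_cvg _ _ b01 g l.
have cup : (fun n => (\sum_(i < n) u i) * (\sum_(j < n) w j)) @ \oo -->
    walk_exp a l (fun i => (f i)%:R) * walk_exp b l (fun j => (g j)%:R) by exact: cvgM.
have half : (fun n : nat => n./2) @ \oo --> \oo.
  by move=> A [N _ hN]; exists N.*2 => // n /= Nn; apply: hN => /=; lia.
have clo := cvg_comp _ _ half cup.
apply: (squeeze_cvgr _ clo cup).
apply: nearW => n /=; rewrite TE; apply/andP; split; last first.
  rewrite big_distrl /=; apply: ler_sum => i _; rewrite ler_wpM2l //.
  rewrite -(big_mkord xpredT w) -(big_mkord xpredT w) [leRHS](big_cat_nat (n := (n - i)%N)) ?leq_subr //=.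
  by rewrite lerDl sumr_ge0.
rewrite -/u -/w.
have nn : (n./2 <= n)%N by lia.
rewrite -(big_mkord xpredT u) -(big_mkord xpredT (fun i => u i * \sum_(j < n - i) w j)).
rewrite [leRHS](big_cat_nat (n := n./2)) //=.
apply: ler_wpDr; first by apply: sumr_ge0 => i _; rewrite mulr_ge0 ?sumr_ge0.
rewrite big_distrl /= !big_nat; apply: ler_sum => i /= iN; rewrite ler_wpM2l //.
rewrite -(big_mkord xpredT w) -(big_mkord xpredT w) [leRHS](big_cat_nat (n := n./2)) //=; last by lia.
by rewrite lerDl sumr_ge0.
Qed.

End Triangle.

(** * Random variables with a mass function *)

Section DiscreteLaw.
Variables (R : realType) (d : measure_display) (Omega : measurableType d).
Variable P : probability Omega R.

Lemma law_seq (T : choiceType) (Z : Omega -> T) (w : T -> R) (s : seq T) :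
  has_law P Z w -> uniq s ->
  measurable (Z @^-1` [set` s]) /\ P (Z @^-1` [set` s]) = (\sum_(t <- s) w t)%:E.
Proof.
move=> law us.
have -> : Z @^-1` [set` s] = \bigcup_(t in [set` s]) (Z @^-1` [set t]).
  by rewrite -preimage_bigcup bigcup_imset1 image_id.
have ms t : [set` s] t -> measurable (Z @^-1` [set t]) by move=> _; case: (law t).
split; first exact: fin_bigcup_measurable.
rewrite measure_fin_bigcup //; last exact: trivIset_preimage1.
rewrite -fsbig_seq // -sumEFin; apply: eq_bigr => t _.
by case: (law t).
Qed.

(** The law of a function h of Z, when h has the finite fibres s. *)
Lemma law_comp (T U : choiceType) (Z : Omega -> T) (w : T -> R) (h : T -> U)
    (s : U -> seq T) : has_law P Z w ->
  (forall u, uniq (s u)) -> (forall u t, (t \in s u) = (h t == u)) ->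
  has_law P (h \o Z) (fun u => \sum_(t <- s u) w t).
Proof.
move=> law us ms u.
have -> : (h \o Z) @^-1` [set u] = Z @^-1` [set` s u].
  apply/seteqP; split => om /=; first by move=> e; rewrite ms e eqxx.
  by rewrite ms => /eqP.
exact: law_seq.
Qed.

(** The squares below n exhaust the grid, so the measure of an event is the
    limit of finite sums of masses. *)
Lemma law_grid_cvg (Z : Omega -> nat * nat) (w : nat * nat -> R) (Q : nat -> nat -> bool) :
  has_law P Z w ->
  (fun n => (\sum_(i < n) \sum_(m < n) (Q i m)%:R * w (i : nat, m : nat))%:E) @ \oo -->
  P [set om | Q (Z om).1 (Z om).2].
Proof.
move=> law.
pose s n := [seq p <- [seq (i, m) | i <- iota 0 n, m <- iota 0 n] | Q p.1 p.2].
have us n : uniq (s n).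
  rewrite filter_uniq // allpairs_uniq ?iota_uniq //.
  by move=> [i m] [i' m'] _ _ /= [-> ->].
have ins n p : (p \in s n) = [&& Q p.1 p.2, (p.1 < n)%N & (p.2 < n)%N].
  rewrite mem_filter; congr (_ && _); apply/allpairsP/andP => [[[i m] /= []]|[h1 h2]].
    by rewrite !mem_iota /= => h1 h2 ->.
  by exists p; rewrite !mem_iota /= h1 h2 -surjective_pairing.
have E n := law_seq law (us n).
have -> : [set om | Q (Z om).1 (Z om).2] = \bigcup_n (Z @^-1` [set` s n]).
  apply/seteqP; split => om /=.
    move=> h; exists (maxn (Z om).1 (Z om).2).+1 => //=.
    by rewrite ins h !ltnS leq_maxl leq_maxr.
  by move=> [n _] /=; rewrite ins => /andP[].
have -> : (fun n => (\sum_(i < n) \sum_(m < n) (Q i m)%:R * w (i : nat, m : nat))%:E) =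
    P \o (fun n => Z @^-1` [set` s n]).
  apply/funext => n /=; case: (E n) => _ ->; congr (_%:E).
  rewrite big_filter [RHS]big_mkcond [RHS]big_allpairs_dep /=.
  rewrite -[in RHS](subn0 n) [RHS]big_mkord; apply: eq_bigr => i _.
  rewrite [RHS]big_mkord; apply: eq_bigr => m _ /=.
  by case: (Q i m); rewrite ?mul1r ?mul0r.
apply: nondecreasing_cvg_mu => [n||n n' nn'].
- by case: (E n).
- by apply: bigcup_measurable => n _; case: (E n).
- apply/subsetPset => om /=; rewrite !ins => /and3P[-> h1 h2] /=.
  by rewrite (leq_trans h1) // (leq_trans h2).
Qed.
End DiscreteLaw.

(** * The joint law of the two sizes *)

Section PairLaw.
Variables (R : realType) (skewQ : strict_part -> strict_part -> seq R -> R).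
Hypothesis skewQP : is_skew_schur_Q skewQ.
Variables (a b : R).
Hypotheses (a01 : 0 < a < 1) (b01 : 0 < b < 1).
Variables (q x y : R) (M N : nat).
Hypotheses (aE : a = q * x * y) (bE : b = x * y).
Variables (d : measure_display) (Omega : measurableType d).
Variable P : probability Omega R.
Variables mu lam : Omega -> strict_part.
Hypothesis law : has_law P (fun w => (mu w, lam w)) (PqXY skewQ q (nseq M x) (nseq N y)).

Lemma allpairs_nseq (u v : R) m n : [seq a * b | a <- nseq m u, b <- nseq n v] = nseq (m * n) (u * v).
Proof.
elim: m => //= m IH; rewrite IH map_nseq mulSn.
by rewrite nseqD.
Qed.

Let L := (M * N)%N.
Let K := step_mass a ^+ L * step_mass b ^+ L /
  (HH (scale_alphabet q (nseq M x)) (nseq N y) * HH (nseq M x) (nseq N y)).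

(** The mass of (i, n) is the sum of the weights of all pairs with |mu| = i
    and |lam| = n.  For n < i there is no inclusion and the mass is zero. *)
Lemma size_law : has_law P (fun w => (sumn (mu w), sumn (lam w)))
  (fun p => if (p.1 <= p.2)%N then K * (sum_pmf a L p.1 * sum_pmf b L (p.2 - p.1)) else 0).
Proof.
(* the fibre of the map to the sizes is finite and enumerated by s *)
pose sz (t : strict_part * strict_part) := (sumn t.1, sumn t.2).
pose s (u : nat * nat) := [seq (m, l) | l <- strict_parts u.2, m <- strict_parts u.1].
have us u : uniq (s u).
  rewrite allpairs_uniq ?strict_parts_uniq //.
  by move=> [m l] [m' l'] _ _ /= [-> ->].
have ms u t : (t \in s u) = (sz t == u).
  apply/allpairsP/eqP => [[[l m] /= []]|<-].
    by rewrite !mem_strict_parts /sz => /eqP el /eqP em -> /=; rewrite el em -surjective_pairing.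
  by exists (t.2, t.1); rewrite !mem_strict_parts /= !eqxx -surjective_pairing.
have := law_comp law us ms; rewrite /comp /sz /=.
set w := (X in has_law _ _ X -> _) => h; set w' := (X in has_law _ _ X).
suff -> : w' = w by [].
apply/funext => -[i n]; rewrite /w' /w /= big_allpairs_dep /=.
set C := HH _ _ * HH _ _.
transitivity ((\sum_(l <- strict_parts n) \sum_(m <- strict_parts i | part_sub m l)
   schur_Q m (scale_alphabet q (nseq M x)) * skewQ l m (nseq M x) * schur_P l (nseq N y)) / C); last first.
  rewrite big_distrl; apply: eq_bigr => l _; rewrite big_distrl /= big_mkcond.
  by apply: eq_bigr => m _; case: ifP.
case: leqP => [ilen|ltin]; last first.
  rewrite big_seq big1 ?mul0r // => l; rewrite mem_strict_parts => /eqP el.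
  rewrite big_seq_cond big1 // => m /andP[]; rewrite mem_strict_parts => /eqP em /part_sub_sumn.
  by rewrite el em leqNgt ltin.
rewrite (skew_pair_sum skewQP) // [scale_alphabet _ _]map_nseq !allpairs_nseq -aE -bE.
rewrite /K -/C /sum_pmf -/L.
have := step_mass_gt0 a01; have := step_mass_gt0 b01.
move: (step_mass a) (step_mass b) => ma mb mb0 ma0.
move: (C^-1) => c; field.
by rewrite !expf_neq0 ?lt0r_neq0.
Qed.

(** By triangle_cvg the masses of size_law sum up to K times a product of
    expectations; the certain event shows K = 1. *)
Lemma pair_prob (Q : nat -> nat -> bool) (f g : nat -> bool) :
  (forall i n, (i <= n)%N -> Q i n = f i && g (n - i)%N) ->
  P [set w | Q (sumn (mu w)) (sumn (lam w))] =
  (walk_exp a L (fun i => (f i)%:R) * walk_exp b L (fun j => (g j)%:R))%:E.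
Proof.
have main (Q' : nat -> nat -> bool) (f' g' : nat -> bool) :
  (forall i n, (i <= n)%N -> Q' i n = f' i && g' (n - i)%N) ->
  P [set w | Q' (sumn (mu w)) (sumn (lam w))] =
  (K * (walk_exp a L (fun i => (f' i)%:R) * walk_exp b L (fun j => (g' j)%:R)))%:E.
  move=> hQ; have h1 := law_grid_cvg (Q := Q') size_law.
  have h2 : (fun n => K * \sum_(i < n) \sum_(m < n | (i <= m)%N)
      (f' i)%:R * (g' (m - i)%N)%:R * (sum_pmf a L i * sum_pmf b L (m - i))) @ \oo -->
      K * (walk_exp a L (fun i => (f' i)%:R) * walk_exp b L (fun j => (g' j)%:R)).
    by apply: cvgM; [exact: cvg_cst|exact: triangle_cvg].
  apply: (cvg_unique _ h1); first exact: ereal_hausdorff.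
  apply: cvg_EFin; first exact: nearW.
  apply: cvg_trans h2; apply: near_eq_cvg; apply: nearW => n /=.
  rewrite big_distrr; apply: eq_bigr => i _.
  rewrite big_distrr [LHS]big_mkcond; apply: eq_bigr => m _ /=.
  case: ifP => im; rewrite ?mulr0 //.
  by rewrite hQ //; case: (f' i); case: (g' _); rewrite /= ?mul1r ?mul0r ?mulr0.
have K1 : K = 1.
  have := main (fun _ _ => true) (fun=> true) (fun=> true) (fun _ _ _ => erefl).
  rewrite (walk_exp_cst a01) (walk_exp_cst b01) !mulr1.
  have -> : [set w : Omega | true] = setT by apply/seteqP; split.
  by rewrite probability_setT => -[].
by move=> /main; rewrite K1 mul1r.
Qed.
End PairLaw.

(** * The limit law *)

Section Limit.
Variable R : realType.

(** The lower quadrant is a product of two half-lines. *)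
Lemma Phi_product (z : R * R) :
  (normal_prob 0 1 \x normal_prob 0 1)%E (lower_quadrant z) = (Phi z.1 * Phi z.2)%:E.
Proof.
have -> : lower_quadrant z = `]-oo, z.1] `*` `]-oo, z.2].
  by apply/seteqP; split => -[u w] /=; rewrite !in_itv.
by rewrite product_measure1E // EFinM !Phi_E.
Qed.

Lemma standardized_cvg (a z : R) (L : nat -> nat) : 0 < a < 1 -> L @ \oo --> \oo ->
  (fun k => walk_exp a (L k) (fun i =>
     ((i%:R - (L k)%:R * step_mean a) / Num.sqrt ((L k)%:R * step_var a) <= z)%R%:R)) @ \oo --> Phi z.
Proof.
move=> a01 Loo; apply/cvgrPdist_le => e e0.
have [l0 hl0] := central_limit a01 z e0.
have large : \forall k \near \oo, (l0 <= L k)%N by exact: (Loo _ (nbhs_infty_ge l0)).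
by near=> k; rewrite distrC hl0 //; near: k.
Unshelve. all: end_near.
Qed.
End Limit.

Theorem corollary10p3 (R : realType)
    (* the skew Schur Q-functions *)
    (skewQ : strict_part -> strict_part -> seq R -> R)
    (skewQP : is_skew_schur_Q skewQ)
    (a b : R) (a01 : 0 < a < 1) (b01 : 0 < b < 1)
    (* parameters along an arbitrary sequence with a, b fixed and M N -> oo *)
    (q x y : nat -> R) (M N : nat -> nat)
    (q_ge0 : forall k, 0 <= q k)
    (x_ge0 : forall k, 0 <= x k)
    (y_ge0 : forall k, 0 <= y k)
    (qxy_lt1 : forall k, Num.max 1 (q k) * (x k * y k) < 1)
    (M_ge1 : forall k, (1 <= M k)%N)
    (N_ge1 : forall k, (1 <= N k)%N)
    (aE : forall k, a = q k * x k * y k)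
    (bE : forall k, b = x k * y k)
    (L_oo : (fun k => (M k * N k)%N) @ \oo --> \oo)
    (d : nat -> measure_display)
    (Omega : forall k, measurableType (d k))
    (P : forall k, probability (Omega k) R)
    (mu lam : forall k, Omega k -> strict_part)
    (law : forall k,
      has_law (P k) (fun w => (mu k w, lam k w))
        (PqXY skewQ (q k) (nseq (M k) (x k)) (nseq (N k) (y k)))) :
  let L k : R := (M k * N k)%:R in
  let B k (w : Omega k) : R := (sumn (mu k w))%:R in
  let Rr k (w : Omega k) : R := (sumn (lam k w))%:R - (sumn (mu k w))%:R in
  cvg_in_distribution2 P
    (fun k w =>
      ((B k w - 2 * L k * a / (1 - a ^+ 2)) /
         Num.sqrt (2 * L k * a * (1 + a ^+ 2) / (1 - a ^+ 2) ^+ 2),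
       (Rr k w - 2 * L k * b / (1 - b ^+ 2)) /
         Num.sqrt (2 * L k * b * (1 + b ^+ 2) / (1 - b ^+ 2) ^+ 2)))
    (normal_prob 0 1 \x normal_prob 0 1)%E.
Proof.
move=> L B Rr F z _; rewrite {}/F Phi_product.
pose below (c t : R) k (j : R) := (j - L k * step_mean c) / Num.sqrt (L k * step_var c) <= t.
pose W c t k := walk_exp c (M k * N k) (fun i => (below c t k i%:R)%:R).
have prob_split k : P k ((fun w =>
      ((B k w - 2 * L k * a / (1 - a ^+ 2)) /
         Num.sqrt (2 * L k * a * (1 + a ^+ 2) / (1 - a ^+ 2) ^+ 2),
       (Rr k w - 2 * L k * b / (1 - b ^+ 2)) /
         Num.sqrt (2 * L k * b * (1 + b ^+ 2) / (1 - b ^+ 2) ^+ 2)))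
      @^-1` lower_quadrant z) = (W a z.1 k * W b z.2 k)%:E.
  have meanE (c : R) : 2 * L k * c / (1 - c ^+ 2) = L k * step_mean c.
    by rewrite /step_mean [2 * _]mulrC -!mulrA.
  have varE (c : R) :
      2 * L k * c * (1 + c ^+ 2) / (1 - c ^+ 2) ^+ 2 = L k * step_var c.
    by rewrite /step_var [2 * _]mulrC -!mulrA.
  rewrite !meanE !varE.
  (* on |mu| <= |lam| the event splits into conditions on |mu| and on the
     difference of the sizes *)
  rewrite -(pair_prob skewQP a01 b01 (aE k) (bE k) (law k)
    (Q := fun i n => below a z.1 k i%:R && below b z.2 k (n%:R - i%:R))
    (f := fun i => below a z.1 k i%:R) (g := fun j => below b z.2 k j%:R)); last first.
    by move=> i n le_in; rewrite natrB.
  congr (P k _); apply/seteqP; split => w /=; first by move=> [h1 h2]; apply/andP.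
  by move/andP.
rewrite (_ : (fun k => _) = (fun k => (W a z.1 k * W b z.2 k)%:E)); last first.
  by apply/funext => k; exact: prob_split.
apply: cvg_EFin; first exact: nearW.
by apply: cvgM; apply: standardized_cvg.
Qed.
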